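(* Let $p\in(2,3)$, $y_0\in\mathbb R^k$, $\mathbf X=(X,\mathbb X)\in\mathcal D^p([0,T];\mathbb R^d)$, and consider the rough differential equation $$Y_t=y_0+\int_0^tf(Y_s)\,\mathrm d\mathbf X_s,\qquad t\in[0,T].\qquad(\ast)$$ (i) If $f\in C^3_b(\mathbb R^k;\mathcal L(\mathbb R^d;\mathbb R^k))$, then there exists a unique solution $(Y,Y')\in\mathcal V^p_X([0,T];\mathbb R^k)$ to $(\ast)$. Moreover, there exists a (componentwise) non-decreasing function $K_p\colon[0,\infty)^2\to[0,\infty)$ (depending only on $p$ and the dimensions) such that $$\|Y,Y'\|_{X,p}\le K_p(\|f\|_{C^2_b},\|\mathbf X\|_p).$$ (ii) Let $f\in C^3_b(\mathbb R^k;\mathcal L(\mathbb R^d;\mathbb R^k))$ and let $(Y,Y')\in\mathcal V^p_X([0,T];\mathbb R^k)$ be the unique solution to $(\ast)$. Let moreover $\tilde y_0\in\mathbb R^k$, $\tilde f\in C^3_b(\mathbb R^k;\mathcal L(\mathbb R^d;\mathbb R^k))$, $\widetilde{\mathbf X}=(\widetilde X,\widetilde{\mathbb X})\in\mathcal D^p([0,T];\mathbb R^d)$ with corresponding solution $(\widetilde Y,\widetilde Y')\in\mathcal V^p_{\widetilde X}([0,T];\mathbb R^k)$ of $\widetilde Y_t=\tilde y_0+\int_0^t\tilde f(\widetilde Y_s)\,\mathrm d\widetilde{\mathbf X}_s$, and suppose that $\|Y,Y'\|_{X,p},\|\widetilde Y,\widetilde Y'\|_{\widetilde X,p}\le K$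 for some $K>0$. Then $$|Y_0-\widetilde Y_0|+\|Y,Y';\widetilde Y,\widetilde Y'\|_{X,\widetilde X,p}\lesssim|y_0-\tilde y_0|+\|f-\tilde f\|_{C^2_b}+\|\mathbf X;\widetilde{\mathbf X}\|_p,$$ where the implicit multiplicative constant depends on $p$, $\|f\|_{C^3_b}\vee\|\tilde f\|_{C^3_b}$, $K$, $\|\mathbf X\|_p$ and $\|\widetilde{\mathbf X}\|_p$.
   Context: Fix $T>0$ and $\Delta_T=\{(s,t)\in[0,T]^2:s\le t\}$. $\mathcal L(E_1;E_2)$ is the space of linear maps. $C^k_b$ is the space of $k$-times Fréchet differentiable functions that are continuous and bounded together with all derivatives up to order $k$, with $\|f\|_{C^k_b}=\|f\|_\infty+\|\mathrm Df\|_\infty+\dots+\|\mathrm D^kf\|_\infty$. $X_{s,t}=X_t-X_s$. Variation norms. For a càdlàg path $X\colon[0,T]\to E$, $\|X\|_{p,[s,t]}=(\sup_{\mathcal P}\sum_{[u,v]\in\mathcal P}|X_v-X_u|^p)^{1/p}$ over partitions $\mathcal P$ of $[s,t]$, $\|X\|_p=\|X\|_{p,[0,T]}$; $D^p([0,T];E)$ is the set of càdlàg paths with $\|X\|_p<\infty$. For $\mathbb X\colon\Delta_T\to E$, $\|\mathbb X\|_{\frac p2}=(\sup_{\mathcal P}\sum_{[u,v]\in\mathcal P}|\mathbb X_{u,v}|^{p/2})^{2/p}$ over partitions of $[0,T]$; $D_2^{p/2}(\Delta_T;E)$ is the set of $\mathbb X$ with $\|\mathbb X\|_{\frac p2}<\infty$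 such that $s\mapsto\mathbb X_{s,t}$ and $t\mapsto\mathbb X_{s,t}$ are càdlàg. Rough paths. $\mathbf X=(X,\mathbb X)\in\mathcal D^p([0,T];\mathbb R^d)$ (càdlàg $p$-rough path) if $X\in D^p([0,T];\mathbb R^d)$, $\mathbb X\in D_2^{p/2}(\Delta_T;\mathbb R^{d\times d})$ and $\mathbb X_{s,t}=\mathbb X_{s,u}+\mathbb X_{u,t}+X_{s,u}\otimes X_{u,t}$ for $s\le u\le t$. $\|\mathbf X\|_p=\|X\|_p+\|\mathbb X\|_{\frac p2}$, $\|\mathbf X;\widetilde{\mathbf X}\|_p=\|X-\widetilde X\|_p+\|\mathbb X-\widetilde{\mathbb X}\|_{\frac p2}$. Controlled paths. $(Y,Y')\in\mathcal V^p_X([0,T];E)$ if $Y\in D^p([0,T];E)$, $Y'\in D^p([0,T];\mathcal L(\mathbb R^d;E))$ and $R^Y\in D_2^{p/2}(\Delta_T;E)$, $R^Y_{s,t}=Y_{s,t}-Y'_sX_{s,t}$. $\|Y,Y'\|_{X,p}=|Y'_0|+\|Y'\|_p+\|R^Y\|_{\frac p2}$, and for $(Y,Y')\in\mathcal V^p_X$, $(\widetilde Y,\widetilde Y')\in\mathcal V^p_{\widetilde X}$, $\|Y,Y';\widetilde Y,\widetilde Y'\|_{X,\widetilde X,p}=|Y'_0-\widetilde Y'_0|+\|Y'-\widetilde Y'\|_p+\|R^Y-R^{\widetilde Y}\|_{\frac p2}$. Rough integral. For $(V,V')\in\mathcal V^p_X([0,T];\mathcal L(\mathbb R^d;\mathbb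 R^k))$, $\int_s^tV_r\,\mathrm d\mathbf X_r=\lim_{|\mathcal P|\to0}\sum_{[u,v]\in\mathcal P}(V_uX_{u,v}+V'_u\mathbb X_{u,v})$ over partitions of $[s,t]$ with mesh tending to $0$, using $\mathcal L(\mathbb R^d;\mathcal L(\mathbb R^d;\mathbb R^k))\cong\mathcal L(\mathbb R^d\otimes\mathbb R^d;\mathbb R^k)$. In $(\ast)$ the integrand is the controlled path $(f(Y),\mathrm Df(Y)Y')$, and a solution is a controlled path $(Y,Y')\in\mathcal V^p_X([0,T];\mathbb R^k)$ with $Y'=f(Y)$ satisfying $(\ast)$. $A\lesssim B$ means $A\le CB$ for a constant $C$ whose dependence on the listed variables is locally bounded (it may also depend on dimensions). *)

(* Defs.v *)
From HB Require Import structures.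
From mathcomp Require Import all_boot all_order all_algebra.
From mathcomp Require Import all_classical all_reals all_analysis.

Set Implicit Arguments.
Unset Strict Implicit.
Unset Printing Implicit Defensive.
Import Order.TTheory GRing.Theory Num.Theory.
Import numFieldNormedType.Exports.
Local Open Scope classical_set_scope.
Local Open Scope ring_scope.

(* Conventions.
   - R^n is 'rV[R]_n and L(R^m; R^n) is 'M[R]_(m, n), a matrix A acting on the
     right, v |-> v *m A.  A linear map from R^l into the matrix space
     'M_(m, n) is an element of 'M_(l, m * n), via mxvec.
   - R^d (x) R^d is 'M[R]_d, with x (x) y = x^T *m y.
   - The norm on all these spaces is the norm `|_| of the normed module
     'M[R]_(m, n), i.e. the maximum of the absolute values of the entries; it is
     equivalent, up to factors depending on the dimensions, to the Euclidean
     and to the operator norms.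
   - A path on [0, T] is a function on R of which only the values on [0, T]
     matter, a two-parameter path on Delta_T is a function R -> R -> _ of which
     only the values at 0 <= s <= t <= T matter.
   - A partition of [a, b] is the sequence s of its points other than a
     (itv_partition a b s).
   - The norms are extended-real-valued. *)

Section Variation.
Context {R : realType} {V : normedModType R}.

Definition incr (X : R -> V) (s t : R) : V := X t - X s.

Definition cadlag (a b : R) (X : R -> V) : Prop :=
  (forall t, a <= t < b -> X @ t^'+ --> X t) /\
  (forall t, a < t <= b -> cvg (X @ t^'-)).

Definition cadlag2 (T : R) (XX : R -> R -> V) : Prop :=
  (forall t, 0 <= t <= T -> cadlag 0 t (fun s => XX s t)) /\
  (forall s, 0 <= s <= T -> cadlag s T (fun t => XX s t)).

Definition partition_sum (a b : R) (Xi : R -> R -> V) (P : seq R) : V :=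
  \sum_(0 <= i < size P) Xi (nth b (a :: P) i) (nth b (a :: P) i.+1).

Definition mesh (a b : R) (P : seq R) : R :=
  \big[Num.max/0]_(0 <= i < size P)
    (nth b (a :: P) i.+1 - nth b (a :: P) i).

(* partitions of [a, b] with mesh tending to 0 *)
Definition mesh_filter (a b : R) : set_system (seq R) :=
  filter_from [set e : R | 0 < e]
    (fun e => [set P | itv_partition a b P /\ mesh a b P < e]).

End Variation.

Section VariationNorm.
Context {R : realType} {V : normedModType R}.

Definition var2 (q a b : R) (Xi : R -> R -> V) : \bar R :=
  ((ereal_sup
      [set (partition_sum a b (fun u v => `|Xi u v| `^ q : R^o) P)%:E
         | P in [set P | itv_partition a b P]]) `^ q^-1)%E.

Definition pvar (p T : R) (X : R -> V) : \bar R := var2 p 0 T (incr X).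

(* D^p([0, T]; V) *)
Definition Dpath (p T : R) (X : R -> V) : Prop :=
  cadlag 0 T X /\ (pvar p T X < +oo)%E.

(* D_2^q(Delta_T; V) *)
Definition Dpath2 (q T : R) (XX : R -> R -> V) : Prop :=
  cadlag2 T XX /\ (var2 q 0 T XX < +oo)%E.

End VariationNorm.

Section BoundedSmooth.
Context {R : realType} {k : nat}.

Definition supnorm (V : normedModType R) (f : 'rV[R]_k -> V) : \bar R :=
  ereal_sup [set `|f x|%:E | x in setT].

(* the Frechet derivative of f, as a map R^k -> L(R^k; 'M_(m, n)) *)
Definition Dmx (m n : nat) (f : 'rV[R]_k -> 'M[R]_(m, n)) :
    'rV[R]_k -> 'M[R]_(k, m * n) :=
  fun x => 'J (fun y => mxvec (f y)) x.

Fixpoint Cb (l m n : nat) (f : 'rV[R]_k -> 'M[R]_(m, n)) : Prop :=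
  [/\ continuous f, bounded_fun f &
      if l is l'.+1 then (forall x, differentiable f x) /\ Cb l' (Dmx f)
      else True].

Fixpoint Cbnorm (l m n : nat) (f : 'rV[R]_k -> 'M[R]_(m, n)) : \bar R :=
  (if l is l'.+1 then supnorm f + Cbnorm l' (Dmx f) else supnorm f)%E.

End BoundedSmooth.

Section RoughPaths.
Context {R : realType} {d : nat}.

Definition tensor (x y : 'rV[R]_d) : 'M[R]_d := x^T *m y.

Definition rough_path (p T : R) (X : R -> 'rV[R]_d) (XX : R -> R -> 'M[R]_d) :
    Prop :=
  [/\ Dpath p T X, Dpath2 (p / 2) T XX &
      forall s u t, 0 <= s -> s <= u -> u <= t -> t <= T ->
        XX s t = XX s u + XX u t + tensor (incr X s u) (incr X u t)].

Definition rough_norm (p T : R) (X : R -> 'rV[R]_d) (XX : R -> R -> 'M[R]_d) :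
    \bar R :=
  (pvar p T X + var2 (p / 2) 0 T XX)%E.

Definition rough_dist (p T : R) (X : R -> 'rV[R]_d) (XX : R -> R -> 'M[R]_d)
    (X' : R -> 'rV[R]_d) (XX' : R -> R -> 'M[R]_d) : \bar R :=
  rough_norm p T (fun t => X t - X' t) (fun s t => XX s t - XX' s t).

End RoughPaths.

Section ControlledPaths.
Context {R : realType} {d k : nat}.
Implicit Types (X : R -> 'rV[R]_d) (XX : R -> R -> 'M[R]_d).
Implicit Types (Y : R -> 'rV[R]_k) (DY : R -> 'M[R]_(d, k)).
Implicit Types (V : R -> 'M[R]_(d, k)) (DV : R -> 'M[R]_(d, d * k)).

(* DY is the Gubinelli derivative Y' of Y *)
Definition remainder X Y DY (s t : R) : 'rV[R]_k :=
  incr Y s t - incr X s t *m DY s.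

Definition controlled (p T : R) X Y DY : Prop :=
  [/\ Dpath p T Y, Dpath p T DY & Dpath2 (p / 2) T (remainder X Y DY)].

Definition controlled_norm (p T : R) X Y DY : \bar R :=
  (`|DY 0|%:E + pvar p T DY + var2 (p / 2) 0 T (remainder X Y DY))%E.

Definition controlled_dist (p T : R) X1 Y1 DY1 X2 Y2 DY2 : \bar R :=
  (`|DY1 0 - DY2 0|%:E + pvar p T (fun t => (DY1 t - DY2 t)%R)
   + var2 (p / 2) 0 T
       (fun s t => (remainder X1 Y1 DY1 s t - remainder X2 Y2 DY2 s t)%R))%E.

(* L(R^d; L(R^d; R^k)) = L(R^d (x) R^d; R^k): A sends x (x) y to (A x) y *)
Definition apply_tensor (A : 'M[R]_(d, d * k)) (M : 'M[R]_d) : 'rV[R]_k :=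
  \sum_i \sum_j M i j *: row j (vec_mx (row i A)).

Definition compensated X XX V DV (u v : R) : 'rV[R]_k :=
  incr X u v *m V u + apply_tensor (DV u) (XX u v).

Definition rough_integral_cvg X XX V DV (s t : R) (I : 'rV[R]_k) : Prop :=
  partition_sum s t (compensated X XX V DV) @ mesh_filter s t --> I.

(* Y_t = y0 + int_0^t f(Y_s) dX_s, the integrand being (f(Y), Df(Y) Y') *)
Definition RDE_solution (p T : R) (f : 'rV[R]_k -> 'M[R]_(d, k)) (y0 : 'rV[R]_k)
    X XX Y DY : Prop :=
  [/\ controlled p T X Y DY,
      forall t, 0 <= t <= T -> DY t = f (Y t) &
      forall t, 0 <= t <= T -> exists I : 'rV[R]_k,
        rough_integral_cvg X XX (fun r => f (Y r))
          (fun r => DY r *m Dmx f (Y r)) 0 t I /\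
        Y t = y0 + I].

End ControlledPaths.

(* Main.v *)
Require Import Defs.
From HB Require Import structures.
From mathcomp Require Import all_boot all_order all_algebra.
From mathcomp Require Import all_classical all_reals all_analysis.
From mathcomp Require Import ring lra zify.

(* All the data are measured by one control, a superadditive function om on the
   intervals of [0, T] built from their variation norms; write w for its p-th
   root.  The defect J of a path Y over [s, t] is the increment of Y minus the
   step f(Y_s) X_{s,t} + Df(Y_s) f(Y_s) XX_{s,t} of the Euler scheme.  By Chen's
   relation J is additive up to O(w^3), and Y solves the equation iff the sums
   of J over fine partitions are negligible; since 3/p > 1, sewing turns this
   into |J| <= C w^3, first where w is small and then, by a discrete Gronwall
   argument, on [0, T].
   Existence: the Euler scheme on a finite set of times obeys these bounds
   uniformly in the set, and compactness yields a limit along finer sets.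
   Stability and uniqueness: the relation [close N e v a b] bounds the sizes of
   two quantities by N v and their difference by N e v.  It is stable under sums,
   products and Taylor remainders, so the same argument applied to two solutions
   at once bounds all the differences linearly in the distance e of the data.
   The constants are existential for integer bounds on the parameters; summing
   over these integers gives monotone, hence locally bounded, functions. *)

(** The drivers may jump, and this shapes the proof. The control of an interval that contains a jump
    does not become small with the interval, so [0, T] cannot be cut into pieces on which a Picard
    map contracts. Jumps are confined to single steps: on finite sets of times an interval is split
    into two parts of small control and one step between them, over which the scheme is exact. In
    the continuum this role is played by a second bound on the defect over [s, t], by the control of
    [s, u] for u < t: it holds for the scheme because the last step is exact, it survives the limit,
    and it makes sums over fine partitions negligible. The bounds for one solution involve f up to
    its second derivative; comparing two solutions moves the base point and takes a Lipschitz
    constant of the second derivative. Hence the C^2_b norm in (i) and the C^3_b norm in (ii). The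
    fields enter only through the interface [compatible], whose diagonal case with distance 0 covers
    a single solution. *)

Set Implicit Arguments.
Unset Strict Implicit.
Unset Printing Implicit Defensive.
Import Order.TTheory GRing.Theory Num.Theory.
Import numFieldNormedType.Exports.
Local Open Scope classical_set_scope.
Local Open Scope ring_scope.

(* The tactics [ring] and [lra] do not apply to vectors: an identity between them
   is reified and compared coefficientwise in [int]. *)
Inductive zexpr := ZVar of nat | ZZero | ZAdd of zexpr & zexpr | ZOpp of zexpr.

Fixpoint zeval (V : zmodType) (env : seq V) (e : zexpr) : V :=
  match e with
  | ZVar i => nth 0 env i
  | ZZero => 0
  | ZAdd a b => zeval env a + zeval env b
  | ZOpp a => - zeval env a
  end.

Fixpoint zcoef (e : zexpr) (i : nat) : int :=
  match e with
  | ZVar j => if j == i then 1 else 0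
  | ZZero => 0
  | ZAdd a b => zcoef a i + zcoef b i
  | ZOpp a => - zcoef a i
  end.

Lemma zevalE (V : zmodType) (env : seq V) e :
  zeval env e = \sum_(i < size env) env`_i *~ zcoef e i.
Proof.
elim: e => [j||a IHa b IHb|a IHa] /=.
- have [jn|nj] := ltnP j (size env).
    rewrite (bigD1 (Ordinal jn)) //= eqxx mulr1z big1 ?addr0 // => i ij.
    by case: eqP => [ji|_]; rewrite ?mulr0z //; case/eqP: ij; apply/val_inj.
  rewrite nth_default // big1 // => i _; case: eqP => [ji|_]; rewrite ?mulr0z //.
  by move: nj; rewrite ji leqNgt ltn_ord.
- by rewrite big1 // => i _; rewrite mulr0z.
- by rewrite IHa IHb -big_split; apply: eq_bigr => i _; rewrite mulrzDr.
- by rewrite IHa -sumrN; apply: eq_bigr => i _; rewrite mulrNz.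
Qed.

Lemma zeval_eq (V : zmodType) (env : seq V) n e e' : size env = n ->
  all (fun i => zcoef e i == zcoef e' i) (iota 0 n) ->
  zeval env e = zeval env e'.
Proof.
move=> <- /allP H; rewrite !zevalE; apply: eq_bigr => i _.
by rewrite (eqP (H i _)) // mem_iota ltn_ord.
Qed.

Ltac zatom env x :=
  match env with
  | x :: ?l => constr:(0%N)
  | _ :: ?l => let n := zatom l x in constr:(S n)
  end.
Ltac zmember env x :=
  match env with
  | x :: _ => constr:(true)
  | _ :: ?l => zmember l x
  | _ => constr:(false)
  end.
Ltac zatoms env t :=
  match t with
  | 0%R => env
  | (?a + ?b)%R => let env1 := zatoms env a in zatoms env1 b
  | (- ?a)%R => zatoms env a
  | _ => let b := zmember env t in
         match b with true => env | false => constr:(t :: env) end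
  end.
Ltac zreify env t :=
  match t with
  | 0%R => constr:(ZZero)
  | (?a + ?b)%R => let x := zreify env a in let y := zreify env b in constr:(ZAdd x y)
  | (- ?a)%R => let x := zreify env a in constr:(ZOpp x)
  | _ => let n := zatom env t in constr:(ZVar n)
  end.
Ltac zmodule :=
  match goal with
  | |- @eq ?T ?l ?r =>
    let env0 := zatoms (@nil T) l in let env := zatoms env0 r in
    let e1 := zreify env l in let e2 := zreify env r in
    refine (@zeval_eq _ env _ e1 e2 erefl _); vm_compute; reflexivity
  end.

(** * Norms and derivatives of matrix-valued functions *)

Section MatrixNorm.
Context {R : realType}.

Lemma mx_norm_le m n (A : 'M[R]_(m, n)) (c : R) :
  0 <= c -> (forall i j, `|A i j| <= c) -> `|A| <= c.
Proof.
move=> c0 Ac; rewrite [leLHS]/Num.Def.normr /= mx_normrE.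
by apply/bigmax_leP; split => // -[i j] _; exact: Ac.
Qed.

Lemma coord_le_mx_norm m n (A : 'M[R]_(m, n)) i j : `|A i j| <= `|A|.
Proof.
rewrite [leRHS]/Num.Def.normr /= mx_normrE.
by apply/bigmax_geP; right => /=; exists (i, j).
Qed.

Lemma norm_mulmx m n q (A : 'M[R]_(m, n)) (B : 'M[R]_(n, q)) :
  `|A *m B| <= n%:R * `|A| * `|B|.
Proof.
apply: mx_norm_le => [|i j]; first by rewrite !mulr_ge0.
rewrite mxE; apply: (le_trans (ler_norm_sum _ _ _)).
apply: (@le_trans _ _ (\sum_(l < n) `|A| * `|B|)).
  by apply: ler_sum => l _; rewrite normrM ler_pM ?coord_le_mx_norm.
by rewrite sumr_const card_ord -[leLHS]mulr_natl mulrA.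
Qed.

Lemma norm_vec_mx m n (v : 'rV[R]_(m * n)) : `|vec_mx v| <= `|v|.
Proof. by apply: mx_norm_le => // i j; rewrite mxE coord_le_mx_norm. Qed.

Lemma norm_mxvec m n (A : 'M[R]_(m, n)) : `|mxvec A| = `|A|.
Proof.
apply/eqP; rewrite eq_le; apply/andP; split; last first.
  by rewrite -{1}(mxvecK A) norm_vec_mx.
apply: mx_norm_le => // i; case/mxvec_indexP => a b.
by rewrite ord1 mxvecE coord_le_mx_norm.
Qed.

End MatrixNorm.

Section ApplyTensor.
Context {R : realType} {d k : nat}.
Implicit Types (A : 'M[R]_(d, d * k)) (M : 'M[R]_d).

Lemma apply_tensorDl A B M :
  apply_tensor (A + B) M = apply_tensor A M + apply_tensor B M.
Proof.
rewrite /apply_tensor -big_split; apply: eq_bigr => i _ /=.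
rewrite -big_split; apply: eq_bigr => j _ /=.
by rewrite -scalerDr; congr (_ *: _); rewrite !linearD.
Qed.

Lemma apply_tensorDr A M N :
  apply_tensor A (M + N) = apply_tensor A M + apply_tensor A N.
Proof.
rewrite /apply_tensor -big_split; apply: eq_bigr => i _ /=.
rewrite -big_split; apply: eq_bigr => j _ /=.
by rewrite mxE scalerDl.
Qed.

Lemma apply_tensorNl A M : apply_tensor (- A) M = - apply_tensor A M.
Proof.
rewrite /apply_tensor -sumrN; apply: eq_bigr => i _ /=.
by rewrite -sumrN; apply: eq_bigr => j _ /=; rewrite !linearN.
Qed.

Lemma apply_tensorNr A M : apply_tensor A (- M) = - apply_tensor A M.
Proof.
rewrite /apply_tensor -sumrN; apply: eq_bigr => i _ /=.
by rewrite -sumrN; apply: eq_bigr => j _ /=; rewrite mxE scaleNr.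
Qed.

(** Through this identity the tensor term of Chen's relation becomes the first-order Taylor term of
    the field, which it has to cancel. *)
Lemma apply_tensor_tensor A (x y : 'rV[R]_d) :
  apply_tensor A (tensor x y) = y *m vec_mx (x *m A).
Proof.
rewrite (mulmx_sum_row y) /apply_tensor exchange_big /=.
apply: eq_bigr => j _; rewrite (mulmx_sum_row x) linear_sum /= linear_sum /=.
rewrite scaler_sumr; apply: eq_bigr => i _.
rewrite /tensor !mxE big_ord1 !mxE !linearZ /= scalerA.
by [].
Qed.

Lemma norm_apply_tensor A M :
  `|apply_tensor A M| <= (d * d)%:R * `|A| * `|M|.
Proof.
apply: (le_trans (ler_norm_sum _ _ _)).
apply: (@le_trans _ _ (\sum_(i < d) \sum_(j < d) `|A| * `|M|)); last first.
  by rewrite !sumr_const !card_ord -mulrnA -[leLHS]mulr_natl mulrA.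
apply: ler_sum => i _; apply: (le_trans (ler_norm_sum _ _ _)).
apply: ler_sum => j _; rewrite normrZ mulrC.
apply: ler_pM => //; last exact: coord_le_mx_norm.
apply: mx_norm_le => // a b; rewrite ord1 !mxE.
exact: coord_le_mx_norm.
Qed.

End ApplyTensor.

(** * Joint bounds on two quantities and on their difference *)

Section Close.
Context {R : realType}.

(* [a] and [b] have size at most [v], up to the factor [N], and relative
   distance at most [e]. *)
Definition close (V : normedModType R) (N e v : R) (a b : V) : Prop :=
  [/\ `|a| <= N * v, `|b| <= N * v & `|a - b| <= N * e * v].

Lemma close_refl (V : normedModType R) (N v : R) (a : V) :
  `|a| <= N * v -> close N 0 v a a.
Proof. by move=> h; split=> //; rewrite subrr normr0 mulr0 mul0r. Qed.

Lemma closeD (V : normedModType R) (N N' e v : R) (a b c d : V) :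
  close N e v a b -> close N' e v c d -> close (N + N') e v (a + c) (b + d).
Proof.
move=> [a1 b1 ab] [c1 d1 cd].
have L := @ler_normD _ V.
split; rewrite !mulrDl.
- exact: le_trans (L _ _) (lerD _ _).
- exact: le_trans (L _ _) (lerD _ _).
- rewrite opprD addrACA; exact: le_trans (L _ _) (lerD _ _).
Qed.

(** Only the product [N * v] has to grow, so that a power of a bounded [v] can be traded for a
    larger constant. *)
Lemma closeW (V : normedModType R) (N N' e e' v v' : R) (a b : V) :
  0 <= N -> 0 <= e -> 0 <= v -> N * v <= N' * v' -> e <= e' ->
  close N e v a b -> close N' e' v' a b.
Proof.
move=> N0 e0 v0 NN ee [a1 b1 ab]; split.
- exact: le_trans NN.
- exact: le_trans NN.
- apply: le_trans ab _; rewrite mulrAC [leRHS]mulrAC.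
  by apply: ler_pM => //; rewrite mulr_ge0.
Qed.

(** The factor [2] comes from writing the difference as [B (a - b) x + B b (x - y)]. *)
Lemma close_bilinear (U V W : normedModType R) (B : U -> V -> W) (c : R)
    (N N' e v v' : R) a b x y :
  0 <= c -> 0 <= N -> 0 <= N' -> 0 <= e -> 0 <= v -> 0 <= v' ->
  (forall u u' z, B (u - u') z = B u z - B u' z) ->
  (forall u z z', B u (z - z') = B u z - B u z') ->
  (forall u z, `|B u z| <= c * `|u| * `|z|) ->
  close N e v a b -> close N' e v' x y ->
  close (2 * c * N * N') e (v * v') (B a x) (B b y).
Proof.
move=> c0 N0 N0' e0 v0 v0' Bl Br Bn [a1 b1 ab] [x1 y1 xy].
have key u z p q : `|u| <= p -> `|z| <= q -> `|B u z| <= c * p * q.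
  move=> up zq; apply: le_trans (Bn _ _) _.
  by apply: ler_pM => //; [rewrite mulr_ge0|apply: ler_pM].
have P : 0 <= c * (N * v) * (N' * v') by rewrite !mulr_ge0.
split.
- apply: le_trans (key _ _ _ _ a1 x1) _; nra.
- apply: le_trans (key _ _ _ _ b1 y1) _; nra.
- have -> : B a x - B b y = B (a - b) x + B b (x - y).
    by rewrite Bl Br addrA subrK.
  apply: le_trans (ler_normD _ _) _.
  apply: le_trans (lerD (key _ _ _ _ ab x1) (key _ _ _ _ b1 xy)) _.
  rewrite le_eqVlt; apply/orP; left; apply/eqP; ring.
Qed.

Lemma close_mulmx m n q (N N' e v v' : R) (a b : 'M[R]_(m, n)) (x y : 'M[R]_(n, q)) :
  0 <= N -> 0 <= N' -> 0 <= e -> 0 <= v -> 0 <= v' ->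
  close N e v a b -> close N' e v' x y ->
  close (2 * n%:R * N * N') e (v * v') (a *m x) (b *m y).
Proof.
move=> *; apply: close_bilinear => //.
- exact: mulmxBl.
- exact: mulmxBr.
- exact: norm_mulmx.
Qed.

Lemma close_apply_tensor d k (N N' e v v' : R) (a b : 'M[R]_(d, d * k)) (x y : 'M[R]_d) :
  0 <= N -> 0 <= N' -> 0 <= e -> 0 <= v -> 0 <= v' ->
  close N e v a b -> close N' e v' x y ->
  close (2 * (d * d)%:R * N * N') e (v * v') (apply_tensor a x) (apply_tensor b y).
Proof.
move=> *; apply: close_bilinear => //.
- by move=> *; rewrite apply_tensorDl apply_tensorNl.
- by move=> *; rewrite apply_tensorDr apply_tensorNr.
- exact: norm_apply_tensor.
Qed.

Lemma close_vec_mx m n (N e v : R) (a b : 'rV[R]_(m * n)) :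
  close N e v a b -> close N e v (vec_mx a) (vec_mx b).
Proof.
by case=> ? ? ?; split; rewrite -?linearB; exact: le_trans (norm_vec_mx _) _.
Qed.

End Close.

(** * Mean value estimates along segments *)

Section CurveDerivative.
Context {R : realType}.

Definition curve_derive m n (c c' : R -> 'M[R]_(m, n)) : Prop :=
  forall t i j, is_derive t (1 : R) (fun t => c t i j) (c' t i j).

(** The norm is the maximum of the entries, so the real mean value theorem, applied entry by entry,
    gives the bound without a factor. *)
Lemma curve_mean_value m n (c c' : R -> 'M[R]_(m, n)) (B : R) :
  curve_derive c c' -> 0 <= B -> (forall t, 0 <= t <= 1 -> `|c' t| <= B) ->
  `|c 1 - c 0| <= B.
Proof.
move=> cc B0 cB; apply: mx_norm_le => // i j; rewrite !mxE.
have [||t] := @MVT R (fun t => c t i j) (fun t => c' t i j) 0 1 ltr01.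
- by move=> t _; exact: cc.
- apply: continuous_subspaceT => t.
  apply/differentiable_continuous/derivable1_diffP.
  by have [] := cc t i j.
- rewrite in_itv /= => /andP[t0 t1] ->; rewrite subr0 mulr1.
  by apply: le_trans (coord_le_mx_norm _ _ _) (cB _ _); rewrite !ltW.
Qed.

Lemma curve_deriveB m n (c c' e e' : R -> 'M[R]_(m, n)) :
  curve_derive c c' -> curve_derive e e' ->
  curve_derive (fun t => c t - e t) (fun t => c' t - e' t).
Proof.
move=> cc ee t i j; rewrite !mxE.
have := @is_deriveB _ _ _ _ _ _ _ _ _ (cc t i j) (ee t i j).
by apply: near_eq_is_derive; near=> s; rewrite !mxE.
Unshelve. all: by end_near. Qed.

End CurveDerivative.

Section CurveClose.
Context {R : realType}.

Lemma curve_derive_scale m n (A : 'M[R]_(m, n)) :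
  curve_derive (fun t => t *: A) (fun=> A).
Proof.
move=> t i j.
have := @is_deriveZ _ _ _ _ (A i j) _ _ _ (@is_derive_id _ R^o t 1).
rewrite [_ *: 1]mulr1.
by apply: near_eq_is_derive; near=> s; rewrite mxE mulrC.
Unshelve. all: by end_near. Qed.

Lemma curve_close m n (c c' b b' : R -> 'M[R]_(m, n)) (N e v : R) :
  0 <= N -> 0 <= e -> 0 <= v ->
  curve_derive c c' -> curve_derive b b' ->
  (forall t, 0 <= t <= 1 -> close N e v (c' t) (b' t)) ->
  close N e v (c 1 - c 0) (b 1 - b 0).
Proof.
move=> N0 e0 v0 cc bb H; split.
- by apply: curve_mean_value cc _ _ => [|t /H[]//]; rewrite mulr_ge0.
- by apply: curve_mean_value bb _ _ => [|t /H[]//]; rewrite mulr_ge0.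
- rewrite opprD addrACA -opprD.
  apply: curve_mean_value (curve_deriveB cc bb) _ _ => [|t /H[]//].
  by rewrite !mulr_ge0.
Qed.

End CurveClose.

Section Fields.
Context {R : realType} {k m n : nat}.
Implicit Types (f g : 'rV[R]_k -> 'M[R]_(m, n)).


Lemma mxvec_continuous : continuous (mxvec : 'M[R]_(m, n) -> 'rV[R]_(m * n)).
Proof.
move=> A; apply/(@cvgrPdist_lt _ _ _ (nbhs A) _ mxvec (mxvec A)) => e e0.
have := (@cvgrPdist_lt _ _ _ (nbhs A) _ id A).1 (@cvg_id _ _) e e0.
by move=> /(_ _); apply: filterS => B; rewrite -linearB norm_mxvec.
Qed.

Lemma differentiable_mxvec f x :
  differentiable f x -> differentiable (fun y => mxvec (f y)) x.
Proof.
move=> df; apply: (differentiable_comp df).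
exact/linear_differentiable/mxvec_continuous.
Qed.

(* [act v A] is [A v] for a linear map [A] from R^k into 'M_(m, n). *)
Definition act (v : 'rV[R]_k) (A : 'M[R]_(k, m * n)) : 'M[R]_(m, n) :=
  vec_mx (v *m A).

Lemma actBr v A B : act v (A - B) = act v A - act v B.
Proof. by rewrite /act mulmxBr linearB. Qed.

Lemma actBl v v' A : act (v - v') A = act v A - act v' A.
Proof. by rewrite /act mulmxBl linearB. Qed.

Lemma close_act (N N' e v v' : R) (a b : 'rV[R]_k) (x y : 'M[R]_(k, m * n)) :
  0 <= N -> 0 <= N' -> 0 <= e -> 0 <= v -> 0 <= v' ->
  close N e v a b -> close N' e v' x y ->
  close (2 * k%:R * N * N') e (v * v') (act a x) (act b y).
Proof. by move=> *; apply/close_vec_mx/close_mulmx. Qed.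

Lemma curve_derive_field f (a v : 'rV[R]_k) :
  (forall x, differentiable f x) ->
  curve_derive (fun t => f (a + t *: v))
    (fun t => act v (Dmx f (a + t *: v))).
Proof.
move=> df t i j.
pose F y := mxvec (f y); pose b := a + t *: v.
have dF : differentiable F b by exact: differentiable_mxvec.
have DF : derivable F b v by exact: diff_derivable.
have := deriveEjacobian v dF; rewrite (derive_mx DF) => /rowP/(_ (mxvec_index i j)).
rewrite !mxE => E; rewrite /act.
have [+ _] := derivable_mxP F b v; move=> /(_ DF ord0 (mxvec_index i j)) D.
have eqf : (fun y => F y 0 (mxvec_index i j)) = fun y => f y i j.
  by apply/funext => y; rewrite mxvecE.
move: E D; rewrite eqf => E D.
have eqg : (fun h : R => h^-1 *: (((fun y => f y i j) \o shift b) (h *: v) - f b i j)) =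
    fun h => h^-1 *: (((fun t0 : R => f (a + t0 *: v) i j) \o shift t) (h *: 1) -
             f (a + t *: v) i j).
  apply/funext => h /=; congr (_ *: (f _ i j - _)).
  by rewrite /b [h *: 1]mulr1 scalerDl addrCA.
apply: DeriveDef; first by move: D; rewrite /derivable eqg.
by move: E; rewrite /derive eqg => ->.
Qed.

Definition taylor1 f x y := f y - f x - act (y - x) (Dmx f x).

(** Pass through [f y]: [k%:R * N] is a Lipschitz constant of [f], the summand [1] accounts for
    [f y - g y], and [N] for the sizes. *)
Lemma close_field (N e : R) f g (x y : 'rV[R]_k) :
  0 <= N -> (forall x, differentiable f x) ->
  (forall x, `|f x| <= N) -> (forall x, `|g x| <= N) ->
  (forall x, `|Dmx f x| <= N) -> (forall x, `|f x - g x| <= e) ->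
  `|x - y| <= e -> close (k%:R * N + N + 1) e 1 (f x) (g y).
Proof.
move=> N0 df fN gN DfN fg xy.
have kN : 0 <= k%:R * N by rewrite mulr_ge0.
have e0 : 0 <= e by exact: le_trans (normr_ge0 _) xy.
split.
- by apply: le_trans (fN _) _; lra.
- by apply: le_trans (gN _) _; lra.
- have -> : f x - g y = (f x - f y) + (f y - g y) by rewrite addrA subrK.
  apply: le_trans (ler_normD _ _) _.
  apply: (@le_trans _ _ (k%:R * N * e + e)); last by nra.
  apply: lerD (fg _).
  have := curve_mean_value (curve_derive_field y (x - y) df).
  rewrite scale1r scale0r addr0 [y + _]addrC subrK; apply.
    by rewrite mulr_ge0.
  move=> t _; apply: le_trans (norm_vec_mx _) _ => /=.
  apply: le_trans (norm_mulmx _ _) _.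
  by rewrite -!mulrA ler_wpM2l // mulrC ler_pM.
Qed.

Lemma close_increment (N N1 e v : R) f g (x h y j : 'rV[R]_k) :
  (forall x, differentiable f x) -> (forall x, differentiable g x) ->
  0 <= N -> 0 <= N1 -> 0 <= e -> 0 <= v ->
  (forall s, 0 <= s <= 1 -> close N e 1 (Dmx f (x + s *: h)) (Dmx g (y + s *: j))) ->
  close N1 e v h j ->
  close (2 * k%:R * N1 * N) e v (f (x + h) - f x) (g (y + j) - g y).
Proof.
move=> df dg N0 N10 e0 v0 H hj.
have P : 0 <= 2 * k%:R * N1 * N by rewrite !mulr_ge0.
have := curve_close P e0 v0 (curve_derive_field x h df) (curve_derive_field y j dg).
rewrite !scale1r !scale0r !addr0; apply => t /H Ht.
by rewrite -[v]mulr1; exact: close_act.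
Qed.

Lemma close_taylor (N N1 e v : R) f g (x h y j : 'rV[R]_k) :
  (forall x, differentiable f x) -> (forall x, differentiable g x) ->
  0 <= N -> 0 <= N1 -> 0 <= e -> 0 <= v ->
  (forall s, 0 <= s <= 1 ->
     close N e v (Dmx f (x + s *: h) - Dmx f x) (Dmx g (y + s *: j) - Dmx g y)) ->
  close N1 e v h j ->
  close (2 * k%:R * N1 * N) e (v ^+ 2) (taylor1 f x (x + h)) (taylor1 g y (y + j)).
Proof.
move=> df dg N0 N10 e0 v0 H hj.
have P : 0 <= 2 * k%:R * N1 * N by rewrite !mulr_ge0.
have v2 : 0 <= v ^+ 2 by rewrite exprn_ge0.
(* The increment of this curve over [0, 1] is the Taylor remainder, and its speed is [act b] of an
   increment of the derivative, hence of second order. *)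
pose c (F : 'rV[R]_k -> 'M[R]_(m, n)) (a b : 'rV[R]_k) (t : R) :=
  F (a + t *: b) - t *: act b (Dmx F a).
have E F a b : taylor1 F a (a + b) = c F a b 1 - c F a b 0.
  by rewrite /c !scale1r !scale0r addr0 subr0 /taylor1 addrAC [a + b - a]addrC addKr.
rewrite (E f x h) (E g y j); apply: (curve_close P e0 v2).
- exact: (curve_deriveB (curve_derive_field x h df) (curve_derive_scale (act h (Dmx f x)))).
- exact: (curve_deriveB (curve_derive_field y j dg) (curve_derive_scale (act j (Dmx g y)))).
move=> t /H Ht.
have := close_act N10 N0 e0 v0 v0 hj Ht.
rewrite (actBr h).
rewrite (actBr j).
rewrite -expr2.
exact.
Qed.

End Fields.

Section FieldPairs.
Context {R : realType} {d k : nat}.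
Implicit Types (F G : 'rV[R]_k -> 'M[R]_(d, k)).

(** All the comparisons that one step from [x] to [y], and from [x'] to [y'], requires. The
    derivative at the end point serves in the product rule for the increment of [F *m Dmx F]. *)
Record fields_close (N e v : R) F G (x x' y y' : 'rV[R]_k) : Prop := FieldsClose {
  close_val : close N e 1 (F x) (G x');
  close_D : close N e 1 (Dmx F x) (Dmx G x');
  close_D_end : close N e 1 (Dmx F y) (Dmx G y');
  close_dval : close N e v (F y - F x) (G y' - G x');
  close_dD : close N e v (Dmx F y - Dmx F x) (Dmx G y' - Dmx G x');
  close_T : close N e (v ^+ 2) (taylor1 F x y) (taylor1 G x' y') }.

Lemma fields_closeI (N N1 : R) : 0 <= N -> 0 <= N1 ->
  exists2 N' : R, 0 <= N' & forall F G (e v : R) (x x' h h' : 'rV[R]_k),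
  0 <= e -> 0 <= v ->
  (forall x, differentiable F x) -> (forall x, differentiable G x) ->
  (forall x, differentiable (Dmx F) x) -> (forall x, differentiable (Dmx G) x) ->
  (forall s, 0 <= s <= 1 ->
    [/\ close N e 1 (F (x + s *: h)) (G (x' + s *: h')),
        close N e 1 (Dmx F (x + s *: h)) (Dmx G (x' + s *: h')) &
        close N e 1 (Dmx (Dmx F) (x + s *: h)) (Dmx (Dmx G) (x' + s *: h'))]) ->
  close N1 e v h h' -> fields_close N' e v F G x x' (x + h) (x' + h').
Proof.
move=> N0 N10.
(* [N2] is the constant for an increment; a Taylor remainder integrates increments of the
   derivative, so [N3] is the same expression with [N2] in place of [N]. *)
pose N2 := 2 * k%:R * N1 * N; pose N3 := 2 * k%:R * N1 * N2.
have N20 : 0 <= N2 by rewrite /N2 !mulr_ge0.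
have N30 : 0 <= N3 by rewrite /N3 !mulr_ge0.
exists (N + N2 + N3); first by rewrite !addr_ge0.
move=> F G e v x x' h h' e0 v0 dF dG dDF dDG H hh.
have NW u (V : normedModType R) (a b : V) N4 : 0 <= N4 -> N4 <= N + N2 + N3 ->
    0 <= u -> close N4 e u a b -> close (N + N2 + N3) e u a b.
  by move=> ? ? ? ; apply: closeW => //; rewrite ler_wpM2r.
have [] := H 0; first by rewrite lexx ler01.
have [] := H 1; first by rewrite lexx ler01.
rewrite !scale1r !scale0r !addr0 => _ D1 _ V0 D0 _.
split; try by apply: NW (V0) => //; lra.
- by apply: NW D0 => //; lra.
- by apply: NW D1 => //; lra.
- apply: (NW _ _ _ _ N2) => //; first lra.
  by apply: (close_increment dF dG N0 N10 e0 v0 _ hh) => s /H[].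
- apply: (NW _ _ _ _ N2) => //; first lra.
  by apply: (close_increment dDF dDG N0 N10 e0 v0 _ hh) => s /H[].
- apply: (NW _ _ _ _ N3); rewrite ?exprn_ge0 //; first lra.
  apply: (close_taylor dF dG N20 N10 e0 v0 _ hh) => s /andP[s0 s1].
  apply: (close_increment dDF dDG N0 N10 e0 v0).
    move=> u /andP[u0 u1].
    by rewrite !scalerA; have [] := H (u * s); rewrite // mulr_ge0 //= mulr_ile1.
  case: hh => a1 a2 a3; split; rewrite -?scalerBr normrZ ger0_norm //.
  + by rewrite (le_trans _ a1) // ler_piMl.
  + by rewrite (le_trans _ a2) // ler_piMl.
  + by rewrite (le_trans _ a3) // ler_piMl.
Qed.

End FieldPairs.

(** * Partitions, variation and controls *)

Section Partitions.
Context {R : realType} {V : normedModType R}.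
Implicit Types (a b c : R) (Xi : R -> R -> V) (P Q : seq R).

Lemma partition_sum_cons a b Xi x P :
  partition_sum a b Xi (x :: P) = Xi a x + partition_sum x b Xi P.
Proof. by rewrite /partition_sum big_nat_recl //=. Qed.

Lemma partition_sum_nil a b Xi : partition_sum a b Xi [::] = 0.
Proof. by rewrite /partition_sum big_nil. Qed.

Lemma partition_sum_cat a b c Xi P Q : itv_partition a c P ->
  partition_sum a b Xi (P ++ Q) = partition_sum a c Xi P + partition_sum c b Xi Q.
Proof.
elim: P a => [|x P IH] a; first by move/itv_partition_nil->; rewrite partition_sum_nil add0r.
by move=> /itv_partition_cons H; rewrite cat_cons !partition_sum_cons (IH _ H) addrA.
Qed.

Lemma itv_partition_lt a b x P : itv_partition a b (x :: P) -> a < x.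
Proof. by case=> /= /andP[]. Qed.

Lemma partition_sumB a b Xi Xj P :
  partition_sum a b (fun u v => Xi u v - Xj u v) P =
  partition_sum a b Xi P - partition_sum a b Xj P.
Proof. by rewrite /partition_sum sumrB. Qed.

Lemma partition_sum_incr a b (X : R -> V) P : itv_partition a b P ->
  partition_sum a b (incr X) P = incr X a b.
Proof.
elim: P a => [|x P IH] a.
  by move/itv_partition_nil->; rewrite partition_sum_nil /incr subrr.
by move=> /itv_partition_cons/IH H; rewrite partition_sum_cons H /incr addrC subrKA.
Qed.

Lemma itv_partition_ex a b : a <= b -> exists P, itv_partition a b P.
Proof.
rewrite le_eqVlt => /predU1P[->|ab]; first by exists [::]; split => /=.
by exists [:: b]; exact: itv_partition1.
Qed.

Lemma mesh_cons a b x P : mesh a b (x :: P) = Num.max (x - a) (mesh x b P).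
Proof. by rewrite /mesh big_nat_recl //=. Qed.

Lemma mesh_nil a b : mesh a b [::] = 0.
Proof. by rewrite /mesh big_nil. Qed.

Lemma mesh_cat_lt a b c P Q e : itv_partition a c P ->
  mesh a c P < e -> mesh c b Q < e -> mesh a b (P ++ Q) < e.
Proof.
elim: P a => [|x P IH] a; first by move/itv_partition_nil->.
move=> /itv_partition_cons iP; rewrite cat_cons !mesh_cons !gt_max.
by move=> /andP[-> xP] cQ /=; exact: IH.
Qed.

Lemma fine_partition_ex a b e : a <= b -> 0 < e ->
  exists P, itv_partition a b P /\ mesh a b P < e.
Proof.
move=> ab e0.
have e2 : 0 < e / 2 by rewrite divr_gt0.
have [n] : exists n : nat, b - a < n%:R * (e / 2).
  by exists (Num.truncn ((b - a) / (e / 2))).+1; rewrite -ltr_pdivrMr // truncnS_gt.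
elim: n a ab => [|n IH] a ab; first by rewrite mul0r subr_lt0 ltNge ab.
move=> H; have [bs|bl] := leP b (a + e / 2).
  move: ab; rewrite le_eqVlt => /predU1P[->|ab].
    by exists [::]; rewrite mesh_nil; split => //; split => /=.
  exists [:: b]; split; first exact: itv_partition1.
  by rewrite mesh_cons mesh_nil gt_max e0 andbT; lra.
have [|P [iP mP]] := IH (a + e / 2) (ltW bl).
  by move: H; rewrite -natr1 mulrDl mul1r; lra.
exists (a + e / 2 :: P); split.
  by case: iP => pP lP; split => //=; rewrite pP ltrDl e2.
by rewrite mesh_cons gt_max mP andbT; lra.
Qed.

End Partitions.

Section Controls.
Context {R : realType}.
Implicit Types (T : R) (om : R -> R -> R).

Lemma norm_partition_sum_mesh (V : normedModType R) a b (Xi : R -> R -> V) (g : R -> R -> R) P dl :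
  itv_partition a b P -> mesh a b P < dl ->
  (forall u v, a <= u -> u < v -> v <= b -> v - u < dl -> `|Xi u v| <= g u v) ->
  `|partition_sum a b Xi P| <= partition_sum a b (g : R -> R -> R^o) P.
Proof.
elim: P a => [|x P IH] a iP mP H; first by rewrite partition_sum_nil normr0 partition_sum_nil.
rewrite partition_sum_cons partition_sum_cons.
move: mP; rewrite mesh_cons gt_max => /andP[xa mP].
have xP := itv_partition_cons iP; have ax := itv_partition_lt iP; have xb := itv_partition_le xP.
apply: le_trans (ler_normD _ _) _; apply: lerD; first exact: H.
by apply: IH => // u v xu; apply: H; rewrite (le_trans _ xu) // ltW.
Qed.

Lemma norm_partition_sum (V : normedModType R) a b (Xi : R -> R -> V) (g : R -> R -> R) P :
  itv_partition a b P ->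
  (forall u v, a <= u -> u < v -> v <= b -> `|Xi u v| <= g u v) ->
  `|partition_sum a b Xi P| <= partition_sum a b (g : R -> R -> R^o) P.
Proof.
move=> iP H; have m : mesh a b P < mesh a b P + 1 by rewrite ltrDl.
apply: (norm_partition_sum_mesh iP m).
by move=> u v au uv vb _; exact: H.
Qed.

Definition control T om : Prop :=
  (forall s t, 0 <= s -> s <= t -> t <= T -> 0 <= om s t) /\
  (forall s u t, 0 <= s -> s <= u -> u <= t -> t <= T ->
     om s u + om u t <= om s t).

Lemma control_le T om s s' t t' : control T om ->
  0 <= s' -> s' <= s -> s <= t -> t <= t' -> t' <= T -> om s t <= om s' t'.
Proof.
move=> [om0 omD] s'0 s's st tt' t'T.
have s't := le_trans s's st; have tT := le_trans tt' t'T.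
have s0 := le_trans s'0 s's; have t0 := le_trans s0 st.
have := omD _ _ _ s'0 s's st tT; have := omD _ _ _ s'0 s't tt' t'T.
have := om0 _ _ s'0 s's (le_trans st tT); have := om0 _ _ t0 tt' t'T; lra.
Qed.

Lemma controlxx T om s : control T om -> 0 <= s <= T -> om s s = 0.
Proof.
move=> [om0 omD] /andP[s0 sT]; apply/eqP; rewrite eq_le om0 // andbT.
by have := omD s s s s0 (lexx _) (lexx _) sT; lra.
Qed.

Lemma controlD T om om' : control T om -> control T om' ->
  control T (fun s t => om s t + om' s t).
Proof.
move=> [om0 omD] [om0' omD']; split=> [s t s0 st tT|s u t s0 su ut tT].
  by rewrite addr_ge0 ?om0 ?om0'.
by rewrite addrACA lerD ?omD ?omD'.
Qed.

Lemma partition_sum_control T om s t P : control T om -> 0 <= s -> t <= T ->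
  itv_partition s t P -> partition_sum s t (om : R -> R -> R^o) P <= om s t.
Proof.
move=> omc s0 tT; elim: P s s0 => [|x P IH] s s0 iP.
  rewrite partition_sum_nil (itv_partition_nil iP) omc.1 //.
  by rewrite -(itv_partition_nil iP).
have xP := itv_partition_cons iP; have sx := ltW (itv_partition_lt iP).
have xt := itv_partition_le xP; have x0 := le_trans s0 sx.
rewrite partition_sum_cons; apply: le_trans (omc.2 s x t s0 sx xt tT).
by rewrite lerD2l IH.
Qed.

End Controls.

Section VariationControl.
Context {R : realType} {V : normedModType R}.
Variables (q T : R) (Xi : R -> R -> V).
Hypotheses (q0 : 0 < q) (T0 : 0 <= T).

Let f u v : R^o := `|Xi u v| `^ q.

Lemma var2_partition_sum (B : R) P : (var2 q 0 T Xi <= B%:E)%E ->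
  itv_partition 0 T P -> partition_sum 0 T f P <= B `^ q.
Proof.
move=> H iP; have B0 : 0 <= B.
  by rewrite -lee_fin; apply: le_trans H; exact: poweR_ge0.
have S0 : 0 <= partition_sum 0 T f P by apply: sumr_ge0 => i _; exact: powR_ge0.
have : (((partition_sum 0 T f P)%:E) `^ q^-1 <= B%:E)%E.
  apply: le_trans H; apply: gt0_ler_poweR; rewrite ?invr_ge0 ?(ltW q0) //.
  - by rewrite in_itv /= lee_fin S0 leey.
  - rewrite in_itv /= leey andbT.
    by apply: (@le_trans _ _ (partition_sum 0 T f P)%:E);
      [rewrite lee_fin|apply: ereal_sup_ubound; exists P].
  - by apply: ereal_sup_ubound; exists P.
rewrite poweR_EFin lee_fin => H'.
rewrite -[leLHS]powRr1 // -(mulVf (lt0r_neq0 q0)) powRrM.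
by apply: ge0_ler_powR => //; rewrite ?nnegrE ?powR_ge0 ?(ltW q0).
Qed.

Lemma var2_le (B : R) : 0 <= B ->
  (forall P, itv_partition 0 T P -> partition_sum 0 T f P <= B `^ q) ->
  (var2 q 0 T Xi <= B%:E)%E.
Proof.
move=> B0 H; have [P iP] := itv_partition_ex T0.
have -> : B%:E = (((B `^ q)%:E) `^ q^-1)%E.
  by rewrite poweR_EFin -powRrM mulfV ?lt0r_neq0 // powRr1.
have S0 : 0 <= partition_sum 0 T f P by apply: sumr_ge0 => i _; exact: powR_ge0.
apply: gt0_ler_poweR; rewrite ?invr_ge0 ?(ltW q0) //.
- rewrite in_itv /= leey andbT.
  by apply: (@le_trans _ _ (partition_sum 0 T f P)%:E);
    [rewrite lee_fin|apply: ereal_sup_ubound; exists P].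
- by rewrite in_itv /= lee_fin powR_ge0 leey.
- by apply: ge_ereal_sup => _ [Q iQ <-]; rewrite lee_fin; exact: H.
Qed.

(** The way back from controls to variation norms: the q-th powers are bounded by multiples of [om],
    which superadditivity sums to at most [om 0 T]. *)
Lemma var2_le_control (A C : R) om : control T om -> om 0 T <= C -> 0 <= A ->
  (forall s t, 0 <= s -> s < t -> t <= T -> `|Xi s t| <= A * om s t `^ q^-1) ->
  (var2 q 0 T Xi <= (A * C `^ q^-1)%:E)%E.
Proof.
move=> omc omC A0 H; have om0 := omc.1 _ _ (lexx 0) T0 (lexx T).
have C0 := le_trans om0 omC.
apply: var2_le => [|P iP]; first by rewrite mulr_ge0 ?powR_ge0.
have -> : (A * C `^ q^-1) `^ q = A `^ q * C.
  by rewrite powRM ?powR_ge0 // -powRrM mulVf ?lt0r_neq0 // powRr1.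
have := @norm_partition_sum R R^o 0 T f (fun s t => A `^ q * om s t) P iP.
rewrite ger0_norm; last by apply: sumr_ge0 => i _; exact: powR_ge0.
move=> K; apply: le_trans (K _) _.
  move=> u v u0 uv vT; rewrite ger0_norm ?powR_ge0 //.
  have om_uv := omc.1 _ _ u0 (ltW uv) vT.
  have -> : A `^ q * om u v = (A * om u v `^ q^-1) `^ q.
    by rewrite powRM ?powR_ge0 // -powRrM mulVf ?lt0r_neq0 // powRr1.
  by apply: ge0_ler_powR; rewrite ?nnegrE ?mulr_ge0 ?powR_ge0 ?(ltW q0) //; exact: H.
rewrite /partition_sum -mulr_sumr ler_wpM2l ?powR_ge0 //.
apply: le_trans omC.
exact: (partition_sum_control omc).
Qed.

(** The q-th power of the q-variation over [s, t]; the power is superadditive, the variation itself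
    is not. *)
Definition qvar (s t : R) : R :=
  sup [set partition_sum s t f P | P in [set P | itv_partition s t P]].

Variable B : R.
Hypotheses (B0 : 0 < B) (XiB : (var2 q 0 T Xi <= B%:E)%E).

Lemma partition_sum_sub_le s t P : 0 <= s -> t <= T -> itv_partition s t P ->
  partition_sum s t f P <= B `^ q.
Proof.
move=> s0 tT iP; have st := itv_partition_le iP.
have [P0 iP0] := itv_partition_ex s0; have [P1 iP1] := itv_partition_ex tT.
have := var2_partition_sum XiB (itv_partition_cat iP0 (itv_partition_cat iP iP1)).
rewrite (partition_sum_cat _ _ _ iP0) (partition_sum_cat _ _ _ iP).
have pos a b Q : 0 <= partition_sum a b f Q by apply: sumr_ge0 => i _; exact: powR_ge0.
by have := pos 0 s P0; have := pos t T P1; lra.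
Qed.

Lemma le_qvar s t P : 0 <= s -> t <= T -> itv_partition s t P ->
  partition_sum s t f P <= qvar s t.
Proof.
move=> s0 tT iP; apply: ub_le_sup; last by exists P.
by exists (B `^ q) => _ [Q iQ <-]; exact: partition_sum_sub_le.
Qed.

Lemma qvar_le s t (C : R) : s <= t ->
  (forall P, itv_partition s t P -> partition_sum s t f P <= C) -> qvar s t <= C.
Proof.
move=> st H; apply: ge_sup; last by move=> _ [P iP <-]; exact: H.
by have [P iP] := itv_partition_ex st; exists (partition_sum s t f P); exists P.
Qed.

Lemma qvar_control : control T qvar.
Proof.
split=> [s t s0 st tT|s u t s0 su ut tT].
  have [P iP] := itv_partition_ex st; apply: le_trans (le_qvar s0 tT iP).
  by apply: sumr_ge0 => i _; exact: powR_ge0.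
have u0 := le_trans s0 su; have uT := le_trans ut tT.
rewrite -lerBrDr; apply: qvar_le => // P iP.
rewrite lerBrDl -lerBrDr; apply: qvar_le => // Q iQ.
rewrite lerBrDl -(partition_sum_cat t _ _ iP); apply: le_qvar => //.
exact: (itv_partition_cat iP iQ).
Qed.

Lemma norm_le_qvar s t : 0 <= s -> s < t -> t <= T ->
  `|Xi s t| <= qvar s t `^ q^-1.
Proof.
move=> s0 st tT; have := le_qvar s0 tT (itv_partition1 st).
rewrite partition_sum_cons partition_sum_nil addr0 => H.
rewrite -[leLHS]powRr1 // -(mulfV (lt0r_neq0 q0)) powRrM.
by apply: ge0_ler_powR => //; rewrite ?nnegrE ?powR_ge0 ?invr_ge0 ?(ltW q0) // (le_trans _ H) // powR_ge0.
Qed.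

Hypothesis Xi_right : forall s t, 0 <= s -> s < t -> t <= T ->
  Xi u t @[u --> s^'+] --> Xi s t.

(* The first interval [s, t1] of a nearly optimal partition of [s, T] can be
   shrunk to [u, t1] with [u] close to [s] at little cost, so that [qvar u T] is
   close to [qvar s T] and [qvar s u] is small by superadditivity. *)
Lemma qvar_right s e : 0 <= s -> s < T -> 0 < e ->
  exists u, [/\ s < u, u <= T & qvar s u <= e].
Proof.
move=> s0 sT e0; have e2 : 0 < e / 2 by rewrite divr_gt0.
have [P iP PS] : exists2 P, itv_partition s T P & qvar s T - e / 2 < partition_sum s T f P.
  have [|_ [P iP <-] H] := @sup_adherent R
      [set partition_sum s T f P | P in [set P | itv_partition s T P]] _ e2; last by exists P.
  split; last by exists (B `^ q) => _ [Q iQ <-]; exact: partition_sum_sub_le.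
  by exists (partition_sum s T f [:: T]); exists [:: T] => //; exact: itv_partition1.
case: P iP PS => [/itv_partition_nil sT'|t1 P iP PS].
  by rewrite sT' ltxx in sT.
have st1 := itv_partition_lt iP; have iP1 := itv_partition_cons iP.
have t1T := itv_partition_le iP1.
(* Continuity of the q-th power is taken from its derivative at positive points; when the norm at
   [s] is 0 the difference is at most 0 anyway. *)
have near1 : \forall u \near s^'+, `|Xi s t1| `^ q - `|Xi u t1| `^ q < e / 2.
  have [->|neq0] := eqVneq `|Xi s t1| 0.
    rewrite powR0 ?lt0r_neq0 //; near=> u.
    by rewrite sub0r; apply: le_lt_trans e2; rewrite oppr_le0 powR_ge0.
  have X0 : 0 < `|Xi s t1| by rewrite lt_neqAle eq_sym neq0 normr_ge0.
  have pc : {for `|Xi s t1|, continuous (fun x : R => x `^ q)}.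
    apply/differentiable_continuous/derivable1_diffP.
    by have [] := is_derive1_powR q X0.
  have C : `|Xi u t1| `^ q @[u --> s^'+] --> `|Xi s t1| `^ q.
    exact: (cvg_comp _ _ (cvg_norm (Xi_right s0 st1 t1T)) pc).
  have /cvgrPdist_lt/(_ _ e2) := C.
  by apply: filterS => u; apply: le_lt_trans; exact: ler_norm.
have [u [[su ut1] uX]] : exists u, (s < u /\ u < t1) /\
    `|Xi s t1| `^ q - `|Xi u t1| `^ q < e / 2.
  have : \forall u \near s^'+, (s < u /\ u < t1) /\
    `|Xi s t1| `^ q - `|Xi u t1| `^ q < e / 2.
    near=> u; split; first by split; near: u; [exact: nbhs_right_gt|exact: nbhs_right_lt].
    by near: u.
  by move/filter_ex.
have uT := le_trans (ltW ut1) t1T; have u0 := le_trans s0 (ltW su).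
exists u; split => //.
have iP2 : itv_partition u T (t1 :: P).
  by case: iP1 => pP lP; split => //=; rewrite ut1.
have := le_qvar u0 (lexx T) iP2; have := qvar_control.2 s u T s0 (ltW su) uT (lexx T).
move: PS; rewrite !partition_sum_cons /f.
move: uX; lra.
Unshelve. all: by end_near. Qed.

End VariationControl.

Section ControlExistence.
Context {R : realType} {V : normedModType R}.

(** The q-variation is divided by the q-th power of [B], which leaves a control of total at most 1
    with [B] as a factor in front. For the difference of two drivers this factor is their distance,
    so that one control can serve drivers and differences alike. *)
Lemma control_exists (q T B : R) (Xi : R -> R -> V) :
  0 < q -> 0 <= T -> 0 < B -> (var2 q 0 T Xi <= B%:E)%E ->
  exists om : R -> R -> R,
    [/\ control T om, om 0 T <= 1,
        forall s t, 0 <= s -> s < t -> t <= T -> `|Xi s t| <= B * om s t `^ q^-1 &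
        (forall s t, 0 <= s -> s < t -> t <= T -> Xi u t @[u --> s^'+] --> Xi s t) ->
        forall s e, 0 <= s -> s < T -> 0 < e ->
          exists u, [/\ s < u, u <= T & om s u <= e]].
Proof.
move=> q0 T0 B0 XiB.
have Bq : 0 < B `^ q by rewrite powR_gt0.
have [qc0 qcD] := qvar_control q0 XiB.
exists (fun s t => qvar q Xi s t / B `^ q); split.
- split=> [s t s0 st tT|s u t s0 su ut tT].
    by rewrite divr_ge0 ?qc0 // ltW.
  by rewrite -mulrDl ler_wpM2r ?invr_ge0 ?(ltW Bq) // qcD.
- rewrite ler_pdivrMr // mul1r; apply: qvar_le => // P.
  exact: (var2_partition_sum q0 XiB).
- move=> s t s0 st tT; apply: le_trans (norm_le_qvar q0 XiB s0 st tT) _.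
  have x0 := qc0 _ _ s0 (ltW st) tT.
  have {1}-> : B = (B `^ q) `^ q^-1.
    by rewrite -powRrM mulfV ?lt0r_neq0 // powRr1 // ltW.
  by rewrite -powRM ?divr_ge0 ?(ltW Bq) // mulrC divfK ?lt0r_neq0.
- move=> Xr s e s0 sT e0.
  have [u [su uT qe]] := qvar_right q0 XiB Xr s0 sT (mulr_gt0 e0 Bq).
  by exists u; split => //; rewrite ler_pdivrMr.
Qed.

End ControlExistence.

(** * Sewing and Gronwall on finite sets of times *)

Section NatControl.
Context {R : realType}.
Implicit Types (om : nat -> nat -> R).

Definition ncontrol (n : nat) om : Prop :=
  (forall i j, (i <= j)%N -> (j <= n)%N -> 0 <= om i j) /\
  (forall i m j, (i <= m)%N -> (m <= j)%N -> (j <= n)%N ->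
     om i m + om m j <= om i j).

Lemma ncontrol_le n om i i' j j' : ncontrol n om ->
  (i' <= i)%N -> (i <= j)%N -> (j <= j')%N -> (j' <= n)%N -> om i j <= om i' j'.
Proof.
move=> [om0 omD] i'i ij jj' j'n.
have i'j := leq_trans i'i ij; have jn := leq_trans jj' j'n.
have := omD _ _ _ i'i ij jn; have := omD _ _ _ i'j jj' j'n.
have := om0 _ _ i'i (leq_trans ij jn); have := om0 _ _ jj' j'n; lra.
Qed.

Lemma ncontrolxx n om i : ncontrol n om -> (i <= n)%N -> om i i = 0.
Proof.
move=> [om0 omD] i_n; apply/eqP; rewrite eq_le om0 // andbT.
by have := omD i i i (leqnn _) (leqnn _) i_n; lra.
Qed.

(* The largest [m] with [om i m <= x]: one step further, [x] is exceeded. *)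
Lemma ncontrol_split n om i j x : ncontrol n om -> (i <= j)%N -> (j <= n)%N ->
  0 <= x -> x < om i j ->
  exists m, [/\ (i <= m)%N, (m < j)%N, om i m <= x & om m.+1 j <= om i j - x].
Proof.
move=> omc ij jn x0 xij.
pose P m := (i <= m)%N && (m <= j)%N && (om i m <= x).
have exP : exists m, P m by exists i; rewrite /P leqnn ij /= (ncontrolxx omc) // (leq_trans ij).
have Pj m : P m -> (m <= j)%N by case/andP => /andP[].
case: (ex_maxnP exP Pj) => m /andP[/andP[im mj] omx] mmax.
have mltj : (m < j)%N.
  rewrite ltn_neqAle mj andbT; apply/eqP => mj'.
  by move: omx; rewrite mj' leNgt xij.
exists m; split => //.
have : x < om i m.+1.
  rewrite ltNge; apply/negP => H.
  have /mmax : P m.+1 by rewrite /P mltj H (leq_trans im).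
  by rewrite ltnn.
by have := omc.2 i m.+1 j (leq_trans im (leqnSn _)) mltj jn; lra.
Qed.

(** The contraction factor is 2^(1 - 3/p), less than 1 for p < 3 and increasing in p. Its value at
    [p0] therefore gives one constant for all [p <= p0]. *)
Lemma sewing_constant (p0 : R) : 0 < p0 < 3 ->
  exists2 S : R, 0 < S &
    forall p, 0 < p <= p0 -> 2 + S * (2 * (2^-1 `^ p^-1) ^+ 3) <= S.
Proof.
move=> /andP[p00 p03].
have l2 : 0 < ln (2 : R) by rewrite ln_gt0 // ltr1n.
have E p : (2^-1 `^ p^-1) ^+ 3 = expR (- (3 / p * ln 2)) :> R.
  rewrite -powR_mulrn ?powR_ge0 // -powRrM /powR invr_eq0 pnatr_eq0 /=.
  by rewrite lnV ?posrE // mulrN [p^-1 * _]mulrC.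
pose q : R := 2 * (2^-1 `^ p0^-1) ^+ 3.
have q1 : q < 1.
  rewrite /q E; have : expR (- (3 / p0 * ln 2)) < 2^-1 :> R.
    rewrite -[ltRHS]lnK ?posrE // ltr_expR lnV ?posrE // ltrN2.
    by rewrite ltr_pMl // ltr_pdivlMr ?mul1r.
  by lra.
exists (2 / (1 - q)); first by rewrite divr_gt0 // subr_gt0.
move=> p /andP[p_gt0 pp0].
have pq : 2 * (2^-1 `^ p^-1) ^+ 3 <= q.
  rewrite /q !E ler_wpM2l // ler_expR lerN2 ler_wpM2r ?(ltW l2) //.
  by rewrite ler_wpM2l // lef_pV2 ?posrE.
have q0 : 1 - q != 0 by rewrite subr_eq0 gt_eqF.
apply: (@le_trans _ _ (2 + 2 / (1 - q) * q)).
  by rewrite lerD2l ler_wpM2l // divr_ge0 // subr_ge0 ltW.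
rewrite le_eqVlt; apply/orP; left; apply/eqP; field.
exact: q0.
Qed.

(** Split at a step from [m] to [m.+1] with at most half of the control on either side; the step
    contributes 0, however large its control. The two defects of additivity give [2 * A], the two
    halves [2 * L] times 2^(-3/p), and [S] makes the sum at most [L]. The defect bound may
    presuppose the estimate on the left part, which the induction supplies. *)
Lemma nsewing (V : normedModType R) (p A L S : R) n om (J : nat -> nat -> V) :
  0 < p -> ncontrol n om -> 0 <= A -> 0 <= L -> 0 <= S ->
  2 + S * (2 * (2^-1 `^ p^-1) ^+ 3) <= S -> S * A <= L ->
  (forall i, (i <= n)%N -> J i i = 0) ->
  (forall i, (i < n)%N -> J i i.+1 = 0) ->
  (forall i m j, (i <= m)%N -> (m <= j)%N -> (j <= n)%N ->
     `|J i m| <= L * (om i m `^ p^-1) ^+ 3 ->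
     `|J i j - J i m - J m j| <= A * (om i j `^ p^-1) ^+ 3) ->
  forall i j, (i <= j)%N -> (j <= n)%N -> `|J i j| <= L * (om i j `^ p^-1) ^+ 3.
Proof.
move=> p0 omc A0 L0 S0 hS SA J0 J1 HJ.
set w := fun i j => om i j `^ p^-1.
have w0 i j : 0 <= w i j by exact: powR_ge0.
have hp : 0 <= p^-1 by rewrite invr_ge0 ltW.
move=> i j; have [N] := ubnP (j - i); elim: N i j => // N IH i j jiN ij jn.
have [->|] := eqVneq i j; first by rewrite J0 // normr0 mulr_ge0 // exprn_ge0 // w0.
move=> neq; have ltij : (i < j)%N by rewrite ltn_neqAle neq.
have om0 := omc.1 i j ij jn.
have [m [im mj om1 om2]] : exists m,
    [/\ (i <= m)%N, (m < j)%N, om i m <= om i j / 2 & om m.+1 j <= om i j / 2].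
  have [om_gt0|om_le0] := ltP 0 (om i j); last first.
    exists i; split => //; rewrite ?(ncontrolxx omc) ?divr_ge0 //; first lia.
    apply: le_trans (_ : om i j <= _); last lra.
    by apply: (ncontrol_le omc) => //; lia.
  have [||m [im mj om1 om2]] := @ncontrol_split n om i j (om i j / 2) omc ij jn.
  - by rewrite divr_ge0.
  - by lra.
  by exists m; split => //; lra.
have mn : (m < n)%N by exact: leq_trans jn.
have om10 : 0 <= om i m by apply: omc.1 => //; exact: ltnW.
have om20 : 0 <= om m.+1 j by exact: omc.1.
pose h := (2^-1 : R) `^ p^-1.
have wh x : 0 <= x -> x <= om i j / 2 -> x `^ p^-1 <= w i j * h.
  move=> x0 xo; rewrite -powRM //.
  by apply: ge0_ler_powR => //; rewrite nnegrE // divr_ge0.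
have Lh x : 0 <= x -> x <= om i j / 2 -> L * (x `^ p^-1) ^+ 3 <= L * h ^+ 3 * w i j ^+ 3.
  move=> x0 xo; rewrite -mulrA ler_wpM2l // -exprMn [h * _]mulrC.
  by rewrite lerXn2r ?nnegrE ?mulr_ge0 ?powR_ge0 // wh.
have N1 : (m - i < N)%N by clear -im mj jiN; lia.
have N3 : (j - m.+1 < N)%N by clear -im mj jiN; lia.
have im1 : (i <= m.+1)%N by exact: leqW.
have I1 : `|J i m| <= L * (om i m `^ p^-1) ^+ 3 by apply: IH => //; exact: ltnW.
have I3 : `|J i m.+1| <= L * (om i m.+1 `^ p^-1) ^+ 3 \/ m.+1 = j.
  have [->|neqm] := eqVneq m.+1 j; [by right|left].
  have N2 : (m.+1 - i < N)%N by clear -im mj jiN neqm; lia.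
  exact: IH.
have I2 : `|J m.+1 j| <= L * (om m.+1 j `^ p^-1) ^+ 3 by exact: IH.
have D1 : `|J i m.+1 - J i m - J m m.+1| <= A * w i j ^+ 3.
  apply: le_trans (HJ _ _ _ im (leqnSn _) mn I1) _.
  rewrite ler_wpM2l // lerXn2r ?nnegrE ?powR_ge0 // ge0_ler_powR ?nnegrE //.
    exact: omc.1.
  exact: (ncontrol_le omc).
have D2 : `|J i j - J i m.+1 - J m.+1 j| <= A * w i j ^+ 3.
  have [I3'|<-] := I3; first exact: HJ.
  rewrite subrr J0 // subr0 normr0 mulr_ge0 // exprn_ge0 //; exact: w0.
have -> : J i j = (J i j - J i m.+1 - J m.+1 j) + (J i m.+1 - J i m - J m m.+1) + (J i m + J m.+1 j).
  by rewrite J1 // subr0 -addrA [X in _ + X]addrA subrK -(addrA (J i j)) -opprD subrK.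
apply: le_trans (ler_normD _ _) _.
apply: (@le_trans _ _ (2 * A * w i j ^+ 3 + 2 * L * h ^+ 3 * w i j ^+ 3)).
  apply: lerD.
    by apply: le_trans (ler_normD _ _) _; lra.
  apply: le_trans (ler_normD _ _) _.
  have := le_trans I1 (Lh _ om10 om1); have := le_trans I2 (Lh _ om20 om2); lra.
have hS' : 2 + S * (2 * h ^+ 3) <= S by [].
have h1 : 0 <= h ^+ 3 by rewrite exprn_ge0 // powR_ge0.
rewrite -mulrDl ler_wpM2r ?exprn_ge0 ?w0 //.
move: (h ^+ 3) h1 hS' => x x0 hx.
have x1 : 0 <= 1 - 2 * x.
  by rewrite leNgt; apply/negP => x1; have := mulr_ge0_le0 S0 (ltW x1); nra.
have := ler_wpM2r x1 SA; nra.
Qed.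

(** Subtracting the sum of the one-step values makes the function vanish on single steps and leaves
    its defect of additivity unchanged. *)
Lemma nsewing_sum (V : normedModType R) (p A S : R) n om (J : nat -> nat -> V) :
  0 < p -> ncontrol n om -> 0 <= A -> 0 <= S ->
  2 + S * (2 * (2^-1 `^ p^-1) ^+ 3) <= S ->
  (forall i, (i <= n)%N -> J i i = 0) ->
  (forall i m j, (i <= m)%N -> (m <= j)%N -> (j <= n)%N ->
     `|J i j - J i m - J m j| <= A * (om i j `^ p^-1) ^+ 3) ->
  `|J 0 n - \sum_(0 <= i < n) J i i.+1| <= S * A * (om 0 n `^ p^-1) ^+ 3.
Proof.
move=> p0 omc A0 S0 hS J0 HJ.
apply: (@nsewing _ p A (S * A) S n om
  (fun i j => J i j - \sum_(i <= l < j) J l l.+1)) => //.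
- by rewrite mulr_ge0.
- by move=> i i_n; rewrite J0 // big_geq // subr0.
- by move=> i _; rewrite big_nat1 subrr.
- move=> i m j im mj jn _; apply: le_trans (HJ _ _ _ im mj jn).
  rewrite (big_cat_nat im mj) /=.
  rewrite le_eqVlt; apply/orP; left; apply/eqP; congr (`| _ |).
  set a := \sum_(i <= _ < m) _; set b := \sum_(m <= _ < j) _.
  by rewrite 2!opprB -addrA [X in _ + X]addrACA addrA subrK addrA.
Qed.

(* A discrete Gronwall argument: cut the index set into at most [N.+1] runs of
   control at most [dl], separated by single steps. *)
Lemma ngronwall (A ep dl : R) (N n : nat) om (z : nat -> R) :
  ncontrol n om -> 0 <= A -> 0 <= ep -> 0 < dl -> (forall i, 0 <= z i) ->
  (forall i, (i < n)%N -> z i.+1 <= A * (z i + ep)) ->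
  (forall i j, (i <= j)%N -> (j <= n)%N -> om i j <= dl -> z j <= A * (z i + ep)) ->
  forall i j, (i <= j)%N -> (j <= n)%N -> om i j <= N.+1%:R * dl ->
    z j + ep <= (A + 1) ^+ (2 * N).+1 * (z i + ep).
Proof.
move=> omc A0 ep0 dl0 z0 step run.
have A1 : 1 <= A + 1 by lra.
have grow a b : z b <= A * (z a + ep) -> z b + ep <= (A + 1) * (z a + ep).
  by move=> H; have := z0 a; nra.
have ze i : 0 <= z i + ep by rewrite addr_ge0.
elim: N => [|N IH] i j ij jn omN.
  by rewrite muln0 expr1; apply/grow/run => //; rewrite mul1r in omN.
have [small|big] := leP (om i j) dl.
  apply: le_trans (grow _ _ (run _ _ ij jn small)) _.
  by rewrite ler_wpM2r // -[leLHS]expr1 ler_weXn2l.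
(* One run up to [m] and the step to [m.+1] use up control [dl] and cost two factors [A + 1], hence
   the exponent [(2 * N).+1]. *)
have [m [im mj om1 om2]] := ncontrol_split omc ij jn (ltW dl0) big.
have K : om m.+1 j <= N.+1%:R * dl.
  by apply: le_trans om2 _; rewrite lerBlDr; apply: le_trans omN _; rewrite -natr1; lra.
apply: le_trans (IH _ _ mj jn K) _.
have mn : (m < n)%N by exact: leq_trans jn.
rewrite mulnS -addnS addnC.
rewrite exprD -mulrA ler_wpM2l ?exprn_ge0 //; first lra.
rewrite expr2 -mulrA; apply: le_trans (grow _ _ (step _ mn)) _.
rewrite ler_wpM2l //; first lra.
by apply/grow/run => //; exact: ltnW.
Qed.

(** A self-improving bound: the iterates of [z |-> c + z / 2] tend to the fixed point [2 * c], and
    the slack [e] lets finitely many of them suffice. *)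
Lemma halving (P : R -> Prop) (c z0 e : R) :
  0 < e -> (forall z z', z <= z' -> P z -> P z') -> P z0 ->
  (forall z, P z -> P (c + z / 2)) -> P (2 * c + e).
Proof.
move=> e0 mono Pz0 step.
have H n : P (2 * c + (z0 - 2 * c) / 2 ^+ n).
  elim: n => [|n /step IH]; first by rewrite expr0 divr1 addrC subrK.
  apply: mono IH; rewrite exprS.
  have : (2 : R) ^+ n != 0 by rewrite expf_neq0 // pnatr_eq0.
  move: (2 ^+ n) => x x0; rewrite le_eqVlt; apply/orP; left; apply/eqP.
  by field.
have [n hn] : exists n, `|z0 - 2 * c| / e < 2 ^+ n.
  exists (Num.truncn (`|z0 - 2 * c| / e)).+1.
  apply: lt_trans (truncnS_gt _) _.
  by rewrite -natrX ltr_nat ltn_expl.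
apply: mono (H n); rewrite lerD2l.
apply: le_trans (ler_norm _) _; rewrite normrM normfV [`|2 ^+ n|]ger0_norm ?exprn_ge0 //.
by rewrite ler_pdivrMr ?exprn_gt0 // [e * _]mulrC -ler_pdivrMr // ltW.
Qed.

End NatControl.

Ltac nonneg_with phi0 := repeat first
  [ assumption | exact: ler01 | exact: ler0n | exact: normr_ge0
  | exact: powR_ge0 | apply: phi0 | apply: ltW; assumption
  | apply: addr_ge0 | apply: mulr_ge0 | apply: exprn_ge0
  | rewrite invr_ge0 ].

(** * Euler schemes of abstract fields and their a priori bounds *)

Section AbstractFields.
Context {R : realType} {E E2 V : normedModType R}.
Variable tens : E -> E -> E2.

(* One step of the scheme moves [y] by [f1 y x + f2 y A], where [(x, A)] is an
   increment of the driver; [fd] is the defect of additivity of this step. *)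
Record vfield := VField {
  f1 : V -> E -> V;
  f2 : V -> E2 -> V;
  fd : V -> V -> E -> E -> E2 -> V;
  fdE : forall y y' x1 x2 A1 A2,
    f1 y (x1 + x2) + f2 y (A1 + A2 + tens x1 x2) - (f1 y x1 + f2 y A1)
      - (f1 y' x2 + f2 y' A2) = - fd y y' x1 x2 A2 }.

Implicit Types (F G : vfield) (phi : R -> R).

Definition euler F y x A := f1 F y x + f2 F y A.

(** All that the analysis uses of the smoothness of the fields: constants [N] in the data give the
    constant [phi N] in the terms of the scheme, for positions at distance at most [e]. For [F = G]
    and [e = 0] these are size estimates for one equation. The defect of additivity is of third
    order and vanishes with either of the two intervals. *)
Definition compatible phi e F G : Prop := forall N, 0 <= N ->
  [/\ 0 <= phi N,
      forall y z x x' v, 0 <= v -> `|y - z| <= e -> close N e v x x' ->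
        close (phi N) e v (f1 F y x) (f1 G z x'),
      forall y z A A' v, 0 <= v -> `|y - z| <= e -> close N e v A A' ->
        close (phi N) e v (f2 F y A) (f2 G z A') &
      forall y z y' z' x1 x1' x2 x2' A2 A2' v u,
        0 <= v -> 0 <= u -> `|y - z| <= e -> `|y' - z'| <= e ->
        close N e v (y' - y) (z' - z) ->
        close N e (v ^+ 2) (y' - y - f1 F y x1) (z' - z - f1 G z x1') ->
        close N e u x2 x2' -> close N e (u ^+ 2) A2 A2' ->
        close (phi N) e (v * u * (v + u)) (fd F y y' x1 x2 A2) (fd G z z' x1' x2' A2')].

Section Defect.
Context {I : Type}.
Variables (X : I -> E) (XX : I -> I -> E2).

Definition chen_at (s u t : I) : Prop :=
  XX s t = XX s u + XX u t + tens (X u - X s) (X t - X u).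

Definition defect F (Y : I -> V) s t := Y t - Y s - euler F (Y s) (X t - X s) (XX s t).

Lemma defect_delta F Y s u t : chen_at s u t ->
  defect F Y s t - defect F Y s u - defect F Y u t =
  fd F (Y s) (Y u) (X u - X s) (X t - X u) (XX u t).
Proof.
move=> ch; apply: oppr_inj; rewrite -(fdE F (Y s) (Y u) _ _ (XX s u)).
have -> : X u - X s + (X t - X u) = X t - X s by rewrite addrC subrKA.
have -> : XX s u + XX u t + tens (X u - X s) (X t - X u) = XX s t by rewrite ch.
rewrite /defect /euler.
move: (f1 F (Y s) (X t - X s) + _) (f1 F (Y s) (X u - X s) + _) (f1 F (Y u) _ + _) => a b c.
zmodule.
Qed.

End Defect.

(** Adding the second-order term [f2] back to the defect gives the remainder of a controlled path,
    and adding [f1] gives the increment; [W] absorbs the surplus power of [w]. *)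
Lemma defect_close phi F G (N W e w : R) y y' z z' x1 x1' A1 A1' :
  compatible phi e F G -> 0 <= N -> 0 <= e -> 0 <= w <= W ->
  `|y - z| <= e -> close N e w x1 x1' -> close N e (w ^+ 2) A1 A1' ->
  close N e (w ^+ 2) (y' - y - euler F y x1 A1) (z' - z - euler G z x1' A1') ->
  [/\ close (phi N + N) e (w ^+ 2) (y' - y - f1 F y x1) (z' - z - f1 G z x1') &
      close (phi N + (phi N + N) * W) e w (y' - y) (z' - z)].
Proof.
move=> FG N0 e0 /andP[w0 wW] yz cx cA cj.
have [phi0 c1 c2 _] := FG N N0.
have w20 : 0 <= w ^+ 2 by rewrite exprn_ge0.
have R2 : close (phi N + N) e (w ^+ 2) (y' - y - f1 F y x1) (z' - z - f1 G z x1').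
  have -> : y' - y - f1 F y x1 = f2 F y A1 + (y' - y - euler F y x1 A1).
    rewrite /euler; zmodule.
  have -> : z' - z - f1 G z x1' = f2 G z A1' + (z' - z - euler G z x1' A1').
    rewrite /euler; zmodule.
  by apply: closeD => //; exact: c2.
split=> //.
have -> : y' - y = f1 F y x1 + (y' - y - f1 F y x1) by zmodule.
have -> : z' - z = f1 G z x1' + (z' - z - f1 G z x1') by zmodule.
apply: closeD; first exact: c1.
apply: closeW R2 => //; rewrite ?addr_ge0 // expr2 mulrA -!mulrA.
by rewrite ler_wpM2l ?addr_ge0 // ler_wpM2r.
Qed.

Lemma closexx (N v : R) (U : normedModType R) (a : U) : close N 0 v a a -> `|a| <= N * v.
Proof. by case. Qed.

(* The sizes for a single solution, i.e. [defect_close] on the diagonal. *)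
Lemma defect_size phi F (N W w : R) y y' x1 A1 :
  compatible phi 0 F F -> 0 <= N -> 0 <= w <= W ->
  `|x1| <= N * w -> `|A1| <= N * w ^+ 2 ->
  `|y' - y - euler F y x1 A1| <= N * w ^+ 2 ->
  `|y' - y - f1 F y x1| <= (phi N + N) * w ^+ 2 /\
  `|y' - y| <= (phi N + (phi N + N) * W) * w.
Proof.
move=> FF N0 w0 hx hA hj.
have [||||H1 H2] := @defect_close phi F F N W 0 w y y' y y' x1 x1 A1 A1 FF N0 (lexx 0) w0.
- by rewrite subrr normr0.
- exact: close_refl.
- exact: close_refl.
- exact: close_refl.
by split; exact: closexx.
Qed.

Lemma euler_size phi F (N W w : R) y x1 A1 :
  compatible phi 0 F F -> 0 <= N -> 0 <= w <= W ->
  `|x1| <= N * w -> `|A1| <= N * w ^+ 2 ->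
  `|euler F y x1 A1| <= phi N * (1 + W) * w.
Proof.
move=> FF N0 /andP[w0 wW] hx hA; have [phi0 c1 c2 _] := FF N N0.
have yy : `|y - y| <= 0 by rewrite subrr normr0.
have := closexx (c1 _ _ _ _ _ w0 yy (close_refl hx)).
have := closexx (c2 _ _ _ _ _ (exprn_ge0 2 w0) yy (close_refl hA)).
move=> h2 h1; apply: le_trans (ler_normD _ _) _.
apply: le_trans (lerD h1 h2) _.
rewrite mulrDr mulr1 mulrDl lerD2l expr2 -mulrA ler_wpM2l //.
by rewrite ler_wpM2r.
Qed.

Lemma fd_size phi F (N v u : R) y y' x1 x2 A2 :
  compatible phi 0 F F -> 0 <= N -> 0 <= v -> 0 <= u ->
  `|y' - y| <= N * v -> `|y' - y - f1 F y x1| <= N * v ^+ 2 ->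
  `|x2| <= N * u -> `|A2| <= N * u ^+ 2 ->
  `|fd F y y' x1 x2 A2| <= phi N * (v * u * (v + u)).
Proof.
move=> FF N0 v0 u0 h1 h2 h3 h4; have [_ _ _ c] := FF N N0.
have yy z : `|z - z : V| <= 0 by rewrite subrr normr0.
exact: closexx (c _ _ _ _ _ _ _ _ _ _ _ _ v0 u0 (yy y) (yy y')
  (close_refl h1) (close_refl h2) (close_refl h3) (close_refl h4)).
Qed.

Section APriori.
Variables (p N K S : R) (phi : R -> R).
Hypotheses (p1 : 1 <= p) (N0 : 0 <= N) (K0 : 0 <= K) (S0 : 0 <= S).
Hypothesis phi0 : forall x, 0 <= x -> 0 <= phi x.
Hypothesis Sp : 2 + S * (2 * (2^-1 `^ p^-1) ^+ 3) <= S.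

Let w (om : nat -> nat -> R) i j := om i j `^ p^-1.

Lemma root_le (x y : R) : 0 <= x -> x <= y -> x `^ p^-1 <= 1 + y.
Proof.
move=> x0 xy; have y0 := le_trans x0 xy.
apply: (@le_trans _ _ ((1 + y) `^ p^-1)).
  by apply: ge0_ler_powR; rewrite ?nnegrE ?addr_ge0 ?invr_ge0 ?(le_trans ler01 p1) //; lra.
apply: ler1_powR; first by rewrite lerDl.
by rewrite invf_le1 // (lt_le_trans ltr01).
Qed.

Record discrete_scheme n om F (X : nat -> E) XX (Y : nat -> V) : Prop := DiscreteScheme {
  ds_control : ncontrol n om;
  ds_total : om 0 n <= K;
  ds_field : compatible phi 0 F F;
  ds_X : forall i j, (i <= j)%N -> (j <= n)%N -> `|X j - X i| <= N * w om i j;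
  ds_XX : forall i j, (i <= j)%N -> (j <= n)%N -> `|XX i j| <= N * w om i j ^+ 2;
  ds_chen : forall i m j, (i <= m)%N -> (m <= j)%N -> (j <= n)%N -> chen_at X XX i m j;
  ds_euler0 : forall y, euler F y 0 0 = 0;
  ds_step : forall i, (i < n)%N -> defect X XX F Y i i.+1 = 0 }.

Section Scheme.
Variables (n : nat) (om : nat -> nat -> R) (F : vfield).
Variables (X : nat -> E) (XX : nat -> nat -> E2) (Y : nat -> V).
Hypothesis ds : discrete_scheme n om F X XX Y.

Lemma w_ge0 i j : 0 <= w om i j. Proof. exact: powR_ge0. Qed.

Lemma w_le i i' j j' : (i' <= i)%N -> (i <= j)%N -> (j <= j')%N -> (j' <= n)%N ->
  w om i j <= w om i' j'.
Proof.
move=> i'i ij jj' j'n; have omc := ds_control ds.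
have H := ncontrol_le omc i'i ij jj' j'n.
have H0 := omc.1 i j ij (leq_trans jj' j'n).
by apply: ge0_ler_powR; rewrite ?nnegrE ?invr_ge0 ?(le_trans ler01 p1) // (le_trans H0).
Qed.

Lemma w_bound i j : (i <= j)%N -> (j <= n)%N -> w om i j <= 1 + K.
Proof.
move=> ij jn; have omc := ds_control ds; apply: root_le; first exact: omc.1.
by apply: le_trans (ds_total ds); exact: (ncontrol_le omc).
Qed.

Lemma defectxx i : (i <= n)%N -> defect X XX F Y i i = 0.
Proof.
move=> i_n; rewrite /defect !subrr.
have -> : XX i i = 0.
  apply/eqP; rewrite -normr_le0.
  apply: le_trans (ds_XX ds (leqnn _) i_n) _.
  rewrite /w (ncontrolxx (ds_control ds)) // powR0 ?invr_eq0 ?gt_eqF ?(lt_le_trans ltr01 p1) //.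
  by rewrite expr0n mulr0.
by rewrite (ds_euler0 ds) subrr.
Qed.

Lemma scheme_euler_size i j : (i <= j)%N -> (j <= n)%N ->
  `|euler F (Y i) (X j - X i) (XX i j)| <= phi N * (1 + (1 + K)) * w om i j.
Proof.
move=> ij jn; apply: (euler_size _ (ds_field ds) N0).
- by rewrite w_ge0 w_bound.
- exact: (ds_X ds).
- exact: (ds_XX ds).
Qed.

(* [v] is the size of the first of the two intervals. *)
Lemma scheme_delta N1 N2 i m j v :
  N <= N1 -> N1 + phi N1 + (phi N1 + N1) * (1 + K) <= N2 ->
  (i <= m)%N -> (m <= j)%N -> (j <= n)%N ->
  w om i m <= v -> v <= 1 + K ->
  `|defect X XX F Y i m| <= N1 * w om i m ^+ 2 ->
  `|defect X XX F Y i j - defect X XX F Y i m - defect X XX F Y m j| <=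
    phi N2 * (v * w om i j * (v + w om i j)).
Proof.
move=> NN1 NN2 im mj jn wv vK hJ.
have mn := leq_trans mj jn; have ij := leq_trans im mj.
rewrite (defect_delta F Y (ds_chen ds im mj jn)).
have N10 := le_trans N0 NN1; have phi1 := phi0 N10.
have K1 : 0 <= 1 + K by rewrite addr_ge0.
have P1 : 0 <= (phi N1 + N1) * (1 + K) by rewrite mulr_ge0 // addr_ge0.
have w0 := w_ge0 i m; have v0 := le_trans w0 wv.
have wij : w om m j <= w om i j by exact: w_le.
have NN : N <= N2 by lra.
have [r1 r2] : `|Y m - Y i - f1 F (Y i) (X m - X i)| <= (phi N1 + N1) * w om i m ^+ 2 /\
  `|Y m - Y i| <= (phi N1 + (phi N1 + N1) * (1 + K)) * w om i m.
  apply: (@defect_size phi F N1 (1 + K) (w om i m) _ _ _ (XX i m)) => //.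
  - exact: (ds_field ds).
  - by rewrite w0 w_bound.
  - by apply: le_trans (ds_X ds im mn) _; rewrite ler_wpM2r.
  - by apply: le_trans (ds_XX ds im mn) _; rewrite ler_wpM2r ?exprn_ge0.
have N20 : 0 <= N2 by lra.
apply: fd_size => //; rewrite ?w_ge0 //.
- exact: (ds_field ds).
- apply: le_trans r2 _; apply: ler_pM => //; first by rewrite !addr_ge0.
  lra.
- apply: le_trans r1 _; apply: ler_pM => //; rewrite ?exprn_ge0 ?addr_ge0 //.
    lra.
  by rewrite lerXn2r ?nnegrE.
- apply: le_trans (ds_X ds mj jn) _; apply: ler_pM => //; exact: w_ge0.
- apply: le_trans (ds_XX ds mj jn) _; apply: ler_pM => //; rewrite ?exprn_ge0 ?w_ge0 //.
  by rewrite lerXn2r ?nnegrE ?w_ge0.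
Qed.

Let N1 := N + 1.
Let N2 := N1 + phi N1 + (phi N1 + N1) * (1 + K).

(** The estimate of the additivity defect requires a bound of order [w ^+ 2] on the defect with
    constant [N1], and [L] depends on [N1]. The smallness [L * w <= 1] breaks the circle, as it
    turns [L * w ^+ 3] into at most [w ^+ 2]. *)
Lemma scheme_local (L := S * (phi N2 * 2)) i j :
  (i <= j)%N -> (j <= n)%N -> L * w om i j <= 1 ->
  `|defect X XX F Y i j| <= L * w om i j ^+ 3.
Proof.
move=> ij jn Lw.
have N10 : 0 <= N1 by rewrite addr_ge0.
have N20 : 0 <= N2 by rewrite !addr_ge0 ?mulr_ge0 ?addr_ge0 ?phi0.
have A0 : 0 <= phi N2 * 2 by rewrite mulr_ge0 ?phi0.
have L0 : 0 <= L by rewrite mulr_ge0.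
have omc := ds_control ds.
pose om' a b := om (i + a)%N (i + b)%N.
have om'c : ncontrol (j - i) om'.
  have le_n b : (b <= j - i)%N -> (i + b <= n)%N.
    by rewrite leq_subRL // => /leq_trans; apply.
  split=> [a b ab /le_n bn|a m b am mb /le_n bn]; rewrite /om'.
    by apply: omc.1; rewrite ?leq_add2l.
  by apply: omc.2; rewrite ?leq_add2l.
have := @nsewing R V p (phi N2 * 2) L S (j - i) om'
  (fun a b => defect X XX F Y (i + a)%N (i + b)%N)
  (lt_le_trans ltr01 p1) om'c A0 L0 S0 Sp (lexx _).
have E1 : (i + (j - i) = j)%N by rewrite subnKC.
have le_j b : (b <= j - i)%N -> (i + b <= j)%N by rewrite -{2}E1 leq_add2l.
move=> /(_ _ _ _ 0%N (j - i)%N (leq0n _) (leqnn _)).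
rewrite addn0 /om' addn0 E1; apply.
- by move=> a /le_j aj; rewrite defectxx // (leq_trans aj).
- by move=> a /le_j; rewrite addnS => aj; rewrite (ds_step ds) // (leq_trans aj).
- move=> a m b am mb /le_j bj hJ.
  have am' : (i + a <= i + m)%N by rewrite leq_add2l.
  have mb' : (i + m <= i + b)%N by rewrite leq_add2l.
  have bn := leq_trans bj jn; have mn := leq_trans mb' bn.
  have wam : L * w om (i + a) (i + m) <= 1.
    apply: le_trans Lw; rewrite ler_wpM2l // w_le ?leq_addr //.
    exact: leq_trans mb' bj.
  have H : `|defect X XX F Y (i + a) (i + m)| <= N1 * w om (i + a) (i + m) ^+ 2.
    apply: le_trans hJ _; rewrite -/(w om _ _) exprSr mulrCA mulrC.
    apply: ler_wpM2r; first by rewrite exprn_ge0 ?w_ge0.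
    by apply: le_trans wam _; rewrite lerDr.
  have wle : w om (i + a) (i + m) <= w om (i + a) (i + b) by exact: w_le.
  apply: le_trans (scheme_delta _ (lexx _) am' mb' bn wle _ H) _.
  + by rewrite lerDl.
  + by apply: w_bound => //; exact: leq_trans mb'.
  + rewrite -/(w om _ _) le_eqVlt; apply/orP; left; apply/eqP; ring.
Qed.

End Scheme.

(** The last bound stops at [j.-1] and so ignores a jump in the final step: that step has defect 0,
    and the defect of additivity on adding it has a factor [w om i j.-1]. *)
Lemma scheme_apriori : exists2 C : R, 0 <= C &
  forall n om F X XX Y, discrete_scheme n om F X XX Y ->
  forall i j, (i <= j)%N -> (j <= n)%N ->
  [/\ `|defect X XX F Y i j| <= C * w om i j ^+ 3, `|Y j - Y i| <= C &
      (i < j)%N -> `|defect X XX F Y i j| <= C * w om i j.-1].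
Proof.
pose N1 := N + 1.
pose N2 := N1 + phi N1 + (phi N1 + N1) * (1 + K).
pose L := S * (phi N2 * 2).
have N10 : 0 <= N1 by nonneg_with phi0.
have N20 : 0 <= N2 by nonneg_with phi0.
have L0 : 0 <= L by nonneg_with phi0.
have p0 := lt_le_trans ltr01 p1.
(* Control at most [dl] forces [w <= (L + 1)^-1], hence [L * w <= 1]. *)
pose dl := ((L + 1)^-1) `^ p.
have L1 : 0 < L + 1 by rewrite ltr_wpDl.
have dl0 : 0 < dl by rewrite powR_gt0 // invr_gt0.
have dlr : dl `^ p^-1 = (L + 1)^-1.
  by rewrite /dl -powRrM mulfV ?gt_eqF // powRr1 // invr_ge0 ltW.
pose e1 := phi N * (1 + (1 + K)) * (1 + K).
have e10 : 0 <= e1 by nonneg_with phi0.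
pose c := e1 + L * (1 + K) ^+ 3.
have K1 : 0 <= 1 + K by nonneg_with phi0.
have c0 : 0 <= c by nonneg_with phi0.
pose M := Num.truncn (K / dl).
(* The Gronwall bound with factor 1: [c] bounds the increment over a run or a single step, and the
   distance to the starting point begins at 0. *)
pose C1 := (1 + 1) ^+ (2 * M).+1 * (0 + c).
have C10 : 0 <= C1 by nonneg_with phi0.
(* Where the control exceeds [dl], [(L + 1) * w >= 1], so the cubic bound follows from the plain
   bound [C1 + e1]. *)
pose C2 := L + (C1 + e1) * (L + 1) ^+ 3.
have C20 : 0 <= C2 by nonneg_with phi0.
pose N3 := (C2 * (1 + K) + N) + phi (C2 * (1 + K) + N) + (phi (C2 * (1 + K) + N) + (C2 * (1 + K) + N)) * (1 + K).
have N31 : 0 <= C2 * (1 + K) + N by nonneg_with phi0.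
have N30 : 0 <= N3 by nonneg_with phi0.
pose C3 := C2 * (1 + K) ^+ 2 + phi N3 * ((1 + K) * ((1 + K) + (1 + K))).
have C30 : 0 <= C3 by nonneg_with phi0.
exists (C1 + C2 + C3); first by nonneg_with phi0.
move=> n om F X XX Y ds.
have omc := ds_control ds; have w0 i j : 0 <= w om i j := powR_ge0 _ _.
have wK i j : (i <= j)%N -> (j <= n)%N -> w om i j <= 1 + K by exact: (w_bound ds).
have eul i j : (i <= j)%N -> (j <= n)%N -> `|euler F (Y i) (X j - X i) (XX i j)| <= e1.
  move=> ij jn; apply: le_trans (scheme_euler_size ds ij jn) _.
  by rewrite ler_wpM2l ?wK // !mulr_ge0 ?addr_ge0 ?phi0.
have incE i j : Y j - Y i = euler F (Y i) (X j - X i) (XX i j) + defect X XX F Y i j.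
  by rewrite /defect; zmodule.
have small i j : (i <= j)%N -> (j <= n)%N -> om i j <= dl -> L * w om i j <= 1.
  move=> ij jn h; apply: (@le_trans _ _ (L * (L + 1)^-1)).
    rewrite ler_wpM2l // -dlr; apply: ge0_ler_powR => //; rewrite ?nnegrE ?invr_ge0 ?(ltW p0) ?(ltW dl0) //.
    exact: omc.1.
  by rewrite ler_pdivrMr // mul1r lerDl.
have loc i j : (i <= j)%N -> (j <= n)%N -> om i j <= dl ->
    `|defect X XX F Y i j| <= L * w om i j ^+ 3.
  by move=> ij jn h; apply: (scheme_local ds) => //; exact: small.
have chunk i j : (i <= j)%N -> (j <= n)%N -> `|Y j - Y i| <= C1.
  move=> ij jn.
  have omM : om i j <= M.+1%:R * dl.
    rewrite -ler_pdivrMr //; apply/ltW; apply: le_lt_trans (truncnS_gt _).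
    rewrite ler_wpM2r ?invr_ge0 ?(ltW dl0) //; apply: le_trans (ds_total ds).
    exact: (ncontrol_le omc).
  have tri a b : `|Y b - Y i| <= `|Y a - Y i| + `|Y b - Y a|.
    have -> : Y b - Y i = (Y a - Y i) + (Y b - Y a) by zmodule.
    exact: ler_normD.
  have := @ngronwall R 1 c dl M n om (fun l => `|Y l - Y i|) omc ler01 c0 dl0.
  move=> /(_ (fun=> normr_ge0 _) _ _ i j ij jn omM) H.
  apply: le_trans (_ : _ <= `|Y j - Y i| + c) _; first by rewrite lerDl.
  apply: le_trans (H _ _) _.
  - move=> l ln; rewrite mul1r; apply: le_trans (tri l l.+1) _; rewrite lerD2l.
    rewrite incE (ds_step ds) // addr0; apply: le_trans (eul _ _ _ _) _ => //.
    by rewrite lerDl mulr_ge0 // exprn_ge0.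
  - move=> a b ab bn h; rewrite mul1r; apply: le_trans (tri a b) _; rewrite lerD2l.
    rewrite incE; apply: le_trans (ler_normD _ _) _; apply: lerD; first exact: eul.
    apply: le_trans (loc _ _ ab bn h) _; rewrite ler_wpM2l //.
    by rewrite lerXn2r ?nnegrE // wK.
  - by rewrite subrr normr0.
have glob i j : (i <= j)%N -> (j <= n)%N -> `|defect X XX F Y i j| <= C2 * w om i j ^+ 3.
  move=> ij jn; rewrite mulrDl; have [h|h] := leP (om i j) dl.
    apply: le_trans (loc _ _ ij jn h) _; rewrite lerDl.
    by rewrite !mulr_ge0 ?exprn_ge0 ?addr_ge0 // ltW.
  apply: (@le_trans _ _ (C1 + e1)).
    have -> : defect X XX F Y i j = (Y j - Y i) - euler F (Y i) (X j - X i) (XX i j) by [].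
    by apply: le_trans (ler_normB _ _) _; apply: lerD; [exact: chunk|exact: eul].
  rewrite -[leLHS]add0r; apply: lerD; first by rewrite mulr_ge0 ?exprn_ge0.
  rewrite -mulrA -exprMn ler_peMr ?addr_ge0 // exprn_ege1 //.
  rewrite -ler_pdivrMl // mulr1 -dlr.
  by apply: ge0_ler_powR; rewrite ?nnegrE ?invr_ge0 ?(ltW p0) ?(ltW dl0) ?(ltW h) // omc.1.
move=> i j ij jn; split.
- apply: le_trans (glob _ _ ij jn) _; rewrite ler_wpM2r ?exprn_ge0 //; lra.
- by apply: le_trans (chunk _ _ ij jn) _; lra.
case: j ij jn => // j _ jn ij /=; rewrite ltnS in ij.
have jn' := ltnW jn.
have := scheme_delta ds (_ : N <= C2 * (1 + K) + N) (lexx _) ij (leqnSn j) jn (lexx _) (wK _ _ ij jn').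
rewrite (ds_step ds) // subr0 => H.
have -> : defect X XX F Y i j.+1 = (defect X XX F Y i j.+1 - defect X XX F Y i j) + defect X XX F Y i j.
  by zmodule.
apply: le_trans (ler_normD _ _) _.
apply: (@le_trans _ _ (phi N3 * ((1 + K) * ((1 + K) + (1 + K))) * w om i j + C2 * (1 + K) ^+ 2 * w om i j)); last first.
  by rewrite -mulrDl ler_wpM2r // [leLHS]addrC -/C3 lerDr addr_ge0.
apply: lerD.
  apply: le_trans (H _ _) _; first by rewrite lerDr mulr_ge0.
    apply: le_trans (glob _ _ ij jn') _; rewrite [leRHS]mulrDl exprS mulrA.
    apply: (@le_trans _ _ (C2 * (1 + K) * w om i j ^+ 2)).
      by rewrite ler_wpM2r ?exprn_ge0 // ler_wpM2l // wK.
    by rewrite lerDl mulr_ge0 ?exprn_ge0.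
  have hj := wK i j.+1 (leqW ij) jn; have hi := wK i j ij jn'.
  rewrite -/N3 -[leRHS]mulrA; apply: ler_wpM2l; first exact: phi0.
  rewrite [leRHS]mulrC -mulrA; apply: ler_wpM2l; first exact: w0.
  by apply: ler_pM; rewrite ?addr_ge0 ?lerD.
apply: le_trans (glob _ _ ij jn') _; rewrite exprSr mulrA ler_wpM2r // ler_wpM2l //.
by rewrite lerXn2r ?nnegrE // wK.
Qed.

End APriori.

End AbstractFields.

(* Compactness by ultrafilters: functions [ys S] attached to the finite
   sequences [S] have a pointwise limit along finer and finer [S]. *)
Lemma pointwise_compactness (I : eqType) (U : topologicalType) (A : set U)
    (ys : seq I -> I -> U) :
  compact A -> (forall S i, A (ys S i)) ->
  exists (G : set_system (seq I)) (Y : I -> U),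
    [/\ ProperFilter G, forall S : seq I, G [set S' : seq I | {subset S <= S'}] &
        forall i, ys S i @[S --> G] --> Y i].
Proof.
move=> cA yA.
pose F : set_system (seq I) := 
  filter_from setT (fun S : seq I => [set S' : seq I | {subset S <= S'}]).
have FF : ProperFilter F.
  apply: filter_from_proper; last by move=> S _; exists S.
  apply: filter_from_filter; first by exists [::].
  move=> S S' _ _; exists (S ++ S') => // S'' H; split=> x xS; apply: H; rewrite mem_cat xS ?orbT //.
have [G [GU FG]] := ultraFilterLemma FF.
have GP : ProperFilter G by exact: ultra_proper.
have lim i : exists y : U, ys S i @[S --> G] --> y.
  have PG : ProperFilter (ys S i @[S --> G]) by exact: fmap_proper_filter.
  have [|y [Ay cy]] := cA _ PG; first by apply: (@filterE _ G) => S; exact: yA.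
  exists y => B By.
  have [//|GnB] := in_ultra_setVsetC (ys ^~ i @^-1` B) GU.
  by have [z [nBz Bz]] := cy (~` B) B GnB By.
have [Y HY] := choice lim.
exists G, Y; split=> // S; apply: FG; by exists S.
Qed.

(** * Existence *)

Section Existence.
Context {R : realType} {E E2 V : normedModType R}.
Variable tens : E -> E -> E2.
Variables (p N K S : R) (phi : R -> R).
Hypotheses (p1 : 1 <= p) (N0 : 0 <= N) (K0 : 0 <= K) (S0 : 0 <= S).
Hypothesis phi0 : forall x, 0 <= x -> 0 <= phi x.
Hypothesis Sp : 2 + S * (2 * (2^-1 `^ p^-1) ^+ 3) <= S.

Local Notation w om s t := (om s t `^ p^-1).
Local Notation vfield := (@vfield R E E2 V tens).

Record rough_driver T (om : R -> R -> R) (X : R -> E) (XX : R -> R -> E2) : Prop :=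
  RoughDriver {
  rd_control : control T om;
  rd_total : om 0 T <= K;
  rd_X : forall s t, 0 <= s -> s <= t -> t <= T -> `|X t - X s| <= N * w om s t;
  rd_XX : forall s t, 0 <= s -> s <= t -> t <= T -> `|XX s t| <= N * w om s t ^+ 2;
  rd_chen : forall s u t, 0 <= s -> s <= u -> u <= t -> t <= T -> chen_at tens X XX s u t }.

Lemma sorted_enumeration (T : R) (l : seq R) : 0 <= T ->
  (forall x, x \in l -> 0 <= x <= T) ->
  exists n (t : nat -> R), [/\ t 0%N = 0,
    forall i, (i <= n)%N -> 0 <= t i <= T,
    forall i j, (i < j)%N -> (j <= n)%N -> t i < t j &
    forall x, x \in l -> exists2 i, (i <= n)%N & t i = x].
Proof.
move=> T0 lT; pose l' := sort <=%R (undup (0 :: l)).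
have l's : sorted <%R l' by rewrite sort_lt_sorted undup_uniq.
have meml' x : (x \in l') = (x \in 0 :: l) by rewrite mem_sort mem_undup.
have l'T x : x \in l' -> 0 <= x <= T.
  by rewrite meml' inE => /predU1P[->|/lT //]; rewrite lexx.
have sl' : (0 < size l')%N by rewrite -has_predT; apply/hasP; exists 0; rewrite ?meml' ?mem_head.
exists (size l').-1, (nth T l').
have ltn i : (i <= (size l').-1)%N -> (i < size l')%N by rewrite -ltnS prednK.
have mono i j : (i < j)%N -> (j <= (size l').-1)%N -> nth T l' i < nth T l' j.
  move=> ij jn; rewrite (lt_sorted_ltn_nth T l's) ?inE ?ltn //.
  exact: leq_trans (ltnW ij) jn.
split=> //.
- have /(nthP T) [i il E0] : 0 \in l' by rewrite meml' mem_head.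
  case: i il E0 => // i il E0.
  have := mono 0%N i.+1 (ltn0Sn _); rewrite -ltnS prednK // il => /(_ isT).
  by rewrite E0 ltNge; have /andP[-> _] := l'T _ (mem_nth T sl').
- by move=> i /ltn il; apply: l'T; exact: mem_nth.
- move=> x xl; have /(nthP T) [i il Ei] : x \in l' by rewrite meml' inE xl orbT.
  by exists i => //; rewrite -ltnS prednK.
Qed.

Fixpoint euler_scheme (F : vfield) (X : nat -> E) (XX : nat -> nat -> E2) (y0 : V) (i : nat) : V :=
  if i is j.+1 then
    let y := euler_scheme F X XX y0 j in y + euler F y (X j.+1 - X j) (XX j j.+1)
  else y0.

(** The predecessor of [t] in the grid depends on [l]. The last bound is therefore stated with any
    [c] valid for all [u < t]; in this form it is uniform in [l] and passes to the limit. *)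
Lemma finite_solution : exists2 C : R, 0 <= C &
  forall T om F X XX y0, 0 <= T -> rough_driver T om X XX ->
  compatible phi 0 F F -> (forall y, euler F y 0 0 = 0 :> V) ->
  forall l : seq R, exists Y : R -> V,
  [/\ Y 0 = y0, forall t, `|Y t - y0| <= C &
      forall s t, 0 <= s -> s < t -> t <= T -> s \in l -> t \in l ->
      `|defect X XX (F : vfield) Y s t| <= C * w om s t ^+ 3 /\
      forall c, (forall u, s <= u -> u < t -> w om s u <= c) ->
        `|defect X XX F Y s t| <= C * c].
Proof.
have [C C0 HC] := @scheme_apriori R E E2 V tens p N K S phi p1 N0 K0 S0 phi0 Sp.
exists C => // T om F X XX y0 T0 [omc omK hX hXX hch] FF F0 l.
have [|n [t [t0 tT tlt tl]]] := @sorted_enumeration T [seq x <- l | 0 <= x <= T] T0.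
  by move=> x; rewrite mem_filter => /andP[].
have tle i j : (i <= j)%N -> (j <= n)%N -> t i <= t j.
  by rewrite leq_eqVlt => /predU1P[->//|ij jn]; apply/ltW/tlt.
pose Xn i := X (t i); pose XXn i j := XX (t i) (t j); pose omn i j := om (t i) (t j).
pose e := euler_scheme F Xn XXn y0.
have tb i j : (i <= j)%N -> (j <= n)%N -> [/\ 0 <= t i, t i <= t j & t j <= T].
  move=> ij jn; have /andP[? _] := tT i (leq_trans ij jn); have /andP[_ ?] := tT j jn.
  by split=> //; exact: tle.
have ds : discrete_scheme p N K phi n omn F Xn XXn e.
  split=> //.
  - split=> [i j ij jn|i m j im mj jn]; first by have [? ? ?] := tb _ _ ij jn; exact: omc.1.
    have [? ? ?] := tb _ _ im (leq_trans mj jn); have [? ? ?] := tb _ _ mj jn.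
    exact: omc.2.
  - have [? ? ?] := tb 0%N n (leq0n _) (leqnn _).
    by apply: le_trans omK; apply: (control_le omc).
  - by move=> i j ij jn; have [? ? ?] := tb _ _ ij jn; exact: hX.
  - by move=> i j ij jn; have [? ? ?] := tb _ _ ij jn; exact: hXX.
  - move=> i m j im mj jn.
    have [? ? ?] := tb _ _ im (leq_trans mj jn); have [? ? ?] := tb _ _ mj jn.
    exact: hch.
  - by move=> i _; rewrite /defect /e /=; zmodule.
have inj i j : (i <= n)%N -> (j <= n)%N -> t i = t j -> i = j.
  move=> i_n jn; case: (ltngtP i j) => // ij; last first.
    by have := tlt _ _ ij i_n; move=> + Et; rewrite Et ltxx.
  by have := tlt _ _ ij jn; move=> + Et; rewrite Et ltxx.
(* The default index 0 sends times off the grid to [y0], so that the bound on [Y t - y0], which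
   compactness uses, holds at every time. *)
pose idx x := xget 0%N [set i | (i <= n)%N /\ t i = x].
have idxE i : (i <= n)%N -> idx (t i) = i.
  move=> i_n; rewrite /idx; case: xgetP => [j _ [jn]|/(_ i) []//].
  exact: inj.
have idxn x : (idx x <= n)%N.
  by rewrite /idx; case: xgetP => [j _ []//|].
exists (e \o idx); split.
- by rewrite /= -t0 idxE.
- move=> x /=; have [_ H _] := HC _ _ _ _ _ _ ds 0%N (idx x) (leq0n _) (idxn x).
  exact: H.
move=> s t' s0 st tT' sl tl'.
have [i i_n Ei] : exists2 i, (i <= n)%N & t i = s.
  by apply: tl; rewrite mem_filter sl s0 /= andbT (le_trans (ltW st)).
have [j jn Ej] : exists2 j, (j <= n)%N & t j = t'.
  by apply: tl; rewrite mem_filter tl' tT' /= !andbT (le_trans s0 (ltW st)).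
have ij : (i < j)%N.
  by rewrite ltnNge; apply/negP => ji; have := tle _ _ ji i_n; rewrite Ei Ej leNgt st.
have [ij' j'n j'j] : [/\ (i <= j.-1)%N, (j.-1 <= n)%N & (j.-1 < j)%N].
  by clear -ij jn; split; lia.
have [H1 _ H3] := HC _ _ _ _ _ _ ds i j (ltnW ij) jn.
have -> : defect X XX F (e \o idx) s t' = defect Xn XXn F e i j.
  by rewrite /defect /= -Ei -Ej !idxE.
split; first by rewrite -Ei -Ej.
move=> c Hc; apply: le_trans (H3 ij) _; apply: ler_wpM2l => //.
rewrite /omn Ei; apply: Hc.
  by rewrite -Ei; exact: tle.
by rewrite -Ej; exact: tlt.
Qed.

Hypothesis Vcompact : forall (y0 : V) B, compact [set y | `|y - y0| <= B].

(** Each bound is a closed condition that concerns two times only, and all large finite sets contain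
    both. *)
Lemma solution_limit : exists2 C : R, 0 <= C &
  forall T om F X XX y0, 0 <= T -> rough_driver T om X XX ->
  compatible phi 0 F F -> (forall y, euler F y 0 0 = 0 :> V) ->
  (forall x A, continuous (fun y => euler F y x A)) ->
  exists Y : R -> V, Y 0 = y0 /\
      forall s t, 0 <= s -> s < t -> t <= T ->
      `|defect X XX (F : vfield) Y s t| <= C * w om s t ^+ 3 /\
      forall c, (forall u, s <= u -> u < t -> w om s u <= c) ->
        `|defect X XX F Y s t| <= C * c.
Proof.
have [C C0 HC] := finite_solution.
exists C => // T om F X XX y0 T0 rd FF F0 Fcont.
have [ys Hys] := choice (fun l => HC T om F X XX y0 T0 rd FF F0 l).
have [|G [Y [PG GS Ylim]]] := @pointwise_compactness R V _ ys (@Vcompact y0 C).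
  by move=> l t; have [_ + _] := Hys l; exact.
have dlim s t : defect X XX F (ys l) s t @[l --> G] --> defect X XX F Y s t.
  rewrite /defect; apply: cvgB; first exact: cvgB.
  exact: (cvg_comp _ _ (Ylim s) (Fcont _ _ _)).
have bound s t b : (\forall l \near G, `|defect X XX F (ys l) s t| <= b) ->
    `|defect X XX F Y s t| <= b.
  move=> H; exact: (@closed_cvg _ _ G PG _ (fun y : R => y <= b)
    (@closed_le R b) H _ (cvg_norm (dlim s t))).
exists Y; split.
  have := Ylim 0; have -> : (fun l => ys l 0) = cst y0.
    by apply/funext => l; have [] := Hys l.
  move=> H; exact: (cvg_unique (@norm_hausdorff R V) H (cvg_cst y0)).
move=> s t s0 st tT; split.
  apply: bound; have := GS [:: s; t]; apply: filterS => l H.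
  have [_ _ /(_ s t s0 st tT)] := Hys l.
  by rewrite !H ?inE ?eqxx ?orbT // => -[].
move=> c Hc; apply: bound; have := GS [:: s; t]; apply: filterS => l H.
have [_ _ /(_ s t s0 st tT)] := Hys l.
by rewrite !H ?inE ?eqxx ?orbT // => -[] // _; exact.
Qed.

End Existence.

(** * Negligible defects and sewing of paths *)

Section SmallControl.
Context {R : realType}.
Implicit Types (T : R) (om : R -> R -> R).

(** Right-continuity of the data, carried over to the control. *)
Definition right_small T om : Prop := forall s e, 0 <= s -> s < T -> 0 < e ->
  exists u, [/\ s < u, u <= T & om s u <= e].

Lemma right_smallD T om om' : control T om -> control T om' ->
  right_small T om -> right_small T om' -> right_small T (fun s t => om s t + om' s t).
Proof.
move=> c c' r r' s e s0 sT e0; have e2 : 0 < e / 2 by rewrite divr_gt0.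
have [u [su uT ue]] := r s _ s0 sT e2; have [v [sv vT ve]] := r' s _ s0 sT e2.
exists (Num.min u v); rewrite lt_min su sv ge_min uT; split => //.
have mu : Num.min u v <= u by rewrite ge_min lexx.
have mv : Num.min u v <= v by rewrite ge_min lexx orbT.
have sm : s <= Num.min u v by rewrite le_min !ltW.
have H := control_le c s0 (lexx s) sm mu uT.
have H' := control_le c' s0 (lexx s) sm mv vT.
by have := lerD (le_trans H ue) (le_trans H' ve); lra.
Qed.

(** The function [om 0 u] is non-decreasing and bounded; once it is within [e] of its supremum over
    [u < tau], superadditivity leaves at most [e] for [om u v]. *)
Lemma control_left_small T om tau e : control T om -> 0 < tau -> tau <= T -> 0 < e ->
  exists u0, [/\ 0 <= u0, u0 < tau &
    forall u v, u0 <= u -> u <= v -> v < tau -> om u v <= e].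
Proof.
move=> omc tau0 tauT e0.
pose A := [set om 0 u | u in [set u | 0 <= u < tau]].
have Aub u : 0 <= u -> u < tau -> om 0 u <= om 0 T.
  by move=> u0 ut; apply: (control_le omc) => //; rewrite (le_trans (ltW ut)).
have supA : has_sup A.
  split; first by exists (om 0 0); exists 0; rewrite //= lexx.
  by exists (om 0 T) => _ [u /andP[u0 ut] <-]; exact: Aub.
have [_ [u0 /andP[u00 u0t] <-] supu0] := sup_adherent e0 supA.
exists u0; split=> // u v u0u uv vt.
have u_ge0 := le_trans u00 u0u; have v_ge0 := le_trans u_ge0 uv.
have vT := le_trans (ltW vt) tauT.
have H1 : om 0 v <= sup A by apply: sup_upper_bound => //; exists v; rewrite //= v_ge0.
have H2 : om 0 u0 <= om 0 u.
  by apply: (control_le omc) => //; exact: le_trans vT.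
by have := omc.2 0 u v (lexx 0) u_ge0 uv vT; lra.
Qed.

(** An interval that starts before [tau] and reaches it is left out: its control need not be small
    when there is a jump at [tau]. *)
Lemma control_local_small T om tau e : control T om -> right_small T om ->
  0 <= tau <= T -> 0 < e -> exists2 r, 0 < r &
    (forall u v, tau - r < u -> 0 <= u -> u <= v -> v < tau -> om u v <= e) /\
    (forall u v, tau <= u -> u <= v -> v < tau + r -> v <= T -> om u v <= e).
Proof.
move=> omc omr /andP[tau0 tauT] e0.
have [r1 r10 H1] : exists2 r, 0 < r &
    forall u v, tau - r < u -> 0 <= u -> u <= v -> v < tau -> om u v <= e.
  move: tau0; rewrite le_eqVlt => /predU1P[<-|tau0].
    exists 1 => // u v _ u0 uv v0.
    by move: (le_lt_trans (le_trans u0 uv) v0); rewrite ltxx.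
  have [u0 [u00 u0t H]] := control_left_small omc tau0 tauT e0.
  exists (tau - u0) => [|u v]; first by rewrite subr_gt0.
  by rewrite subKr => /ltW uu _; exact: H.
have [r2 r20 H2] : exists2 r, 0 < r &
    forall u v, tau <= u -> u <= v -> v < tau + r -> v <= T -> om u v <= e.
  move: tauT; rewrite le_eqVlt => /predU1P[tT|tauT].
    exists 1 => // u v tu uv _ vT; have uT := le_trans uv vT.
    have -> : u = v by apply: le_anti; rewrite uv /= (le_trans vT) // -tT.
    rewrite (controlxx omc) ?(ltW e0) //; rewrite vT andbT.
    exact: le_trans tau0 (le_trans tu uv).
  have [u1 [tu1 u1T ue]] := omr tau e tau0 tauT e0.
  exists (u1 - tau) => [|u v tu uv]; first by rewrite subr_gt0.
  rewrite addrC subrK => /ltW vu1 _; apply: le_trans ue.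
  exact: (control_le omc).
exists (Num.min r1 r2); first by rewrite lt_min r10.
split=> [u v tu|u v tu uv vt].
  by apply: H1; apply: le_lt_trans tu; rewrite lerD2l lerN2 ge_min lexx.
by apply: H2 => //; apply: lt_le_trans vt _; rewrite lerD2l ge_min lexx orbT.
Qed.

(* From local to uniform smallness, by compactness of [0, T]. *)
Lemma uniform_small T (Q : R -> R -> Prop) :
  (forall tau, 0 <= tau <= T -> exists2 r, 0 < r &
     forall u v, 0 <= u -> u <= v -> v <= T -> tau - r < u -> v < tau + r -> Q u v) ->
  exists2 dl, 0 < dl & forall u v, 0 <= u -> u <= v -> v <= T -> v - u < dl -> Q u v.
Proof.
move=> H; have cT := (compact_near_coveringP _).1 (@segment_compact R 0 T).
have := cT R (0^'+)%R (fun dl u => forall v, 0 <= u -> u <= v -> v <= T -> v - u < dl -> Q u v) _.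
case=> [tau /= tauT|e e0 He].
  have [r r0 Hr] := H tau tauT; have r2 : 0 < r / 2 by rewrite divr_gt0.
  exists (ball tau (r / 2), [set dl | dl < r / 2]) => /=.
    split; first exact: nbhsx_ballx.
    exact: nbhs_right_lt.
  move=> [u dl] /= [bu dlr] v u0 uv vT vu.
  move: bu; rewrite /ball /= ltr_norml => /andP[b1 b2].
  apply: Hr => //; lra.
exists (e / 2); first by rewrite divr_gt0.
move=> u v u0 uv vT vu.
apply: (He (e / 2)) => //=.
- by rewrite sub0r normrN gtr0_norm ?divr_gt0 // ltr_pdivrMr // ltr_pMr // ltr1n.
- by rewrite divr_gt0.
- by rewrite in_itv /= u0 (le_trans uv).
Qed.

End SmallControl.

Lemma mesh_filter_proper {R : realType} (a b : R) : a <= b -> ProperFilter (mesh_filter a b).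
Proof.
move=> ab; apply: filter_from_proper; last first.
  by move=> e e0; have [P HP] := fine_partition_ex ab e0; exists P.
apply: filter_from_filter; first by exists 1 => /=.
move=> e e' /= e0 e0'; exists (Num.min e e'); first by rewrite /= lt_min e0.
by move=> P [iP]; rewrite lt_min => /andP[Pe Pe'].
Qed.

Section Negligible.
Context {R : realType} {V : normedModType R}.
Implicit Types (J : R -> R -> V).

(** Uniform over subintervals, so that it covers single short intervals as well as the sewing on any
    [s, t]. *)
Definition negligible T J : Prop := forall e, 0 < e -> exists2 dl, 0 < dl &
  forall s t P, 0 <= s -> t <= T -> itv_partition s t P -> mesh s t P < dl ->
  `|partition_sum s t J P| <= e.

Lemma negligible_step T J : negligible T J ->
  forall e, 0 < e -> exists2 dl, 0 < dl &
  forall s t, 0 <= s -> s < t -> t <= T -> t - s < dl -> `|J s t| <= e.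
Proof.
move=> Jn e e0; have [dl dl0 H] := Jn e e0.
exists dl => // s t s0 st tT ts; have := H s t [:: t] s0 tT (itv_partition1 st).
rewrite mesh_cons mesh_nil gt_max ts dl0 => /(_ isT).
by rewrite partition_sum_cons partition_sum_nil addr0.
Qed.

(* Saks-Henstock: refining the complement of [s, t] shows that convergence to 0
   on each [0, t] is uniform over all subintervals. *)
Lemma negligible_from0 T J : 0 <= T ->
  (forall t, 0 <= t <= T -> partition_sum 0 t J @ mesh_filter 0 t --> (0 : V)) ->
  negligible T J.
Proof.
move=> T0 H e e0; have e4 : 0 < e / 4 by rewrite divr_gt0.
have H' t : 0 <= t <= T -> exists2 dl, 0 < dl & forall P, itv_partition 0 t P ->
    mesh 0 t P < dl -> `|partition_sum 0 t J P| <= e / 4.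
  move=> /andP[t0 tT]; have mf := mesh_filter_proper t0.
  have := H t (introT andP (conj t0 tT)).
  move=> /cvgrPdist_le /(_ _ e4)[dl dl0 Hd].
  exists dl => // P iP mP; have := Hd P (conj iP mP).
  by rewrite /= sub0r normrN.
have [dl dl0 HT] := H' T (introT andP (conj T0 (lexx T))).
exists dl => // s t P s0 tT iP mP.
have st := itv_partition_le iP; have t0 := le_trans s0 st.
have [d1 d10 Hs] := H' s (introT andP (conj s0 (le_trans st tT))).
have [d2 d20 Ht] := H' t (introT andP (conj t0 tT)).
have m1 : 0 < Num.min d1 dl by rewrite lt_min d10.
have m2 : 0 < Num.min d2 dl by rewrite lt_min d20.
have [P0 [iP0]] := fine_partition_ex s0 m1; rewrite lt_min => /andP[mP0 mP0'].
have [P1 [iP1 mP1]] := fine_partition_ex tT dl0.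
have [P2 [iP2]] := fine_partition_ex t0 m2; rewrite lt_min => /andP[mP2 mP2'].
have E1 := HT _ (itv_partition_cat iP0 (itv_partition_cat iP iP1))
  (mesh_cat_lt iP0 mP0' (mesh_cat_lt iP mP mP1)).
have E2 := HT _ (itv_partition_cat iP2 iP1) (mesh_cat_lt iP2 mP2' mP1).
have E3 := Hs _ iP0 mP0; have E4 := Ht _ iP2 mP2.
move: E1 E2; rewrite (partition_sum_cat _ _ _ iP0) (partition_sum_cat _ _ _ iP).
rewrite (partition_sum_cat _ _ _ iP2).
move: (partition_sum 0 s _ _) (partition_sum s t _ _) (partition_sum t T _ _)
  (partition_sum 0 t _ _) E3 E4 => a b c d E3 E4 E1 E2.
have -> : b = (a + (b + c)) - a - ((d + c) - d) by zmodule.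
apply: le_trans (ler_normB _ _) _.
apply: le_trans (lerD (ler_normB _ _) (ler_normB _ _)) _.
lra.
Qed.

(** On a fine partition [nsewing_sum] bounds [J s t] minus its partition sum, with a constant
    independent of the partition, and negligibility removes the sum. *)
Lemma sewing_path (p S A a b T : R) om J :
  0 < p -> control T om -> 0 <= A -> 0 <= S -> 0 <= a -> b <= T ->
  2 + S * (2 * (2^-1 `^ p^-1) ^+ 3) <= S -> negligible T J ->
  (forall s, 0 <= s <= T -> J s s = 0) ->
  (forall s u t, a <= s -> s <= u -> u <= t -> t <= b ->
     `|J s t - J s u - J u t| <= A * (om s t `^ p^-1) ^+ 3) ->
  forall s t, a <= s -> s <= t -> t <= b ->
    `|J s t| <= S * A * (om s t `^ p^-1) ^+ 3.
Proof.
move=> p0 omc A0 S0 a0 bT Sp Jn J0 HJ s t as_ st tb.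
apply/ler_addgt0Pr => e e0; have [dl dl0 Hn] := Jn e e0.
have s0 := le_trans a0 as_; have tT := le_trans tb bT.
have [P [iP mP]] := fine_partition_ex st dl0.
have HP := Hn s t P s0 tT iP mP.
pose ti i := nth t (s :: P) i; pose n := size P.
have tis i : (i <= n)%N -> s <= ti i by move=> i_n; apply: itv_partition_nth_ge iP.
have tit i : (i <= n)%N -> ti i <= t by move=> i_n; apply: itv_partition_nth_le iP.
have tim i j : (i <= j)%N -> (j <= n)%N -> ti i <= ti j.
  move=> ij jn; case: (iP) => pP _; have sP : sorted <=%R (s :: P).
    by apply: sub_path pP => x y; exact: ltW.
  by apply: (sorted_leq_nth le_trans lexx t sP) => //; rewrite inE /= ltnS // (leq_trans ij).
have tin : ti n = t by exact: itv_partition_nth_size iP.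
pose Jn' i j := J (ti i) (ti j).
have omn : ncontrol n (fun i j => om (ti i) (ti j)).
  split=> [i j ij jn|i m j im mj jn].
    apply: omc.1; rewrite ?(le_trans s0 (tis _ _)) ?tim ?(le_trans (tit _ jn)) //.
    exact: leq_trans ij jn.
  have mn := leq_trans mj jn; have i_n := leq_trans im mn.
  by apply: omc.2; rewrite ?(le_trans s0 (tis _ _)) ?tim ?(le_trans (tit _ jn)).
have := @nsewing_sum R V p A S n (fun i j => om (ti i) (ti j)) Jn' p0 omn A0 S0 Sp.
rewrite /Jn' tin {1 3}/ti /= => /(_ _ _)/wrap[].
- move=> i i_n; apply: J0; rewrite (le_trans s0 (tis _ i_n)) /=.
  exact: le_trans (tit _ i_n) tT.
- move=> i m j im mj jn; have mn := leq_trans mj jn; have i_n := leq_trans im mn.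
  apply: HJ; rewrite ?tim ?(le_trans as_ (tis _ _)) //.
  exact: le_trans (tit _ jn) tb.
move=> H.
have -> : J s t = (J s t - partition_sum s t J P) + partition_sum s t J P by zmodule.
apply: le_trans (ler_normD _ _) _; apply: lerD => //.
Qed.

End Negligible.

(** * Existence of paths with negligible defect *)

Section Paths.
Context {R : realType} {E E2 V : normedModType R}.
Variable tens : E -> E -> E2.
Variables (p N K S : R) (phi : R -> R).
Hypotheses (p1 : 1 <= p) (p3 : p < 3) (N0 : 0 <= N) (K0 : 0 <= K) (S0 : 0 <= S).
Hypothesis phi0 : forall x, 0 <= x -> 0 <= phi x.
Hypothesis Sp : 2 + S * (2 * (2^-1 `^ p^-1) ^+ 3) <= S.

Local Notation vfield := (@vfield R E E2 V tens).
Local Notation rough_driver := (@rough_driver R E E2 tens p N K).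

Let p0 : 0 < p. Proof. exact: lt_le_trans ltr01 p1. Qed.

Section Driver.
Variables (T : R) (om : R -> R -> R) (X : R -> E) (XX : R -> R -> E2).
Hypotheses (rd : rough_driver T om X XX).
Variables (F : vfield) (Y : R -> V).
Hypothesis (FF : compatible phi 0 F F) (F0 : forall y, euler F y 0 0 = 0).

Let w s t := om s t `^ p^-1.

Lemma rd_w_ge0 s t : 0 <= w s t. Proof. exact: powR_ge0. Qed.

Lemma rd_w_le s s' t t' : 0 <= s' -> s' <= s -> s <= t -> t <= t' -> t' <= T ->
  w s t <= w s' t'.
Proof.
move=> s'0 s's st tt' t'T; have omc := rd_control rd.
have H := control_le omc s'0 s's st tt' t'T.
have H0 := omc.1 s t (le_trans s'0 s's) st (le_trans tt' t'T).
by apply: ge0_ler_powR; rewrite ?nnegrE ?invr_ge0 ?(ltW p0) // (le_trans H0).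
Qed.

Lemma rd_w_bound s t : 0 <= s -> s <= t -> t <= T -> w s t <= 1 + K.
Proof.
move=> s0 st tT; have omc := rd_control rd; apply: (root_le p1); first exact: omc.1.
by apply: le_trans (rd_total rd); apply: (control_le omc).
Qed.

Lemma rd_wxx s : 0 <= s <= T -> w s s = 0.
Proof.
by move=> sT; rewrite /w (controlxx (rd_control rd)) // powR0 // invr_eq0 gt_eqF.
Qed.

Lemma rd_XXxx s : 0 <= s <= T -> XX s s = 0.
Proof.
move=> /andP[s0 sT]; apply/eqP; rewrite -normr_le0.
have := rd_XX rd s0 (lexx s) sT; rewrite -/(w s s) rd_wxx ?s0 //.
by rewrite expr0n mulr0.
Qed.

Lemma rd_defectxx s : 0 <= s <= T -> defect X XX F Y s s = 0.
Proof. by move=> sT; rewrite /defect !subrr rd_XXxx // F0 subrr. Qed.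

Lemma rd_euler_size y s t : 0 <= s -> s <= t -> t <= T ->
  `|euler F y (X t - X s) (XX s t)| <= phi N * (1 + (1 + K)) * w s t.
Proof.
move=> s0 st tT; apply: (euler_size _ FF N0).
- by rewrite rd_w_ge0 rd_w_bound.
- exact: (rd_X rd).
- exact: (rd_XX rd).
Qed.

(** The product of the two roots is kept, so that the bound is small as soon as one of the intervals
    has small control. *)
Lemma rd_delta N1 N2 s u t : N <= N1 -> N1 + phi N1 + (phi N1 + N1) * (1 + K) <= N2 ->
  0 <= s -> s <= u -> u <= t -> t <= T ->
  `|defect X XX F Y s u| <= N1 * w s u ^+ 2 ->
  `|defect X XX F Y s t - defect X XX F Y s u - defect X XX F Y u t| <=
    phi N2 * (w s u * w u t * (w s u + w u t)).
Proof.
move=> NN1 NN2 s0 su ut tT hJ; have uT := le_trans ut tT; have u0 := le_trans s0 su.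
rewrite (defect_delta F Y (rd_chen rd s0 su ut tT)).
have N10 := le_trans N0 NN1; have phi1 := phi0 N10.
have K1 : 0 <= 1 + K by rewrite addr_ge0.
have P1 : 0 <= (phi N1 + N1) * (1 + K) by rewrite mulr_ge0 // addr_ge0.
have w0 := rd_w_ge0 s u; have NN : N <= N2 by lra.
have [r1 r2] : `|Y u - Y s - f1 F (Y s) (X u - X s)| <= (phi N1 + N1) * w s u ^+ 2 /\
  `|Y u - Y s| <= (phi N1 + (phi N1 + N1) * (1 + K)) * w s u.
  apply: (@defect_size _ _ _ _ _ phi F N1 (1 + K) (w s u) _ _ _ (XX s u)) => //.
  - by rewrite w0 rd_w_bound.
  - by apply: le_trans (rd_X rd s0 su uT) _; rewrite ler_wpM2r ?rd_w_ge0.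
  - by apply: le_trans (rd_XX rd s0 su uT) _; rewrite ler_wpM2r ?exprn_ge0 ?rd_w_ge0.
have N20 : 0 <= N2 by lra.
apply: fd_size => //; rewrite ?rd_w_ge0 //.
- by apply: le_trans r2 _; rewrite ler_wpM2r //; lra.
- by apply: le_trans r1 _; rewrite ler_wpM2r ?exprn_ge0 //; lra.
- by apply: le_trans (rd_X rd u0 ut tT) _; rewrite ler_wpM2r ?rd_w_ge0.
- by apply: le_trans (rd_XX rd u0 ut tT) _; rewrite ler_wpM2r ?exprn_ge0 ?rd_w_ge0.
Qed.

End Driver.

Hypothesis Vcompact : forall (y0 : V) B, compact [set y | `|y - y0| <= B].

Section SmallDefect.
Variables (C T : R) (om : R -> R -> R) (X : R -> E) (XX : R -> R -> E2).
Hypotheses (C0 : 0 <= C) (rd : rough_driver T om X XX).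
Hypothesis (omr : right_small T om).
Variables (F : vfield) (Y : R -> V).
Hypothesis (FF : compatible phi 0 F F) (F0 : forall y, euler F y 0 0 = 0).
Hypothesis J3 : forall s t, 0 <= s -> s < t -> t <= T ->
  `|defect X XX F Y s t| <= C * (om s t `^ p^-1) ^+ 3.
Hypothesis Jl : forall s t c, 0 <= s -> s < t -> t <= T ->
  (forall u, s <= u -> u < t -> om s u `^ p^-1 <= c) -> `|defect X XX F Y s t| <= C * c.

Let w s t := om s t `^ p^-1.
Let J := defect X XX F Y.

Lemma defect_le3 s t : 0 <= s -> s <= t -> t <= T -> `|J s t| <= C * w s t ^+ 3.
Proof.
move=> s0; rewrite le_eqVlt => /predU1P[<-|st] tT; last exact: J3.
by rewrite /J (rd_defectxx rd) ?s0 // normr0 mulr_ge0 ?exprn_ge0 ?powR_ge0.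
Qed.

(** Near a point [tau], intervals on one side have small control. An interval across [tau] is split
    there: the left part is small by [Jl], which ignores a jump at [tau], the right part by
    right-continuity, and the defect of additivity through its factor [w tau v]. *)
Lemma defect_uniform_small (e : R) : 0 < e -> exists2 dl, 0 < dl &
  forall u v, 0 <= u -> u <= v -> v <= T -> v - u < dl -> `|J u v| <= e.
Proof.
move=> e0; have K1 : 0 <= 1 + K by rewrite addr_ge0.
pose N1 := C * (1 + K) + N.
pose N2 := N1 + phi N1 + (phi N1 + N1) * (1 + K).
have N10 : 0 <= N1 by nonneg_with phi0.
have N20 : 0 <= N2 by nonneg_with phi0.
pose D1 := C * (1 + K) ^+ 2; pose D2 := phi N2 * ((1 + K) * ((1 + K) + (1 + K))).
have D10 : 0 <= D1 by nonneg_with phi0.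
have D20 : 0 <= D2 by nonneg_with phi0.
have D0 : 0 < C + D1 + D2 + 1 by rewrite ltr_wpDl // !addr_ge0.
pose th := e / (C + D1 + D2 + 1).
have th0 : 0 < th by rewrite divr_gt0.
have wth s t : 0 <= s -> s <= t -> t <= T -> om s t <= th `^ p -> w s t <= th.
  move=> s0 st tT H; have : (th `^ p) `^ p^-1 = th.
    by rewrite -powRrM mulfV ?gt_eqF // powRr1 // ltW.
  move=> <-; apply: ge0_ler_powR; rewrite ?nnegrE ?invr_ge0 ?(ltW p0) ?powR_ge0 //.
  exact: (rd_control rd).1.
have Jth s t : 0 <= s -> s <= t -> t <= T -> w s t <= th -> `|J s t| <= D1 * th.
  move=> s0 st tT H; apply: le_trans (defect_le3 s0 st tT) _.
  have wK := rd_w_bound rd s0 st tT; have w0 := powR_ge0 (om s t) p^-1.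
  rewrite exprSr mulrA; apply: ler_pM => //; first by nonneg_with phi0.
  by rewrite ler_wpM2l // lerXn2r ?nnegrE.
have eth : (C + D1 + D2 + 1) * th = e by rewrite mulrC divfK // gt_eqF.
apply: uniform_small => tau tauT.
have [r r0 [Hl Hr]] := control_local_small (rd_control rd) omr tauT (powR_gt0 p th0).
exists r => // u v u0 uv vT tu vt.
have [tau0 tauT'] := andP tauT.
have D1e : D1 * th <= e by rewrite -eth ler_wpM2r ?(ltW th0) //; have := C0; lra.
have [vtau|tauv] := ltP v tau.
  by apply: le_trans D1e; apply: Jth => //; apply: wth => //; exact: Hl.
have [tauu|utau] := leP tau u.
  by apply: le_trans D1e; apply: Jth => //; apply: wth => //; exact: Hr.
have utau' := ltW utau.
have w2 : w tau v <= th by apply: wth => //; exact: Hr.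
have A1 : `|J u tau| <= C * th.
  apply: Jl => // u' uu' u'tau; apply: wth => //.
    exact: le_trans (ltW u'tau) tauT'.
  exact: Hl.
have A2 : `|J tau v| <= D1 * th by exact: Jth.
have A3 : `|J u v - J u tau - J tau v| <= D2 * th.
  have NN1 : N <= N1 by rewrite lerDr mulr_ge0.
  apply: le_trans (rd_delta rd FF NN1 (lexx N2) u0 utau' tauv vT _) _.
    apply: le_trans (defect_le3 u0 utau' tauT') _.
    have wK := rd_w_bound rd u0 utau' tauT'; have w0 := powR_ge0 (om u tau) p^-1.
    rewrite exprS mulrA ler_wpM2r ?exprn_ge0 //.
    by apply: (@le_trans _ _ (C * (1 + K))); [rewrite ler_wpM2l|rewrite lerDl].
  have wK1 := rd_w_bound rd u0 utau' tauT'; have w01 := powR_ge0 (om u tau) p^-1.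
  have wK2 := rd_w_bound rd tau0 tauv vT; have w02 := powR_ge0 (om tau v) p^-1.
  rewrite -/D2 -[leRHS]mulrA; apply: ler_wpM2l; first exact: phi0.
  rewrite mulrAC; apply: ler_pM => //; first by nonneg_with phi0.
  by apply: ler_pM => //; [nonneg_with phi0|exact: lerD].
have -> : J u v = (J u v - J u tau - J tau v) + (J u tau + J tau v) by zmodule.
apply: le_trans (ler_normD _ _) _; apply: le_trans (lerD A3 (ler_normD _ _)) _.
rewrite -eth; have := C0; lra.
Qed.

(** Where [w <= th], the cubic bound is at most a small multiple of the control, because w^3 =
    w^(3-p) om. Where [w > th], the control is at least the p-th power of [th], and the uniformly
    small defect is again a small multiple of it. Superadditivity sums both kinds. *)
Lemma defect_negligible : negligible T J.
Proof.
move=> e e0.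
have q0 : 0 < 3 - p.
  by have h := p3; lra.
(* [D] and [e2] are chosen such that each kind of interval contributes at most [e / 2]. *)
pose D := 2 * (C * K + 1).
have D0 : 0 < D by rewrite mulr_gt0 // ltr_wpDl // mulr_ge0.
pose th := (e / D) `^ (3 - p)^-1.
have th0 : 0 < th by rewrite powR_gt0 // divr_gt0.
have thE : th `^ (3 - p) = e / D.
  by rewrite /th -powRrM mulVf ?gt_eqF // powRr1 // ltW // divr_gt0.
have thp : 0 < th `^ p by rewrite powR_gt0.
pose e2 := e * th `^ p / (2 * (K + 1)).
have K1 : 0 < K + 1 by rewrite ltr_wpDl.
have e20 : 0 < e2 by rewrite divr_gt0 ?mulr_gt0.
have [dl dl0 H] := defect_uniform_small e20.
exists dl => // s t P s0 tT iP mP.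
pose c := C * (e / D) + e2 / th `^ p.
have c0 : 0 <= c by nonneg_with phi0.
have st := itv_partition_le iP.
apply: le_trans (norm_partition_sum_mesh (g := fun u v => c * om u v) iP mP _) _.
  move=> u v su uv vt uvd; have u0 := le_trans s0 su; have vT := le_trans vt tT.
  have om0 := (rd_control rd).1 u v u0 (ltW uv) vT.
  have [small|big] := leP (w u v) th.
    apply: le_trans (defect_le3 u0 (ltW uv) vT) _.
    have -> : w u v ^+ 3 = w u v `^ (3 - p) * om u v.
      have wp : w u v `^ p = om u v by rewrite /w -powRrM mulVf ?gt_eqF // powRr1.
      rewrite -wp -powRD ?subrK ?powR_mulrn ?powR_ge0 //.
      by rewrite pnatr_eq0.
    rewrite mulrA ler_wpM2r //; apply: (@le_trans _ _ (C * (e / D))).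
      rewrite ler_wpM2l // -thE; apply: ge0_ler_powR; rewrite ?nnegrE ?powR_ge0 ?(ltW q0) ?(ltW th0) //.
    by rewrite lerDl mulr_ge0 ?invr_ge0 ?ltW.
  apply: le_trans (H _ _ u0 (ltW uv) vT uvd) _.
  have H2 : th `^ p <= om u v.
    have <- : w u v `^ p = om u v by rewrite /w -powRrM mulVf ?gt_eqF // powRr1.
    by apply: ge0_ler_powR; rewrite ?nnegrE ?powR_ge0 ?(ltW p0) ?(ltW th0) // ltW.
  apply: (@le_trans _ _ (e2 / th `^ p * om u v)).
    by rewrite mulrAC ler_pdivlMr // ler_wpM2l // ltW.
  by rewrite ler_wpM2r // lerDr mulr_ge0 // divr_ge0 // ltW.
have Hs : partition_sum s t (om : R -> R -> R^o) P <= K.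
  apply: le_trans (partition_sum_control (rd_control rd) s0 tT iP) _.
  by apply: le_trans (rd_total rd); apply: (control_le (rd_control rd)).
rewrite /partition_sum -mulr_sumr; apply: le_trans (ler_wpM2l c0 Hs) _.
have -> : e = e / 2 + e / 2 by rewrite -splitr.
rewrite mulrDl; apply: lerD.
  have -> : C * (e / D) * K = C * K * e / D by rewrite mulrA mulrAC [C * e * K]mulrAC.
  rewrite ler_pdivrMr //; have -> : e / 2 * D = C * K * e + e by rewrite /D; field.
  by rewrite lerDl ltW.
have -> : e2 / th `^ p * K = e * K / (2 * (K + 1)).
  by rewrite /e2 mulrAC [X in X / _](_ : _ = e * K / (2 * (K + 1)) * th `^ p) ?mulfK ?gt_eqF //; ring.
rewrite ler_pdivrMr ?mulr_gt0 //; have -> : e / 2 * (2 * (K + 1)) = e * K + e by field.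
by rewrite lerDl ltW.
Qed.

End SmallDefect.

Lemma existence : exists2 C : R, 0 <= C &
  forall T om F X XX y0, 0 <= T -> rough_driver T om X XX -> right_small T om ->
  compatible phi 0 F F -> (forall y, euler F y 0 0 = 0 :> V) ->
  (forall x A, continuous (fun y => euler F y x A)) ->
  exists Y : R -> V, [/\ Y 0 = y0, negligible T (defect X XX (F : vfield) Y) &
      forall s t, 0 <= s -> s <= t -> t <= T ->
      `|defect X XX F Y s t| <= C * (om s t `^ p^-1) ^+ 3 /\
      `|Y t - Y s| <= C * om s t `^ p^-1].
Proof.
have [C C0 HC] := solution_limit tens p1 N0 K0 S0 phi0 Sp Vcompact.
have K1 : 0 <= 1 + K by rewrite addr_ge0.
pose C1 := phi N * (1 + (1 + K)) + C * (1 + K) ^+ 2.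
have C10 : 0 <= C1 by nonneg_with phi0.
exists (C + C1); first by nonneg_with phi0.
move=> T om F X XX y0 T0 rd omr FF F0 Fc.
have [Y [Y0 HY]] := HC T om F X XX y0 T0 rd FF F0 Fc.
have J3 s t : 0 <= s -> s < t -> t <= T -> `|defect X XX F Y s t| <= C * (om s t `^ p^-1) ^+ 3.
  by move=> s0 st tT; have [] := HY s t s0 st tT.
have Jl s t c : 0 <= s -> s < t -> t <= T ->
    (forall u, s <= u -> u < t -> om s u `^ p^-1 <= c) -> `|defect X XX F Y s t| <= C * c.
  by move=> s0 st tT; have [_] := HY s t s0 st tT; apply.
exists Y; split=> //.
  exact: (defect_negligible C0 rd omr FF F0 J3 Jl).
move=> s t s0 st tT.
have w0 := powR_ge0 (om s t) p^-1; have wK := rd_w_bound rd s0 st tT.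
have H := defect_le3 C0 rd F0 J3 s0 st tT.
split; first by apply: le_trans H _; rewrite ler_wpM2r ?exprn_ge0 // lerDl.
have -> : Y t - Y s = euler F (Y s) (X t - X s) (XX s t) + defect X XX F Y s t.
  by rewrite /defect; zmodule.
apply: le_trans (ler_normD _ _) _.
apply: le_trans (lerD (rd_euler_size rd FF _ s0 st tT) H) _.
apply: (@le_trans _ _ (C1 * om s t `^ p^-1)).
  rewrite [leRHS]mulrDl lerD2l exprSr mulrA ler_wpM2r // ler_wpM2l //.
  by rewrite lerXn2r ?nnegrE.
by rewrite ler_wpM2r // lerDr.
Qed.

End Paths.

Lemma mesh_step {R : realType} (a b : R) (P : seq R) i : (i < size P)%N ->
  nth b (a :: P) i.+1 - nth b (a :: P) i <= mesh a b P.
Proof.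
elim: P a i => // x P IH a [|i] iP; rewrite mesh_cons le_max ?lexx //.
by rewrite (IH x i) ?orbT.
Qed.

Lemma partition_points {R : realType} (s t dl : R) (P : seq R) :
  itv_partition s t P -> mesh s t P < dl ->
  exists n (ti : nat -> R), [/\ ti 0%N = s, ti n = t,
    forall i, (i <= n)%N -> s <= ti i <= t,
    forall i j, (i <= j)%N -> (j <= n)%N -> ti i <= ti j &
    forall i, (i < n)%N -> ti i < ti i.+1 /\ ti i.+1 - ti i < dl].
Proof.
move=> iP mP; exists (size P), (fun i => nth t (s :: P) i).
have [pP _] := iP.
split=> //.
- exact: itv_partition_nth_size iP.
- move=> i i_n; apply/andP; split; first exact: itv_partition_nth_ge iP.
  exact: itv_partition_nth_le iP.
- move=> i j ij jn.
  have sP : sorted <=%R (s :: P) by apply: sub_path pP => x y; exact: ltW.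
  by apply: (sorted_leq_nth le_trans lexx t sP) => //; rewrite inE /= ltnS // (leq_trans ij).
- move=> i i_n; split; last exact: le_lt_trans (mesh_step _ _ i_n) mP.
  by move/(pathP t): pP => /(_ i i_n).
Qed.

(** * Stability *)

Section Stability.
Context {R : realType} {E E2 V : normedModType R}.
Variable tens : E -> E -> E2.
Variables (N K S : R) (phi : R -> R).
Hypotheses (N0 : 0 <= N) (K0 : 0 <= K) (S0 : 0 <= S).
Hypothesis phi0 : forall x, 0 <= x -> 0 <= phi x.

Local Notation vfield := (@vfield R E E2 V tens).

(** [ep] is positive because the self-improvement of the errors ends with a slack [ep]. [sp_FG]
    covers every [e >= ep] because it is applied with errors that are still to be estimated. *)
Record stable_pair (p ep T : R) (om : R -> R -> R) (F G : vfield)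
    (X X' : R -> E) (XX XX' : R -> R -> E2) (Y Y' : R -> V) : Prop := StablePair {
  sp_p1 : 1 <= p;
  sp_p3 : p <= 3;
  sp_S : 2 + S * (2 * (2^-1 `^ p^-1) ^+ 3) <= S;
  sp_ep : 0 < ep;
  sp_rd : rough_driver tens p N K T om X XX;
  sp_rd' : rough_driver tens p N K T om X' XX';
  sp_dX : forall s t, 0 <= s -> s <= t -> t <= T ->
    close N ep (om s t `^ p^-1) (X t - X s) (X' t - X' s);
  sp_dXX : forall s t, 0 <= s -> s <= t -> t <= T ->
    close N ep ((om s t `^ p^-1) ^+ 2) (XX s t) (XX' s t);
  sp_FF : compatible phi 0 F F;
  sp_GG : compatible phi 0 G G;
  sp_FG : forall e, ep <= e -> compatible phi e F G;
  sp_F0 : forall y, euler F y 0 0 = 0;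
  sp_G0 : forall y, euler G y 0 0 = 0;
  sp_r : forall s t, 0 <= s -> s <= t -> t <= T ->
    `|Y t - Y s - f1 F (Y s) (X t - X s)| <= N * (om s t `^ p^-1) ^+ 2;
  sp_r' : forall s t, 0 <= s -> s <= t -> t <= T ->
    `|Y' t - Y' s - f1 G (Y' s) (X' t - X' s)| <= N * (om s t `^ p^-1) ^+ 2;
  sp_J : negligible T (defect X XX F Y);
  sp_J' : negligible T (defect X' XX' G Y') }.

Let W := 1 + K.
Let N2 := N + phi N + N * W.
Let A1 := S * (phi N2 * 2).

Let W0 : 0 <= W. Proof. exact: addr_ge0. Qed.
Let N20 : 0 <= N2. Proof. nonneg_with phi0. Qed.
Let A10 : 0 <= A1. Proof. nonneg_with phi0. Qed.

(** The given bound on the second-order remainder takes the place of the smallness used for the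
    scheme, so sewing applies on all of [0, T] at once. *)
Lemma solution_apriori p T om (F : vfield) X XX Y :
  1 <= p -> 2 + S * (2 * (2^-1 `^ p^-1) ^+ 3) <= S ->
  rough_driver tens p N K T om X XX -> compatible phi 0 F F ->
  (forall y, euler F y 0 0 = 0) ->
  (forall s t, 0 <= s -> s <= t -> t <= T ->
    `|Y t - Y s - f1 F (Y s) (X t - X s)| <= N * (om s t `^ p^-1) ^+ 2) ->
  negligible T (defect X XX F Y) ->
  forall s t, 0 <= s -> s <= t -> t <= T ->
  `|defect X XX F Y s t| <= A1 * (om s t `^ p^-1) ^+ 3 /\
  `|Y t - Y s| <= N2 * om s t `^ p^-1.
Proof.
move=> p1 Sp rd FF F0 hr Jn.
pose w s t := om s t `^ p^-1.
have w0 s t : 0 <= w s t := powR_ge0 _ _.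
have inc s t : 0 <= s -> s <= t -> t <= T -> `|Y t - Y s| <= N2 * w s t.
  move=> s0 st tT; have wW := rd_w_bound p1 rd s0 st tT.
  have [_ c1 _ _] := FF N N0.
  have yy : `|Y s - Y s| <= 0 by rewrite subrr normr0.
  have H1 := closexx (c1 _ _ _ _ _ (w0 s t) yy (close_refl (rd_X rd s0 st tT))).
  have -> : Y t - Y s = f1 F (Y s) (X t - X s) + (Y t - Y s - f1 F (Y s) (X t - X s)).
    by zmodule.
  apply: le_trans (ler_normD _ _) _; apply: le_trans (lerD H1 (hr _ _ s0 st tT)) _.
  apply: (@le_trans _ _ (phi N * w s t + N * W * w s t)).
    rewrite lerD2l -/(w s t) expr2 mulrA; apply: ler_wpM2r; first exact: w0.
    exact: ler_wpM2l.
  by rewrite -mulrDl ler_wpM2r // /N2 -addrA lerDr.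
move=> s t s0 st tT; split; last exact: inc.
have p0 : 0 < p by exact: lt_le_trans p1.
have A0 : 0 <= phi N2 * 2 by nonneg_with phi0.
have Jxx u : 0 <= u <= T -> defect X XX F Y u u = 0.
  by move=> uT; exact: (rd_defectxx p1 rd).
apply: (sewing_path p0 (rd_control rd) A0 S0 (lexx 0) (lexx T) Sp Jn Jxx _ s0 st tT).
move=> s' u t' s'0 s'u ut' t'T.
have u0 := le_trans s'0 s'u; have uT := le_trans ut' t'T; have s't' := le_trans s'u ut'.
have wa : w s' u <= w s' t' by exact: (rd_w_le p1 rd).
have wb : w u t' <= w s' t' by exact: (rd_w_le p1 rd).
rewrite (defect_delta F Y (rd_chen rd s'0 s'u ut' t'T)).
have NN2 : N <= N2 by rewrite /N2 -addrA lerDl addr_ge0 ?mulr_ge0 ?phi0.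
apply: le_trans (fd_size (v := w s' u) (u := w u t') FF N20 _ _ _ _ _ _) _ => //.
- exact: inc.
- by apply: le_trans (hr _ _ s'0 s'u uT) _; rewrite ler_wpM2r ?exprn_ge0 ?powR_ge0.
- by apply: le_trans (rd_X rd u0 ut' t'T) _; rewrite ler_wpM2r ?powR_ge0.
- by apply: le_trans (rd_XX rd u0 ut' t'T) _; rewrite ler_wpM2r ?exprn_ge0 ?powR_ge0.
rewrite -[leRHS]mulrA ler_wpM2l ?phi0 // -/(w s' t').
have -> : 2 * w s' t' ^+ 3 = w s' t' * w s' t' * (w s' t' + w s' t') by ring.
by apply: ler_pM; rewrite ?mulr_ge0 ?addr_ge0 //; [apply: ler_pM|apply: lerD].
Qed.

(** [NJ] collects the bounds on the drivers and the second-order bounds on the defects, [Ni] bounds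
    increments, [D] is the third-order factor for a difference of defects. Where [B * w <= 1], also
    [D * w <= 1], which turns the third-order bound into a second-order one free of [D]; so [NJ] and
    [A2] can be fixed before [D]. The [2] in [D] and the [4] in [B] produce the halving of the
    error. *)
Let NJ := 1 + N + A1 * W.
Let Ni := phi NJ + (phi NJ + NJ) * W.
Let N3 := NJ + phi NJ + Ni.
Let A2 := phi N3 * 4.
Let D := 2 * (S * A2) + 1.
Let B := 1 + D + 4 * Ni.

Let NJ0 : 0 <= NJ. Proof. nonneg_with phi0. Qed.
Let Ni0 : 0 <= Ni. Proof. nonneg_with phi0. Qed.
Let N30 : 0 <= N3. Proof. nonneg_with phi0. Qed.
Let A20 : 0 <= A2. Proof. nonneg_with phi0. Qed.
Let D1 : 1 <= D. Proof. by rewrite lerDr; nonneg_with phi0. Qed.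
Let D0 : 0 <= D. Proof. exact: le_trans D1. Qed.
Let B1 : 1 <= B. Proof. by rewrite /B -addrA lerDl; nonneg_with phi0. Qed.

Section Pair.
Variables (p ep T : R) (om : R -> R -> R) (F G : vfield).
Variables (X X' : R -> E) (XX XX' : R -> R -> E2) (Y Y' : R -> V).
Hypothesis sp : stable_pair p ep T om F G X X' XX XX' Y Y'.

Let w s t := om s t `^ p^-1.
Let J s t := defect X XX F Y s t.
Let J' s t := defect X' XX' G Y' s t.
Let w0 s t : 0 <= w s t. Proof. exact: powR_ge0. Qed.
Let wW s t : 0 <= s -> s <= t -> t <= T -> w s t <= W.
Proof. exact: (rd_w_bound (sp_p1 sp) (sp_rd sp)). Qed.

Lemma pair_apriori s t : 0 <= s -> s <= t -> t <= T ->
  [/\ `|J s t| <= A1 * w s t ^+ 3, `|J' s t| <= A1 * w s t ^+ 3,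
      `|Y t - Y s| <= N2 * w s t & `|Y' t - Y' s| <= N2 * w s t].
Proof.
move=> s0 st tT.
have [a b] := solution_apriori (sp_p1 sp) (sp_S sp) (sp_rd sp) (sp_FF sp) (sp_F0 sp)
  (sp_r sp) (sp_J sp) s0 st tT.
have [a' b'] := solution_apriori (sp_p1 sp) (sp_S sp) (sp_rd' sp) (sp_GG sp) (sp_G0 sp)
  (sp_r' sp) (sp_J' sp) s0 st tT.
by split.
Qed.

Let driver_close e s t : ep <= e -> 0 <= s -> s <= t -> t <= T ->
  close NJ e (w s t) (X t - X s) (X' t - X' s) /\
  close NJ e (w s t ^+ 2) (XX s t) (XX' s t).
Proof.
move=> epe s0 st tT; have ep0 := ltW (sp_ep sp).
have NN : N <= NJ by rewrite /NJ addrAC lerDr; nonneg_with phi0.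
split.
  by apply: closeW (sp_dX sp s0 st tT); rewrite ?ler_wpM2r // w0.
by apply: closeW (sp_dXX sp s0 st tT); rewrite ?ler_wpM2r ?exprn_ge0 ?powR_ge0.
Qed.

(* An error [e] at time [s] in the position and of relative size [e] in the
   defect is passed on to the increment over [s, t]. *)
Lemma increment_close e s t : ep <= e -> 0 <= s -> s <= t -> t <= T ->
  `|Y s - Y' s| <= e -> `|J s t - J' s t| <= NJ * e * w s t ^+ 2 ->
  close (phi NJ + NJ) e (w s t ^+ 2) (Y t - Y s - f1 F (Y s) (X t - X s))
     (Y' t - Y' s - f1 G (Y' s) (X' t - X' s)) /\
  close Ni e (w s t) (Y t - Y s) (Y' t - Y' s).
Proof.
move=> epe s0 st tT yz hJ; have e0 := le_trans (ltW (sp_ep sp)) epe.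
have [cX cXX] := driver_close epe s0 st tT.
have w01 : 0 <= w s t <= W by rewrite w0 wW.
have [j1 j2 _ _] := pair_apriori s0 st tT.
have AW : A1 * w s t ^+ 3 <= NJ * w s t ^+ 2.
  rewrite exprS mulrA ler_wpM2r ?exprn_ge0 //.
  by apply: (@le_trans _ _ (A1 * W)); [rewrite ler_wpM2l ?wW|rewrite lerDr addr_ge0].
have [] // := defect_close (sp_FG sp epe) NJ0 e0 w01 yz cX cXX (_ : close NJ e (w s t ^+ 2)
  (Y t - Y s - euler F (Y s) (X t - X s) (XX s t)) (Y' t - Y' s - euler G (Y' s) (X' t - X' s) (XX' s t))).
by split; [exact: le_trans j1 AW|exact: le_trans j2 AW|].
Qed.

Lemma euler_close e s t : ep <= e -> 0 <= s -> s <= t -> t <= T ->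
  `|Y s - Y' s| <= e ->
  `|euler F (Y s) (X t - X s) (XX s t) - euler G (Y' s) (X' t - X' s) (XX' s t)|
    <= phi NJ * (W + W ^+ 2) * e.
Proof.
move=> epe s0 st tT yz; have e0 := le_trans (ltW (sp_ep sp)) epe.
have [cX cXX] := driver_close epe s0 st tT.
have [phiN c1 c2 _] := sp_FG sp epe NJ0.
have ww : 0 <= w s t ^+ 2 by rewrite exprn_ge0.
have [_ _ h1] := c1 _ _ _ _ _ (w0 s t) yz cX.
have [_ _ h2] := c2 _ _ _ _ _ ww yz cXX.
rewrite /euler opprD addrACA; apply: le_trans (ler_normD _ _) _.
apply: le_trans (lerD h1 h2) _.
rewrite -mulrDr mulrAC ler_wpM2r // ler_wpM2l // lerD ?wW //.
by rewrite lerXn2r ?nnegrE ?wW.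
Qed.

Lemma delta_close e s u t : ep <= e -> 0 <= s -> s <= u -> u <= t -> t <= T ->
  `|Y s - Y' s| <= e -> `|Y u - Y' u| <= e ->
  `|J s u - J' s u| <= NJ * e * w s u ^+ 2 ->
  `|(J s t - J' s t) - (J s u - J' s u) - (J u t - J' u t)| <=
    phi N3 * 2 * e * w s t ^+ 3.
Proof.
move=> epe s0 su ut tT ys yu hJ; have e0 := le_trans (ltW (sp_ep sp)) epe.
have uT := le_trans ut tT; have u0 := le_trans s0 su; have st := le_trans su ut.
have [r1 r2] := increment_close epe s0 su uT ys hJ.
have [cX cXX] := driver_close epe u0 ut tT.
have -> : (J s t - J' s t) - (J s u - J' s u) - (J u t - J' u t) =
  (J s t - J s u - J u t) - (J' s t - J' s u - J' u t) by zmodule.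
rewrite /J /J' (defect_delta F Y (rd_chen (sp_rd sp) s0 su ut tT)).
rewrite (defect_delta G Y' (rd_chen (sp_rd' sp) s0 su ut tT)).
have [phiN _ _ cd] := sp_FG sp epe N30.
have e1 : NJ <= N3 by rewrite /N3 -addrA lerDl addr_ge0 ?phi0.
have e2 : phi NJ + NJ <= N3 by rewrite /N3 [NJ + _]addrC lerDl.
have e3 : Ni <= N3 by rewrite lerDr addr_ge0 ?phi0.
have cW M v (U : normedModType R) (a b : U) : 0 <= M -> M <= N3 -> 0 <= v ->
    close M e v a b -> close N3 e v a b.
  by move=> M0 MN v0; apply: closeW => //; rewrite ler_wpM2r.
have [_ _ H] := cd _ _ _ _ _ _ _ _ _ _ _ _ (w0 s u) (w0 u t) ys yu
  (cW _ _ _ _ _ Ni0 e3 (w0 s u) r2)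
  (cW _ _ _ _ _ (addr_ge0 (phi0 NJ0) NJ0) e2 (exprn_ge0 2 (w0 s u)) r1)
  (cW _ _ _ _ _ NJ0 e1 (w0 u t) cX) (cW _ _ _ _ _ NJ0 e1 (exprn_ge0 2 (w0 u t)) cXX).
apply: le_trans H _.
have wa : w s u <= w s t by exact: (rd_w_le (sp_p1 sp) (sp_rd sp)).
have wb : w u t <= w s t by exact: (rd_w_le (sp_p1 sp) (sp_rd sp)).
have -> : phi N3 * 2 * e * w s t ^+ 3 = phi N3 * e * (w s t * w s t * (w s t + w s t)) by ring.
rewrite ler_wpM2l ?mulr_ge0 //.
by apply: ler_pM; rewrite ?mulr_ge0 ?addr_ge0 //; [apply: ler_pM|apply: lerD].
Qed.

(** [Q x] bounds all differences on [a, b] in terms of [x]. The a priori bounds give it for a crude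
    [z0], the two equations improve [x] to [c + x / 2], and [halving] ends at [2 * c + ep]. *)
Lemma chunk_stability a b : 0 <= a -> a <= b -> b <= T -> B * w a b <= 1 ->
  (forall t, a <= t -> t <= b -> `|Y t - Y' t| <= 2 * (`|Y a - Y' a| + ep) + ep) /\
  (forall s t, a <= s -> s <= t -> t <= b ->
    `|J s t - J' s t| <= D * (2 * (`|Y a - Y' a| + ep) + ep) * w s t ^+ 3).
Proof.
move=> a0 ab bT Bw; have ep0 := sp_ep sp; have omc := rd_control (sp_rd sp).
have wab s t : a <= s -> s <= t -> t <= b -> w s t <= w a b.
  by move=> as_ st tb; exact: (rd_w_le (sp_p1 sp) (sp_rd sp)).
have Bw' M : 0 <= M -> M <= B -> M * w a b <= 1.
  by move=> M0 MB; apply: le_trans Bw; rewrite ler_wpM2r.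
have Dw s t : a <= s -> s <= t -> t <= b -> D * w s t <= 1.
  move=> as_ st tb; apply: le_trans (Bw' D D0 _); first by rewrite ler_wpM2l ?wab.
  by rewrite /B -addrA addrCA lerDl addr_ge0 ?mulr_ge0.
pose Q x := [/\ ep <= x, forall t, a <= t -> t <= b -> `|Y t - Y' t| <= x &
  forall s t, a <= s -> s <= t -> t <= b -> `|J s t - J' s t| <= D * x * w s t ^+ 3].
pose c := `|Y a - Y' a| + ep.
suff : Q (2 * c + ep) by case.
pose z0 := ep + (`|Y a - Y' a| + 2 * N2 * W) + 2 * A1.
have c0 : 0 <= `|Y a - Y' a| + 2 * N2 * W by nonneg_with phi0.
apply: (halving (z0 := z0) ep0).
- move=> z z' zz' [q1 q2 q3]; split=> [|t ta tb|s t sa st tb].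
  + exact: le_trans zz'.
  + exact: le_trans (q2 t ta tb) _.
  + by apply: le_trans (q3 s t sa st tb) _; rewrite ler_wpM2r ?exprn_ge0 // ler_wpM2l.
- split=> [|t ta tb|s t sa st tb].
  + by rewrite /z0 -addrA lerDl addr_ge0 // mulr_ge0.
  + have [_ _ h1 h2] := pair_apriori a0 ta (le_trans tb bT).
    have -> : Y t - Y' t = (Y a - Y' a) + ((Y t - Y a) - (Y' t - Y' a)) by zmodule.
    apply: le_trans (ler_normD _ _) _.
    apply: (@le_trans _ _ (`|Y a - Y' a| + 2 * N2 * W)); last first.
      by rewrite /z0 addrAC lerDr; nonneg_with phi0.
    rewrite lerD2l; apply: le_trans (ler_normB _ _) _.
    have := wW a0 ta (le_trans tb bT) => wt.
    have H : N2 * w a t <= N2 * W by rewrite ler_wpM2l.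
    have := le_trans h1 H; have := le_trans h2 H; lra.
  + have s0 := le_trans a0 sa; have tT := le_trans tb bT.
    have [h1 h2 _ _] := pair_apriori s0 st tT.
    apply: le_trans (ler_normB _ _) _; apply: le_trans (lerD h1 h2) _.
    rewrite -mulrDl ler_wpM2r ?exprn_ge0 //.
    apply: (@le_trans _ _ z0); first by rewrite /z0; have := ltW ep0; lra.
    by rewrite ler_peMl // /z0; have := ltW ep0; have := A10; lra.
- move=> x [q1 q2 q3].
  have x0 : 0 <= x by rewrite (le_trans (ltW ep0)).
  have e2 : ep <= 2 * x by lra.
  have x2 : x <= 2 * x by lra.
  have cx : ep <= c by rewrite lerDr.
  have hJ s t : a <= s -> s <= t -> t <= b -> `|J s t - J' s t| <= NJ * (2 * x) * w s t ^+ 2.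
    move=> sa st tb; apply: le_trans (q3 s t sa st tb) _.
    rewrite exprS mulrA ler_wpM2r ?exprn_ge0 //.
    apply: (@le_trans _ _ x).
      by rewrite mulrAC ler_piMl // Dw.
    apply: (le_trans x2); rewrite ler_peMl ?mulr_ge0 //.
    by rewrite /NJ -addrA lerDl; nonneg_with phi0.
  split.
  + by apply: le_trans cx _; rewrite lerDl divr_ge0.
  + move=> t ta tb.
    have ya : `|Y a - Y' a| <= 2 * x by apply: le_trans x2; exact: q2.
    have [_ [_ _ H]] := increment_close e2 a0 ta (le_trans tb bT) ya (hJ a t (lexx a) ta tb).
    have -> : Y t - Y' t = (Y a - Y' a) + ((Y t - Y a) - (Y' t - Y' a)) by zmodule.
    apply: le_trans (ler_normD _ _) _; apply: lerD; first by rewrite lerDl ltW.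
    apply: le_trans H _.
    have H4 : 4 * Ni * w a t <= 1.
      apply: le_trans (Bw' (4 * Ni) _ _); first by rewrite ler_wpM2l ?wab ?mulr_ge0.
        by rewrite mulr_ge0.
      by rewrite /B lerDr addr_ge0.
    have -> : Ni * (2 * x) * w a t = (4 * Ni * w a t) * (x / 2) by field.
    by rewrite ler_piMl // divr_ge0.
  + move=> s t sa st tb.
    have A0 : 0 <= A2 * x by rewrite mulr_ge0.
    have Jxx v : 0 <= v <= T -> J v v - J' v v = 0.
      move=> vT; rewrite /J /J' (rd_defectxx (sp_p1 sp) (sp_rd sp) _ (sp_F0 sp)) //.
      by rewrite (rd_defectxx (sp_p1 sp) (sp_rd' sp) _ (sp_G0 sp)) // subrr.
    have Jneg : negligible T (fun s t => J s t - J' s t).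
      move=> h h0; have h2 : 0 < h / 2 by rewrite divr_gt0.
      have [d1 d10 H1] := sp_J sp h2; have [d2 d20 H2] := sp_J' sp h2.
      exists (Num.min d1 d2); first by rewrite lt_min d10.
      move=> s' t' P s'0 t'T iP; rewrite lt_min => /andP[m1 m2].
      rewrite partition_sumB; apply: le_trans (ler_normB _ _) _.
      by rewrite [h]splitr; apply: lerD; [exact: H1|exact: H2].
    have p0 := lt_le_trans ltr01 (sp_p1 sp).
    apply: le_trans (sewing_path p0 omc A0 S0 a0 bT (sp_S sp) Jneg Jxx _ sa st tb) _.
      move=> s' u t' s'a s'u ut' t'b.
      have s'0 := le_trans a0 s'a; have t'T := le_trans t'b bT.
      have ub := le_trans ut' t'b; have au := le_trans s'a s'u.
      have ys : `|Y s' - Y' s'| <= 2 * x.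
        by apply: le_trans x2; apply: q2 => //; exact: le_trans s'u ub.
      have yu : `|Y u - Y' u| <= 2 * x by apply: le_trans x2; exact: q2.
      apply: le_trans (delta_close e2 s'0 s'u ut' t'T ys yu (hJ s' u s'a s'u ub)) _.
      by rewrite -/(w s' t') le_eqVlt /A2; apply/orP; left; apply/eqP; ring.
    rewrite -/(w s t) ler_wpM2r ?exprn_ge0 // mulrA.
    apply: (@le_trans _ _ (D * (x / 2))).
      rewrite /D mulrDl; have -> : 2 * (S * A2) * (x / 2) = S * A2 * x by field.
      by rewrite lerDl mul1r divr_ge0.
    by rewrite ler_wpM2l // lerDr (le_trans (ltW ep0)).
Qed.

End Pair.

(** Gronwall along a fine partition: runs of small control are handled by [chunk_stability], the
    steps between them, which may be jumps, by comparing one Euler step. *)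
Lemma pair_stability : exists2 C : R, 0 <= C &
  forall p ep T om F G X X' XX XX' Y Y',
  stable_pair p ep T om F G X X' XX XX' Y Y' -> `|Y 0 - Y' 0| <= ep ->
  forall s t, 0 <= s -> s <= t -> t <= T ->
  [/\ `|Y t - Y' t| <= C * ep,
      close C (C * ep) (om s t `^ p^-1) (Y t - Y s) (Y' t - Y' s) &
      `|(Y t - Y s - f1 F (Y s) (X t - X s)) - (Y' t - Y' s - f1 G (Y' s) (X' t - X' s))|
        <= C * ep * (om s t `^ p^-1) ^+ 2].
Proof.
have B0 : 0 < B by exact: lt_le_trans B1.
have Bi : 0 < B^-1 <= 1 by rewrite invr_gt0 B0 invf_le1.
have Bi0 : 0 <= B^-1 by rewrite invr_ge0 ltW.
(* The threshold must not depend on [p]. For 1 <= p <= 3 the p-th root of B^(-3) lies between B^(-3)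
   and B^(-1): the upper bound gives [B * w <= 1] on small intervals, the lower one the factor
   [B ^+ 9] on large ones. *)
pose dl := B^-1 ^+ 3; have dl0 : 0 < dl by rewrite exprn_gt0 // invr_gt0.
pose M := Num.truncn (K / dl).
pose e1 := phi NJ * (W + W ^+ 2); have e10 : 0 <= e1 by nonneg_with phi0.
(* A run turns an error [z] into at most [2 * (z + ep) + ep], a step into at most
   [z + e1 * (z + ep) + ep]. *)
pose A3 := 4 + e1; have A30 : 0 <= A3 by nonneg_with phi0.
pose C1 := (A3 + 1) ^+ (2 * M).+1 * 2; have C10 : 0 <= C1 by nonneg_with phi0.
pose C2 := D * (2 * (C1 + 1) + 1) + (2 * C1 + e1 * (C1 + 1)) * B ^+ 9.
have C20 : 0 <= C2 by nonneg_with phi0.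
pose C3 := C1 + C2 * W + 1; have C30 : 0 <= C3 by nonneg_with phi0.
exists (Ni + C3 + (phi NJ + NJ) * C3); first by nonneg_with phi0.
move=> p ep T om F G X X' XX XX' Y Y' sp Z0.
have ep0 := sp_ep sp; have ep0' := ltW ep0; have omc := rd_control (sp_rd sp).
have p1 := sp_p1 sp; have p0 : 0 < p by exact: lt_le_trans p1.
have pi0 : 0 <= p^-1 by rewrite invr_ge0 ltW.
have dlE : dl `^ p^-1 = B^-1 `^ (3 / p) by rewrite /dl -powR_mulrn // -powRrM.
have w0 s t : 0 <= om s t `^ p^-1 := powR_ge0 _ _.
have small s t : 0 <= om s t -> om s t <= dl -> B * om s t `^ p^-1 <= 1.
  move=> om0 h; rewrite -ler_pdivlMl // mulr1.
  apply: (@le_trans _ _ (dl `^ p^-1)); first by apply: ge0_ler_powR; rewrite ?nnegrE ?(ltW dl0).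
  rewrite dlE; apply: ge1r_powR => //.
  by rewrite ler_pdivlMr // mul1r (sp_p3 sp).
have big s t : dl <= om s t -> 1 <= B ^+ 9 * (om s t `^ p^-1) ^+ 3.
  move=> h; have H : B^-1 ^+ 3 <= om s t `^ p^-1.
    apply: (@le_trans _ _ (dl `^ p^-1)); last first.
      by apply: ge0_ler_powR; rewrite ?nnegrE ?(ltW dl0) // (le_trans (ltW dl0)).
    rewrite dlE -powR_mulrn //; apply: ger_powR => //.
    by rewrite ler_pdivrMr // ler_peMr.
  have -> : 1 = B ^+ 9 * (B^-1 ^+ 3) ^+ 3.
    by rewrite -exprM -exprMn mulfV ?expr1n ?gt_eqF.
  rewrite ler_wpM2l ?exprn_ge0 ?(ltW B0) // lerXn2r ?nnegrE ?exprn_ge0 //.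
have Zb t : 0 <= t -> t <= T -> `|Y t - Y' t| <= C1 * ep.
  move=> t0 tT; have ep2 : 0 < ep / 2 by rewrite divr_gt0.
  (* In a fine partition the defect of each single step is at most [ep / 2] for both solutions, even
     across a jump. *)
  have [d1 d10 H1] := negligible_step (sp_J sp) ep2.
  have [d2 d20 H2] := negligible_step (sp_J' sp) ep2.
  have d0 : 0 < Num.min d1 d2 by rewrite lt_min d10.
  have [P [iP mP]] := fine_partition_ex t0 d0.
  have [n [ti [ti0 tin tib tim tis]]] := partition_points iP mP.
  have omn : ncontrol n (fun i j => om (ti i) (ti j)).
    split=> [i j ij jn|i m j im mj jn].
      have /andP[a _] := tib i (leq_trans ij jn); have /andP[_ b] := tib j jn.
      by apply: omc.1; rewrite ?tim // (le_trans b).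
    have mn := leq_trans mj jn.
    have /andP[a _] := tib i (leq_trans im mn); have /andP[_ b] := tib j jn.
    by apply: omc.2; rewrite ?tim // (le_trans b).
  have omM : om (ti 0%N) (ti n) <= M.+1%:R * dl.
    rewrite -ler_pdivrMr // ti0 tin; apply/ltW; apply: le_lt_trans (truncnS_gt _).
    rewrite ler_wpM2r ?invr_ge0 ?(ltW dl0) //; apply: le_trans (rd_total (sp_rd sp)).
    exact: (control_le omc).
  have := @ngronwall R A3 ep dl M n _ (fun i => `|Y (ti i) - Y' (ti i)|) omn A30 ep0' dl0
    (fun=> normr_ge0 _) _ _ 0%N n (leq0n _) (leqnn _) omM.
  rewrite ti0 tin => H.
  apply: (@le_trans _ _ (`|Y t - Y' t| + ep)); first by rewrite lerDl.
  apply: le_trans (H _ _) _; last first.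
  - rewrite /C1 -mulrA ler_wpM2l ?exprn_ge0 ?addr_ge0 //; lra.
  - move=> i j ij jn h.
    have /andP[a _] := tib i (leq_trans ij jn); have /andP[_ b] := tib j jn.
    have tij := tim _ _ ij jn; have bT := le_trans b tT.
    have [H3 _] := chunk_stability sp a tij bT (small _ _ (omc.1 _ _ a tij bT) h).
    apply: le_trans (H3 _ tij (lexx _)) _.
    have := normr_ge0 (Y (ti i) - Y' (ti i)); rewrite /A3; nra.
  - move=> i i_n; have [tlt tstep] := tis i i_n.
    have /andP[a _] := tib i (ltnW i_n); have /andP[_ b] := tib i.+1 i_n.
    have bT := le_trans b tT.
    move: tstep; rewrite lt_min => /andP[s1 s2].
    have J1 := H1 _ _ a tlt bT s1; have J2 := H2 _ _ a tlt bT s2.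
    have zn := normr_ge0 (Y (ti i) - Y' (ti i)).
    have epe : ep <= `|Y (ti i) - Y' (ti i)| + ep by rewrite lerDr.
    have ze : `|Y (ti i) - Y' (ti i)| <= `|Y (ti i) - Y' (ti i)| + ep by rewrite lerDl.
    have He := euler_close sp epe a (ltW tlt) bT ze.
    have -> : Y (ti i.+1) - Y' (ti i.+1) = (Y (ti i) - Y' (ti i)) +
        (euler F (Y (ti i)) (X (ti i.+1) - X (ti i)) (XX (ti i) (ti i.+1)) -
         euler G (Y' (ti i)) (X' (ti i.+1) - X' (ti i)) (XX' (ti i) (ti i.+1))) +
        (defect X XX F Y (ti i) (ti i.+1) - defect X' XX' G Y' (ti i) (ti i.+1)).
      by rewrite /defect; zmodule.
    apply: le_trans (ler_normD _ _) _.
    apply: le_trans (lerD (ler_normD _ _) (ler_normB _ _)) _.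
    rewrite /A3 -/e1 in He *; nra.
have Jb s t : 0 <= s -> s <= t -> t <= T ->
    `|defect X XX F Y s t - defect X' XX' G Y' s t| <= C2 * ep * (om s t `^ p^-1) ^+ 3.
  move=> s0 st tT; have om0 := omc.1 s t s0 st tT; have sT := le_trans st tT.
  have zs := Zb s s0 sT; have zt := Zb t (le_trans s0 st) tT.
  have w3 : 0 <= (om s t `^ p^-1) ^+ 3 by rewrite exprn_ge0.
  have P2 : 0 <= (2 * C1 + e1 * (C1 + 1)) * B ^+ 9.
    by nonneg_with phi0.
  have P1 : 0 <= D * (2 * (C1 + 1) + 1) by nonneg_with phi0.
  have [h|/ltW h] := leP (om s t) dl.
    have [_ H] := chunk_stability sp s0 st tT (small _ _ om0 h).
    apply: le_trans (H s t (lexx s) st (lexx t)) _; rewrite ler_wpM2r //.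
    apply: (@le_trans _ _ (D * (2 * (C1 + 1) + 1) * ep)); last by rewrite ler_wpM2r // lerDl.
    by rewrite -mulrA ler_wpM2l //; lra.
  have epe : ep <= (C1 + 1) * ep by rewrite ler_peMl // lerDr.
  have ze : `|Y s - Y' s| <= (C1 + 1) * ep by apply: le_trans zs _; rewrite ler_wpM2r // lerDl.
  have He := euler_close sp epe s0 st tT ze.
  have -> : defect X XX F Y s t - defect X' XX' G Y' s t = (Y t - Y' t) - (Y s - Y' s) -
        (euler F (Y s) (X t - X s) (XX s t) - euler G (Y' s) (X' t - X' s) (XX' s t)).
    by rewrite /defect; zmodule.
  apply: (@le_trans _ _ ((2 * C1 + e1 * (C1 + 1)) * ep)).
    apply: le_trans (ler_normB _ _) _.
    apply: le_trans (lerD (ler_normB _ _) (lexx _)) _.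
    rewrite -/e1 in He; lra.
  have wB := big s t h.
  apply: (@le_trans _ _ ((2 * C1 + e1 * (C1 + 1)) * B ^+ 9 * ep * (om s t `^ p^-1) ^+ 3)).
    have -> : (2 * C1 + e1 * (C1 + 1)) * B ^+ 9 * ep * (om s t `^ p^-1) ^+ 3 =
      (2 * C1 + e1 * (C1 + 1)) * ep * (B ^+ 9 * (om s t `^ p^-1) ^+ 3) by ring.
    by rewrite ler_peMr //; nonneg_with phi0.
  by rewrite ler_wpM2r // ler_wpM2r // lerDr.
move=> s t s0 st tT; have tt0 := le_trans s0 st.
have wW := rd_w_bound p1 (sp_rd sp) s0 st tT; have ws := w0 s t.
have epe : ep <= C3 * ep by rewrite ler_peMl // /C3 lerDr; nonneg_with phi0.
have C13 : C1 <= C3 by rewrite /C3 -addrA lerDl; nonneg_with phi0.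
have C23 : C2 * W <= C3 by rewrite /C3 addrAC lerDr; nonneg_with phi0.
have zs : `|Y s - Y' s| <= C3 * ep.
  by apply: le_trans (Zb s s0 (le_trans st tT)) _; rewrite ler_wpM2r.
have hJ : `|defect X XX F Y s t - defect X' XX' G Y' s t| <=
    NJ * (C3 * ep) * (om s t `^ p^-1) ^+ 2.
  apply: le_trans (Jb s t s0 st tT) _; rewrite exprS mulrA ler_wpM2r ?exprn_ge0 //.
  apply: (@le_trans _ _ (C2 * W * ep)); first by rewrite mulrAC ler_wpM2r // ler_wpM2l.
  apply: (@le_trans _ _ (C3 * ep)); first by rewrite ler_wpM2r.
  rewrite ler_peMl ?mulr_ge0 // /NJ -addrA lerDl; nonneg_with phi0.
have [[_ _ r1] r2] := increment_close sp epe s0 st tT zs hJ.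
have P3 : 0 <= (phi NJ + NJ) * C3 by nonneg_with phi0.
have le3 : C3 <= Ni + C3 + (phi NJ + NJ) * C3 by rewrite -addrA addrCA lerDl addr_ge0.
split.
- apply: le_trans (Zb t tt0 tT) _; rewrite ler_wpM2r //; exact: le_trans le3.
- apply: closeW r2 => //; first by rewrite mulr_ge0.
    by rewrite ler_wpM2r // -addrA lerDl addr_ge0.
  by rewrite ler_wpM2r.
- apply: le_trans r1 _; rewrite ler_wpM2r ?exprn_ge0 // mulrA ler_wpM2r //.
  by rewrite lerDr addr_ge0.
Qed.

End Stability.

(** * The fields of a rough differential equation *)

Section MatrixFields.
Context {R : realType} {d k : nat}.
Implicit Types (F G : 'rV[R]_k -> 'M[R]_(d, k)).

Definition field1 F (y : 'rV[R]_k) (x : 'rV[R]_d) : 'rV[R]_k := x *m F y.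

Definition field_D F (y : 'rV[R]_k) : 'M[R]_(d, d * k) := F y *m Dmx F y.

Definition field2 F (y : 'rV[R]_k) (A : 'M[R]_d) : 'rV[R]_k :=
  apply_tensor (field_D F y) A.

(** Here [a] equals [F y' - F y] minus the derivative of [F] in the direction [field1 F y x1].
    Written through the Taylor remainder and the remainder of [y' - y], it is visibly of second
    order, and both summands are of third order. *)
Definition field_defect F (y y' : 'rV[R]_k) (x1 x2 : 'rV[R]_d) (A2 : 'M[R]_d) : 'rV[R]_k :=
  let a : 'M[R]_(d, k) := taylor1 F y y' + act (y' - y - field1 F y x1) (Dmx F y) in
  x2 *m a + apply_tensor (field_D F y' - field_D F y) A2.

Lemma field_defectE F y y' x1 x2 A1 A2 :
  field1 F y (x1 + x2) + field2 F y (A1 + A2 + tensor x1 x2) - (field1 F y x1 + field2 F y A1)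
    - (field1 F y' x2 + field2 F y' A2) = - field_defect F y y' x1 x2 A2.
Proof.
have E1 : field1 F y (x1 + x2) = field1 F y x1 + field1 F y x2 by exact: mulmxDl.
have E2 : field2 F y (A1 + A2 + tensor x1 x2) =
    field2 F y A1 + field2 F y A2 + x2 *m act (field1 F y x1) (Dmx F y).
  by rewrite /field2 !apply_tensorDr apply_tensor_tensor /field_D /act /field1 mulmxA.
have E3 : taylor1 F y y' + act (y' - y - field1 F y x1) (Dmx F y) =
    F y' - F y - act (field1 F y x1) (Dmx F y).
  have -> : act (y' - y - field1 F y x1) (Dmx F y) =
      act (y' - y) (Dmx F y) - act (field1 F y x1) (Dmx F y) by exact: actBl.
  rewrite /taylor1; zmodule.
have E4 : field_defect F y y' x1 x2 A2 = field1 F y' x2 - field1 F y x2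
   - x2 *m act (field1 F y x1) (Dmx F y) + (field2 F y' A2 - field2 F y A2).
  rewrite /field_defect E3 apply_tensorDl apply_tensorNl; congr (_ + _).
  by rewrite mulmxBr mulmxBr.
rewrite E1 E2 E4.
move: (field1 F y x1) (field1 F y x2) (field2 F y A1) (field2 F y A2) (x2 *m act _ _)
  (field1 F y' x2) (field2 F y' A2) => a b c e f g h.
zmodule.
Qed.

Definition field_of F : vfield tensor := VField (field_defectE F).

Definition pair_bound c e F G : Prop := forall y z, `|y - z| <= e ->
  [/\ close c e 1 (F y) (G z), close c e 1 (Dmx F y) (Dmx G z) &
      close c e 1 (Dmx (Dmx F) y) (Dmx (Dmx G) z)].

Definition C2_field F : Prop :=
  (forall x, differentiable F x) /\ (forall x, differentiable (Dmx F) x).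

Lemma closeM1 (V : normedModType R) N e v (a b : V) :
  close N e (v * 1) a b -> close N e v a b.
Proof. by rewrite mulr1. Qed.

Lemma close_eq (V : normedModType R) N e v (a a' b b' : V) :
  a = a' -> b = b' -> close N e v a' b' -> close N e v a b.
Proof. by move=> -> ->. Qed.

Lemma close_field_D c e F G y z : 0 <= c -> 0 <= e ->
  close c e 1 (F y) (G z) -> close c e 1 (Dmx F y) (Dmx G z) ->
  close (2 * k%:R * c * c) e 1 (field_D F y) (field_D G z).
Proof. by move=> c0 e0 h1 h2; apply: closeM1; exact: close_mulmx. Qed.

Lemma close_dfield_D N e v F G y y' z z' : 0 <= N -> 0 <= e -> 0 <= v ->
  fields_close N e v F G y z y' z' ->
  close (2 * k%:R * N * N + 2 * k%:R * N * N) e v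
    (field_D F y' - field_D F y) (field_D G z' - field_D G z).
Proof.
move=> N0 e0 v0 [h1 h2 h3 h4 h5 _].
pose a (H : 'rV[R]_k -> 'M[R]_(d, k)) u u' : 'M[R]_(d, d * k) := (H u' - H u) *m Dmx H u'.
pose b (H : 'rV[R]_k -> 'M[R]_(d, k)) u u' : 'M[R]_(d, d * k) := H u *m (Dmx H u' - Dmx H u).
have E H u u' : field_D H u' - field_D H u = a H u u' + b H u u'.
  by rewrite /a /b mulmxBl mulmxBr addrA subrK.
have ca : close (2 * k%:R * N * N) e v (a F y y') (a G z z').
  by apply: closeM1; exact: close_mulmx.
have cb : close (2 * k%:R * N * N) e v (b F y y') (b G z z').
  by rewrite -[v]mul1r; exact: close_mulmx.
exact: (close_eq (E F y y') (E G z z') (closeD ca cb)).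
Qed.

Lemma pair_fields_close (c N : R) : 0 <= c -> 0 <= N -> exists2 N' : R, 0 <= N' &
  forall e v F G y z y' z', 0 <= e -> 0 <= v -> C2_field F -> C2_field G ->
  pair_bound c e F G -> `|y - z| <= e -> `|y' - z'| <= e ->
  close N e v (y' - y) (z' - z) -> fields_close N' e v F G y z y' z'.
Proof.
move=> c0 N0; have [N' N'0 HN'] := @fields_closeI R d k c N c0 N0.
exists N' => // e v F G y z y' z' e0 v0 [dF dDF] [dG dDG] FG yz yz' hh.
have := HN' F G e v y z (y' - y) (z' - z) e0 v0 dF dG dDF dDG _ hh.
rewrite ![_ + (_ - _)]addrC !subrK; apply=> s /andP[s0 s1]; apply: FG.
(* By convexity the segments from [y] to [y'] and from [z] to [z'] stay within [e] of each other,
   where [pair_bound] applies. *)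
have -> : y + s *: (y' - y) - (z + s *: (z' - z)) = (1 - s) *: (y - z) + s *: (y' - z').
  rewrite !scalerBr !scalerBl !scale1r.
  move: (s *: y) (s *: z) (s *: y') (s *: z') => a1 a2 a3 a4; zmodule.
apply: le_trans (ler_normD _ _) _; rewrite !normrZ !ger0_norm ?subr_ge0 //.
have -> : e = (1 - s) * e + s * e by ring.
by apply: lerD; rewrite ler_wpM2l ?subr_ge0.
Qed.

Lemma field_compatible (c : R) : 0 <= c -> exists2 phi : R -> R,
  forall x, 0 <= x -> 0 <= phi x &
  forall e F G, 0 <= e -> C2_field F -> C2_field G -> pair_bound c e F G ->
  compatible phi e (field_of F) (field_of G).
Proof.
move=> c0.
suff /choice[phi Hphi] : forall N : R, exists P : R, 0 <= N -> 0 <= P /\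
    forall e F G, 0 <= e -> C2_field F -> C2_field G -> pair_bound c e F G ->
    [/\ forall y z x x' v, 0 <= v -> `|y - z| <= e -> close N e v x x' ->
        close P e v (field1 F y x) (field1 G z x'),
      forall y z A A' v, 0 <= v -> `|y - z| <= e -> close N e v A A' ->
        close P e v (field2 F y A) (field2 G z A') &
      forall y z y' z' x1 x1' x2 x2' A2 A2' v u,
        0 <= v -> 0 <= u -> `|y - z| <= e -> `|y' - z'| <= e ->
        close N e v (y' - y) (z' - z) ->
        close N e (v ^+ 2) (y' - y - field1 F y x1) (z' - z - field1 G z x1') ->
        close N e u x2 x2' -> close N e (u ^+ 2) A2 A2' ->
        close P e (v * u * (v + u)) (field_defect F y y' x1 x2 A2)
          (field_defect G z z' x1' x2' A2')].
  exists phi => [x x0|e F G e0 F2 G2 FG N N0]; first by have [] := Hphi x x0.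
  by have [P0 /(_ e F G e0 F2 G2 FG)[]] := Hphi N N0.
move=> N; have [N0|N0] := leP 0 N; last first.
  by exists 0.
have [N' N'0 HN'] := pair_fields_close c0 N0.
(* [P1] and [P2] serve the first- and second-order terms of a step, [P3] and [P4] the two summands
   of the defect of additivity. *)
pose P1 := 2 * d%:R * N * c.
pose P2 := 2 * (d * d)%:R * (2 * k%:R * c * c) * N.
pose P3 := 2 * d%:R * N * (N' + 2 * k%:R * N * N').
pose P4 := 2 * (d * d)%:R * (2 * k%:R * N' * N' + 2 * k%:R * N' * N') * N.
have P10 : 0 <= P1 by nonneg_with N0.
have P20 : 0 <= P2 by nonneg_with N0.
have P30 : 0 <= P3 by nonneg_with N0.
have P40 : 0 <= P4 by nonneg_with N0.
have cc0 : 0 <= 2 * k%:R * c * c by nonneg_with N0.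
have cc1 : 0 <= 2 * k%:R * N' * N' + 2 * k%:R * N' * N' by nonneg_with N0.
have cc2 : 0 <= N' + 2 * k%:R * N * N' by nonneg_with N0.
exists (P1 + P2 + (P3 + P4)) => _; split; first by nonneg_with N0.
move=> e F G e0 F2 G2 FG; split.
- move=> y z x x' v v0 yz xx; have [hF _ _] := FG y z yz.
  apply: (@closeW _ _ P1 _ e e v v) => //; first by rewrite ler_wpM2r // -addrA lerDl !addr_ge0.
  by apply: closeM1; exact: close_mulmx.
- move=> y z A A' v v0 yz AA; have [hF hD _] := FG y z yz.
  apply: (@closeW _ _ P2 _ e e v v) => //.
    by rewrite ler_wpM2r // addrAC lerDr !addr_ge0.
  rewrite -[v]mul1r; apply: close_apply_tensor => //.
  exact: close_field_D.
- move=> y z y' z' x1 x1' x2 x2' A2 A2' v u v0 u0 yz yz' hh hr hx hA.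
  have FC : fields_close N' e v F G y z y' z' by exact: HN' FG yz yz' hh.
  have v2 : 0 <= v ^+ 2 by rewrite exprn_ge0.
  have u2 : 0 <= u ^+ 2 by rewrite exprn_ge0.
  have c1 : close P3 e (u * v ^+ 2)
     (x2 *m (taylor1 F y y' + act (y' - y - field1 F y x1) (Dmx F y)))
     (x2' *m (taylor1 G z z' + act (z' - z - field1 G z x1') (Dmx G z))).
    apply: close_mulmx => //; apply: closeD; first exact: close_T FC.
    apply: closeM1; apply: close_act => //; exact: close_D FC.
  have c2 : close P4 e (v * u ^+ 2) (apply_tensor (field_D F y' - field_D F y) A2)
     (apply_tensor (field_D G z' - field_D G z) A2').
    by apply: close_apply_tensor => //; exact: close_dfield_D.
  have vu : 0 <= v * u by rewrite mulr_ge0.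
  have c3 := closeD (closeW (e' := e) (v' := v * u * (v + u)) P30 e0 (mulr_ge0 u0 v2) _ (lexx e) c1)
                   (closeW (e' := e) (v' := v * u * (v + u)) P40 e0 (mulr_ge0 v0 u2) _ (lexx e) c2).
  apply: (closeW _ _ _ _ _ (c3 P3 P4 _ _)) => //; rewrite ?mulr_ge0 ?addr_ge0 //.
  + by rewrite ler_wpM2r ?mulr_ge0 ?addr_ge0 // lerDr addr_ge0.
  + by rewrite ler_wpM2l //; nra.
  + by rewrite ler_wpM2l //; nra.
Qed.

End MatrixFields.

Lemma lipschitz_bound_continuous {R : realType} (U W : normedModType R) (g : U -> W) C :
  (forall y z, `|g y - g z| <= C * `|y - z|) -> continuous g.
Proof.
move=> L y; apply/cvgrPdist_le => e e0.
have P0 : 0 < `|C| + 1 by rewrite ltr_wpDl.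
near=> z; apply: le_trans (L y z) _.
apply: (@le_trans _ _ ((`|C| + 1) * `|y - z|)).
  by rewrite ler_wpM2r // (le_trans (ler_norm C)) // lerDl.
rewrite mulrC -ler_pdivlMr //; near: z.
by apply: (@cvgr_dist_le _ _ _ (nbhs y) _ id) => //; rewrite divr_gt0.
Unshelve. all: by end_near. Qed.

(** * Field estimates from the C^l_b norms *)

Section BoundedFields.
Context {R : realType} {k : nat}.

Lemma supnorm_ge (V : normedModType R) (f : 'rV[R]_k -> V) x : (`|f x|%:E <= supnorm f)%E.
Proof. by apply: ereal_sup_ubound; exists x. Qed.

Lemma supnorm_ge0 (V : normedModType R) (f : 'rV[R]_k -> V) : (0 <= supnorm f)%E.
Proof. by apply: le_trans (supnorm_ge f 0); rewrite lee_fin. Qed.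

Lemma supnorm_fin (V : normedModType R) (f : 'rV[R]_k -> V) :
  bounded_fun f -> supnorm f \is a fin_num.
Proof.
move=> bf; rewrite ge0_fin_numE ?supnorm_ge0 //.
have [M [_ /(_ (M + 1))]] := bf; rewrite ltrDl ltr01 => /(_ isT) H.
apply: (@le_lt_trans _ _ (M + 1)%:E); last exact: ltry.
by apply: ge_ereal_sup => _ [x _ <-]; rewrite lee_fin H.
Qed.

Lemma Cbnorm_ge0 l m n (f : 'rV[R]_k -> 'M[R]_(m, n)) : (0 <= Cbnorm l f)%E.
Proof.
elim: l m n f => [|l IH] m n f /=; first exact: supnorm_ge0.
by apply: adde_ge0; [exact: supnorm_ge0|exact: IH].
Qed.

Lemma Cbnorm_fin l m n (f : 'rV[R]_k -> 'M[R]_(m, n)) :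
  Cb l f -> Cbnorm l f \is a fin_num.
Proof.
elim: l m n f => [|l IH] m n f /= [_ bf]; first by move=> _; exact: supnorm_fin.
by move=> [_ /IH Cf]; rewrite fin_numD supnorm_fin.
Qed.

Lemma Cbnorm_val l m n (f : 'rV[R]_k -> 'M[R]_(m, n)) x : (`|f x|%:E <= Cbnorm l f)%E.
Proof.
case: l => [|l] /=; first exact: supnorm_ge.
by apply: le_trans (supnorm_ge f x) _; rewrite leeDl // Cbnorm_ge0.
Qed.

Lemma Cbnorm_deriv l m n (f : 'rV[R]_k -> 'M[R]_(m, n)) :
  (Cbnorm l (Dmx f) <= Cbnorm l.+1 f)%E.
Proof. by rewrite /= leeDr // supnorm_ge0. Qed.

Lemma Cbnorm_leS l m n (f : 'rV[R]_k -> 'M[R]_(m, n)) : (Cbnorm l f <= Cbnorm l.+1 f)%E.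
Proof.
elim: l m n f => [|l IH] m n f; last by rewrite [leLHS]/=; apply: leeD => //; exact: IH.
by rewrite /= leeDl // supnorm_ge0.
Qed.

Lemma diffB_app (V W : normedModType R) (F G : V -> W) x v :
  differentiable F x -> differentiable G x ->
  'd (F - G) x v = 'd F x v - 'd G x v.
Proof. by move=> dF dG; rewrite diffB. Qed.

Lemma DmxB m n (f g : 'rV[R]_k -> 'M[R]_(m, n)) x :
  differentiable f x -> differentiable g x ->
  Dmx (fun y => f y - g y) x = Dmx f x - Dmx g x.
Proof.
move=> df dg.
pose F (y : 'rV[R]_k) : 'rV[R]_(m * n) := mxvec (f y).
pose G (y : 'rV[R]_k) : 'rV[R]_(m * n) := mxvec (g y).
have dF : differentiable F x by exact: differentiable_mxvec.
have dG : differentiable G x by exact: differentiable_mxvec.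
have E : (fun y => mxvec (f y - g y)) = F - G by apply/funext => y; rewrite linearB.
have JB : 'J (F - G) x = 'J F x - 'J G x.
  rewrite /jacobian; apply/matrixP => i j; rewrite 3!mxE mxE [in RHS]mxE.
  by have := congr1 (fun v : 'rV[R]_(m * n) => v 0 j) (diffB_app 'e_i dF dG); rewrite !mxE.
by rewrite /Dmx E.
Qed.



Lemma Dmx0 m n (x : 'rV[R]_k) : Dmx (fun=> 0 : 'M[R]_(m, n)) x = 0.
Proof.
have d0 : differentiable (fun _ : 'rV[R]_k => 0 : 'M[R]_(m, n)) x by exact: differentiable_cst.
rewrite -[RHS](subrr (Dmx (fun=> 0 : 'M[R]_(m, n)) x)) -(DmxB d0 d0); congr (Dmx _ x).
by apply/funext => y; rewrite subrr.
Qed.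

Lemma Cbnorm0 l m n : Cbnorm l (fun _ : 'rV[R]_k => 0 : 'M[R]_(m, n)) = 0%E.
Proof.
have S0 p q : supnorm (fun _ : 'rV[R]_k => 0 : 'M[R]_(p, q)) = 0%E.
  apply/eqP; rewrite eq_le supnorm_ge0 andbT.
  by apply: ge_ereal_sup => _ [x _ <-]; rewrite normr0.
elim: l m n => [|l IH] m n /=; rewrite S0 // add0e.
by rewrite (_ : Dmx _ = fun=> 0) //; apply/funext => x; exact: Dmx0.
Qed.

Variable d : nat.
Implicit Types f g : 'rV[R]_k -> 'M[R]_(d, k).

Lemma Cb3_C2_field f : Cb 3 f -> C2_field f.
Proof. by move=> [_ _ [df [_ _ [ddf _]]]]. Qed.

(** At distance 0 only sizes remain, so no third derivative enters; this gives the C^2_b norm in the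
    bound on one solution. *)
Lemma Cb3_pair_refl f M : (Cbnorm 2 f <= M%:E)%E -> pair_bound M 0 f f.
Proof.
move=> fM; have C1 := le_trans (Cbnorm_deriv 1 f) fM.
have C0 := le_trans (Cbnorm_deriv 0 (Dmx f)) C1.
move=> y z; rewrite normr_le0 subr_eq0 => /eqP ->.
by split; apply: close_refl => //; rewrite mulr1 -lee_fin;
  [apply: le_trans fM|apply: le_trans C1|apply: le_trans C0]; exact: Cbnorm_val.
Qed.

(** [close_field] for the fields and their first two derivatives; the third derivative acts as a
    Lipschitz constant of the second. *)
Lemma Cb3_pair_bound f g M e : 0 <= M -> Cb 3 f -> Cb 3 g ->
  (Cbnorm 3 f <= M%:E)%E -> (Cbnorm 3 g <= M%:E)%E ->
  (Cbnorm 2 (fun x => (f x - g x)%R) <= e%:E)%E ->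
  pair_bound (k%:R * M + M + 1) e f g.
Proof.
move=> M0 [_ _ [df [_ _ [ddf [_ _ [dddf _]]]]]] [_ _ [dg [_ _ [ddg [_ _ [dddg _]]]]]] f3 g3 fg2.
have f2 := le_trans (Cbnorm_deriv 2 f) f3; have g2 := le_trans (Cbnorm_deriv 2 g) g3.
have f1 := le_trans (Cbnorm_deriv 1 _) f2; have g1 := le_trans (Cbnorm_deriv 1 _) g2.
have f0 := le_trans (Cbnorm_deriv 0 _) f1.
have E1 := funext (fun x => DmxB (df x) (dg x)).
have E2 := funext (fun x => DmxB (ddf x) (ddg x)).
have fg1 := le_trans (Cbnorm_deriv 1 _) fg2; rewrite E1 in fg1.
have fg0 := le_trans (Cbnorm_deriv 0 _) fg1; rewrite E2 in fg0.
have val l m n (h : 'rV[R]_k -> 'M[R]_(m, n)) C x : (Cbnorm l h <= C%:E)%E -> `|h x| <= C.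
  by move=> hC; rewrite -lee_fin; apply: le_trans (Cbnorm_val l h x) hC.
move=> y z yz; split.
- apply: close_field => // x; [exact: val f3|exact: val g3|exact: val f2|exact: (val 2%N _ _ _ _ x fg2)].
- apply: close_field => // x; [exact: val f2|exact: val g2|exact: val f1|exact: (val 1%N _ _ _ _ x fg1)].
- apply: close_field => // x; [exact: val f1|exact: val g1|exact: val f0|exact: (val 0%N _ _ _ _ x fg0)].
Qed.

Lemma field_of_euler0 f y : euler (field_of f) y 0 0 = 0.
Proof.
rewrite /euler /= /field1 /field2 mul0mx add0r /apply_tensor.
by rewrite big1 // => i _; rewrite big1 // => j _; rewrite mxE scale0r.
Qed.

Lemma Cbnorm_subrr f : Cbnorm 2 (fun x => (f x - f x)%R) = 0%E.
Proof.
rewrite -(Cbnorm0 2 d k); congr (Cbnorm 2 _).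
by apply/funext => x; rewrite subrr.
Qed.

(** Compatibility of the field with itself at distance [e], equal to the norm of [y - z], is a
    Lipschitz estimate. *)
Lemma field_of_continuous f x A : Cb 3 f -> continuous (fun y => euler (field_of f) y x A).
Proof.
move=> Cf; have F2 := Cb3_C2_field Cf.
pose M := fine (Cbnorm 3 f); have M0 : 0 <= M by rewrite fine_ge0 // Cbnorm_ge0.
have fM : (Cbnorm 3 f <= M%:E)%E by rewrite fineK // Cbnorm_fin.
have c0 : 0 <= k%:R * M + M + 1 by rewrite !addr_ge0 // mulr_ge0.
have [phi phi0 Hphi] := @field_compatible R d k _ c0.
pose N := `|x| + `|A|; have N0 : 0 <= N by rewrite addr_ge0.
have L y z : `|euler (field_of f) y x A - euler (field_of f) z x A| <= 2 * phi N * `|y - z|.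
  have fe : (Cbnorm 2 (fun x => (f x - f x)%R) <= `|y - z|%:E)%E by rewrite Cbnorm_subrr lee_fin.
  have [_ H1 H2 _] := Hphi _ _ _ (normr_ge0 _) F2 F2 (Cb3_pair_bound M0 Cf Cf fM fM fe) N N0.
  have cx : close N `|y - z| 1 x x.
    by split; rewrite ?mulr1 ?lerDl // subrr normr0 !mulr_ge0.
  have cA : close N `|y - z| 1 A A.
    by split; rewrite ?mulr1 ?lerDr // subrr normr0 !mulr_ge0.
  have [_ _ h1] := H1 y z x x 1 ler01 (lexx _) cx.
  have [_ _ h2] := H2 y z A A 1 ler01 (lexx _) cA.
  rewrite mulr1 in h1; rewrite mulr1 in h2.
  rewrite /euler opprD addrACA; apply: le_trans (ler_normD _ _) _.
  by rewrite -mulrA mulr2n mulrDl mul1r lerD.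
exact: lipschitz_bound_continuous L.
Qed.

End BoundedFields.

(** * Cadlag regularity from a control *)

Section Regularity.
Context {R : realType} {V : normedModType R}.
Variables (p T : R) (om : R -> R -> R).
Hypotheses (p0 : 0 < p) (omc : control T om) (omr : right_small T om).
Hypothesis Vcompact : forall (y0 : V) B, compact [set y | `|y - y0| <= B].

Lemma root_small (C eta : R) : 0 <= C -> 0 < eta ->
  exists2 e, 0 < e & forall x, 0 <= x -> x <= e -> C * x `^ p^-1 <= eta.
Proof.
move=> C0 eta0; have C1 : 0 < C + 1 by lra.
have e0 : 0 < eta / (C + 1) by rewrite divr_gt0.
exists ((eta / (C + 1)) `^ p); first by rewrite powR_gt0.
move=> x x0 xe.
have : x `^ p^-1 <= eta / (C + 1).
  apply: (@le_trans _ _ (((eta / (C + 1)) `^ p) `^ p^-1)).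
    by apply: ge0_ler_powR => //; rewrite ?nnegrE ?powR_ge0 // invr_ge0 ltW.
  by rewrite -powRrM mulfV ?gt_eqF // powRr1 // ltW.
rewrite ler_pdivlMr // => H; apply: le_trans H.
by rewrite mulrC ler_wpM2l ?powR_ge0 // lerDl.
Qed.

(** To the right of a point the control of [t, v] tends to 0. To the left smallness of the control
    makes the path Cauchy, and a cluster point in a compact ball is then the limit. *)
Lemma cadlag_of_control (C a b : R) (Y : R -> V) : 0 <= a -> b <= T -> 0 <= C ->
  (forall s t, a <= s -> s <= t -> t <= b -> `|Y t - Y s| <= C * om s t `^ p^-1) ->
  cadlag a b Y.
Proof.
move=> a0 bT C0 HY; split=> t /andP[t1 t2].
- apply/cvgrPdist_le => eta eta0; have [e e0 He] := root_small C0 eta0.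
  have t0 := le_trans a0 t1; have tT := le_trans (ltW t2) bT.
  have [|r r0 [_ Hr]] := control_local_small omc omr (tau := t) _ e0; first by rewrite t0.
  near=> v; have tv : t < v by near: v; exact: nbhs_right_gt.
  have vb : v < b by near: v; exact: nbhs_right_lt.
  have vr : v < t + r by near: v; apply: nbhs_right_lt; rewrite ltrDl.
  have vT := le_trans (ltW vb) bT.
  rewrite distrC; apply: le_trans (HY t v t1 (ltW tv) (ltW vb)) _; apply: He.
    exact: (omc.1 _ _ t0 (ltW tv)).
  exact: Hr (lexx _) (ltW tv) vr vT.
- have t0 := le_lt_trans a0 t1; have tT := le_trans t2 bT.
  have small eta : 0 < eta -> exists2 r, 0 < r &
      forall u v, a < u -> t - r < u -> u < t -> a < v -> t - r < v -> v < t ->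
      `|Y v - Y u| <= eta.
    move=> eta0; have [e e0 He] := root_small C0 eta0.
    have [|r r0 [Hr _]] := control_local_small omc omr (tau := t) _ e0; first by rewrite ltW.
    exists r => //.
    suff S u v : a < u -> t - r < u -> u <= v -> v < t -> `|Y v - Y u| <= eta.
      move=> u v au ru ut av rv vt; have [uv|/ltW vu] := leP u v; first exact: S.
      by rewrite distrC; exact: S.
    move=> au ru uv vt; have u0 := le_trans a0 (ltW au).
    have vb := le_trans (ltW vt) t2; have vT := le_trans vb bT.
    apply: le_trans (HY u v (ltW au) uv vb) _; apply: He; first exact: omc.1.
    exact: Hr.
  have nearleft r : 0 < r -> \forall u \near t^'-, [/\ a < u, t - r < u & u < t].
    move=> r0; near=> u; split; near: u.
    - exact: nbhs_left_gt.
    - by apply: nbhs_left_gt; rewrite gtrBl.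
    - exact: nbhs_left_lt.
  have [r r0 Hr] := small 1 ltr01.
  have [v0 [av0 rv0 v0t]] := @filter_ex _ _ _ _ (nearleft r r0).
  have [|l [_ clu]] := @Vcompact (Y v0) 1 (Y @ t^'-) _.
    by apply: filterS (nearleft r r0) => u [au ru ut]; exact: Hr.
  apply/cvg_ex; exists l; apply/cvgrPdist_le => eta eta0.
  have eta2 : 0 < eta / 2 by rewrite divr_gt0.
  have [r1 r10 Hr1] := small _ eta2.
  have A1 : (Y @ t^'-) [set Y u | u in [set u | [/\ a < u, t - r1 < u & u < t]]].
    by apply: filterS (nearleft r1 r10) => u Hu /=; exists u.
  have [|_ [[u [au ru ut] <-] ul]] := clu _ _ A1 (_ : nbhs l [set y | `|l - y| <= eta / 2]).
    by apply: (@cvgr_dist_le _ _ _ (nbhs l) _ id).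
  apply: filterS (nearleft r1 r10) => v [av rv vt] /=.
  have -> : l - Y v = (l - Y u) + (Y u - Y v) by rewrite addrA subrK.
  rewrite (splitr eta); apply: le_trans (ler_normD _ _) _.
  by apply: lerD => //; exact: Hr1.
Unshelve. all: by end_near. Qed.

End Regularity.

(** * Solutions of rough differential equations *)

Section Drivers.
Context {R : realType} {d : nat}.
Implicit Types (X : R -> 'rV[R]_d) (XX : R -> R -> 'M[R]_d).

Lemma powR_half (p x : R) : 0 < p -> 0 <= x -> x `^ (p / 2)^-1 = (x `^ p^-1) ^+ 2.
Proof.
move=> p0 x0; rewrite -powR_mulrn ?powR_ge0 // -powRrM.
by congr (_ `^ _); rewrite invf_div mulrC.
Qed.

Lemma root_mono (p x y : R) : 0 < p -> 0 <= x -> x <= y -> x `^ p^-1 <= y `^ p^-1.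
Proof.
move=> p0 x0 xy; apply: ge0_ler_powR; rewrite ?nnegrE ?invr_ge0 ?(ltW p0) //.
exact: le_trans xy.
Qed.

Lemma control_widen (V : normedModType R) (p T B : R) n om om' (a : R -> R -> V) :
  0 < p -> 0 <= B -> control T om ->
  (forall s t, 0 <= s -> s <= t -> t <= T -> om s t <= om' s t) ->
  (forall s t, 0 <= s -> s <= t -> t <= T -> `|a s t| <= B * (om s t `^ p^-1) ^+ n) ->
  forall s t, 0 <= s -> s <= t -> t <= T -> `|a s t| <= B * (om' s t `^ p^-1) ^+ n.
Proof.
move=> p0 B0 omc le H s t s0 st tT; apply: le_trans (H s t s0 st tT) _.
by rewrite ler_wpM2l // lerXn2r ?nnegrE ?powR_ge0 // root_mono ?le // omc.1.
Qed.

(** Partitions have distinct points, so the variation does not see the diagonal; the bound there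
    comes from [Xi s s = 0]. *)
Lemma two_parameter_control (V : normedModType R) (p T B : R) (Xi : R -> R -> V) :
  0 < p -> 0 <= T -> 0 < B -> (var2 (p / 2) 0 T Xi <= B%:E)%E ->
  (forall s, 0 <= s <= T -> Xi s s = 0) ->
  exists om, [/\ control T om, om 0 T <= 1,
    forall s t, 0 <= s -> s <= t -> t <= T -> `|Xi s t| <= B * (om s t `^ p^-1) ^+ 2 &
    (forall s t, 0 <= s -> s < t -> t <= T -> Xi u t @[u --> s^'+] --> Xi s t) ->
    right_small T om].
Proof.
move=> p0 T0 B0 XiB Xi0; have p20 : 0 < p / 2 by rewrite divr_gt0.
have [om [omc om1 omX omr]] := control_exists p20 T0 B0 XiB.
exists om; split=> // s t s0 st tT.
have [->|ne] := eqVneq s t; last first.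
  by rewrite -powR_half ?omc.1 // omX // lt_neqAle ne.
rewrite Xi0 ?normr0 ?mulr_ge0 ?exprn_ge0 ?powR_ge0 // ?(ltW B0) //.
by rewrite (le_trans s0 st).
Qed.

Lemma path_control (V : normedModType R) (p T B : R) (X : R -> V) :
  0 < p -> 0 <= T -> 0 < B -> (pvar p T X <= B%:E)%E ->
  exists om, [/\ control T om, om 0 T <= 1,
    forall s t, 0 <= s -> s <= t -> t <= T -> `|X t - X s| <= B * om s t `^ p^-1 &
    cadlag 0 T X -> right_small T om].
Proof.
move=> p0 T0 B0 XiB.
have [om [omc om1 omX omr]] := control_exists p0 T0 B0 XiB.
exists om; split=> //.
  move=> s t s0 st tT.
  have [->|ne] := eqVneq s t; last by apply: omX => //; rewrite lt_neqAle ne.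
  by rewrite subrr normr0 mulr_ge0 ?powR_ge0 // ltW.
move=> [Xr _]; apply: omr => s t s0 st tT; apply: cvgB; first exact: cvg_cst.
by apply: Xr; rewrite s0 (lt_le_trans st).
Qed.

Lemma rough_control (p T B : R) X XX :
  0 < p -> 0 <= T -> 0 < B -> (pvar p T X <= B%:E)%E -> (var2 (p / 2) 0 T XX <= B%:E)%E ->
  (forall s, 0 <= s <= T -> XX s s = 0) ->
  exists om, [/\ control T om, om 0 T <= 2,
    forall s t, 0 <= s -> s <= t -> t <= T -> `|X t - X s| <= B * om s t `^ p^-1,
    forall s t, 0 <= s -> s <= t -> t <= T -> `|XX s t| <= B * (om s t `^ p^-1) ^+ 2 &
    cadlag 0 T X -> cadlag2 T XX -> right_small T om].
Proof.
move=> p0 T0 B0 XB XXB XX0.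
have [om1 [c1 t1 b1 r1]] := path_control p0 T0 B0 XB.
have [om2 [c2 t2 b2 r2]] := two_parameter_control p0 T0 B0 XXB XX0.
exists (fun s t => om1 s t + om2 s t); split.
- exact: controlD.
- by lra.
- move=> s t s0 st tT; apply: le_trans (b1 s t s0 st tT) _.
  by rewrite ler_pM2l // root_mono ?lerDl ?c1.1 ?c2.1.
- move=> s t s0 st tT; apply: le_trans (b2 s t s0 st tT) _.
  by rewrite ler_pM2l // lerXn2r ?nnegrE ?powR_ge0 // root_mono ?lerDr ?c1.1 ?c2.1.
- move=> Xc [XXc _]; apply: right_smallD => //; first exact: r1.
  apply: r2 => s t s0 st tT; have t0 := le_trans s0 (ltW st).
  by apply: (XXc t _).1; rewrite ?s0 ?t0.
Qed.

Lemma rough_path_diag (p T : R) X XX s : rough_path p T X XX -> 0 <= s <= T -> XX s s = 0.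
Proof.
move=> [_ _ ch] /andP[s0 sT]; have := ch s s s s0 (lexx s) (lexx s) sT.
rewrite /tensor /incr subrr trmx0 mul0mx addr0 => /eqP.
by rewrite -[X in X == _]addr0 => /eqP/addrI <-.
Qed.

Lemma rough_norm_ge0 (p T : R) X XX : (0 <= rough_norm p T X XX)%E.
Proof. by apply: adde_ge0; exact: poweR_ge0. Qed.

Lemma rough_path_norm (p T : R) X XX : rough_path p T X XX ->
  rough_norm p T X XX \is a fin_num.
Proof.
move=> [[_ X1] [_ X2] _]; rewrite ge0_fin_numE; last exact: rough_norm_ge0.
by rewrite /rough_norm lte_add_pinfty.
Qed.

Lemma rough_norm_bound (p T B : R) X XX : (rough_norm p T X XX <= B%:E)%E ->
  (pvar p T X <= B%:E)%E /\ (var2 (p / 2) 0 T XX <= B%:E)%E.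
Proof.
by move=> H; split; apply: le_trans H; rewrite /rough_norm ?leeDl ?leeDr //; exact: poweR_ge0.
Qed.

Lemma rough_path_driver (p T B : R) X XX : 0 < p -> 0 <= T -> 0 < B ->
  rough_path p T X XX -> (rough_norm p T X XX <= B%:E)%E ->
  exists om, rough_driver tensor p B 2 T om X XX /\ right_small T om.
Proof.
move=> p0 T0 B0 rp /rough_norm_bound[XB XXB].
have [om [c t b1 b2 r]] := rough_control p0 T0 B0 XB XXB (fun s h => rough_path_diag rp h).
have [[Xc _] [XXc _] ch] := rp.
exists om; split; last exact: r.
by split=> // s u t' s0 su ut tT; exact: ch.
Qed.

End Drivers.

Lemma eq_partition_sum {R : realType} (V : normedModType R) a b (Xi Xj : R -> R -> V) P :
  itv_partition a b P -> (forall u v, a <= u -> u < v -> v <= b -> Xi u v = Xj u v) ->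
  partition_sum a b Xi P = partition_sum a b Xj P.
Proof.
move=> iP H; apply/eqP; rewrite -subr_eq0 -partition_sumB -normr_le0.
have := @norm_partition_sum R V a b (fun u v => Xi u v - Xj u v) (fun _ _ => 0) P iP.
rewrite {2}/partition_sum big1 //; apply=> u v au uv vb.
by rewrite H // subrr normr0.
Qed.

Lemma ball_compact {R : realType} k (y0 : 'rV[R]_k) B : compact [set y | `|y - y0| <= B].
Proof.
apply: bounded_closed_compact.
  exists (B + `|y0|); split; first exact: num_real.
  move=> M BM y /= yB; apply: le_trans (ltW BM).
  by rewrite -[y in leLHS](subrK y0); apply: le_trans (ler_normD _ _) _; rewrite lerD2r.
pose g (y : 'rV[R]_k) : R^o := `|y - y0|.
have gc : continuous g.
  apply: (@lipschitz_bound_continuous R _ _ g 1) => y z; rewrite mul1r.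
  by apply: le_trans (ler_dist_dist _ _) _; rewrite opprB addrA subrK.
by move/continuous_closedP: gc => /(_ [set x | x <= B]); apply; exact: closed_le.
Qed.

(** * Rough integrals and negligible defects *)

Section Solutions.
Context {R : realType} {d k : nat}.
Implicit Types (X : R -> 'rV[R]_d) (XX : R -> R -> 'M[R]_d) (Y : R -> 'rV[R]_k).
Implicit Types (f : 'rV[R]_k -> 'M[R]_(d, k)).

(** With [DY = f (Y)] the compensated summand is an Euler step. So the Riemann sums converge to the
    increment of [Y] exactly when the sums of defects tend to 0. *)
Lemma partition_sum_defect f X XX Y (DY : R -> 'M[R]_(d, k)) a b P : itv_partition a b P ->
  (forall t, a <= t <= b -> DY t = f (Y t)) ->
  partition_sum a b (defect X XX (field_of f) Y) P =
  Y b - Y a - partition_sum a b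
    (compensated X XX (fun r => f (Y r)) (fun r => DY r *m Dmx f (Y r))) P.
Proof.
move=> iP DYf; rewrite -[Y b - Y a]/(incr Y a b) -(partition_sum_incr Y iP) -partition_sumB.
apply: eq_partition_sum iP _ => u v au uv vb.
by rewrite /compensated DYf // au (le_trans (ltW uv)).
Qed.

Lemma RDE_solution_negligible p T f y0 X XX Y DY : 0 <= T ->
  RDE_solution p T f y0 X XX Y DY ->
  Y 0 = y0 /\ negligible T (defect X XX (field_of f) Y).
Proof.
move=> T0 [_ DYf HI].
(* The only partition of [0, 0] is empty, so the integral in the equation at time 0 is 0. *)
have Y0 : Y 0 = y0.
  have [|I [cI ->]] := HI 0; first by rewrite lexx.
  have PF := mesh_filter_proper (lexx (0 : R)).
  suff -> : I = 0 by rewrite addr0.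
  apply: (cvg_unique (@norm_hausdorff _ _) cI); apply: cvg_near_cst.
  exists 1 => //= P [iP _].
  by have -> := itv_partitionxx iP; rewrite partition_sum_nil.
split=> //; apply: negligible_from0 => // t /andP[t0 tT].
have [|I [cI YI]] := HI t; first by rewrite t0.
have -> : (0 : 'rV[R]_k) = I - I by rewrite subrr.
have PF := mesh_filter_proper t0.
apply: (@cvg_trans _ (((fun P => I - partition_sum 0 t
    (compensated X XX (fun r => f (Y r)) (fun r => DY r *m Dmx f (Y r))) P)) @ mesh_filter 0 t)).
  apply: near_eq_cvg; exists 1 => //= P [iP _].
  rewrite (@partition_sum_defect _ _ _ _ DY _ _ _ iP) => [|s /andP[s0 st]]; last first.
    by rewrite DYf // s0 (le_trans st).
  by rewrite YI Y0 (addrC y0) addrK.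
by apply: cvgB; [exact: cvg_cst|exact: cI].
Qed.

Lemma negligible_integral T f X XX Y t : 0 <= t <= T ->
  negligible T (defect X XX (field_of f) Y) ->
  rough_integral_cvg X XX (fun r => f (Y r)) (fun r => f (Y r) *m Dmx f (Y r)) 0 t (Y t - Y 0).
Proof.
move=> /andP[t0 tT] Jn; have PF := mesh_filter_proper t0.
apply/cvgrPdist_le => e e0; have [dl dl0 H] := Jn e e0.
exists dl => //= P [iP mP].
rewrite -(@partition_sum_defect _ _ _ _ (fun r => f (Y r)) _ _ _ iP) //.
exact: H.
Qed.

Lemma Cbnorm_lipschitz f M x y : 0 <= M -> Cb 3 f -> (Cbnorm 2 f <= M%:E)%E ->
  `|f x - f y| <= (k%:R * M + M + 1) * `|x - y|.
Proof.
move=> M0 [_ _ [df _]] fM; have f1 := le_trans (Cbnorm_deriv 1 f) fM.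
have b z : `|f z| <= M by rewrite -lee_fin; apply: le_trans fM; exact: Cbnorm_val.
have b1 z : `|Dmx f z| <= M by rewrite -lee_fin; apply: le_trans f1; exact: Cbnorm_val.
have b0 z : `|f z - f z| <= `|x - y| by rewrite subrr normr0.
by have [_ _] := close_field M0 df b b b1 b0 (lexx _); rewrite mulr1.
Qed.

(** All regularity is read off one control. In either variable the remainder has increments of order
    [w]: moving its base point adds a product of an increment of [X] and one of [f (Y)]. *)
Lemma controlled_of_control p T M C D om f X Y : 1 <= p -> 0 < T -> 0 <= M -> 0 <= C -> 0 <= D ->
  control T om -> om 0 T <= D -> right_small T om -> Cb 3 f -> (Cbnorm 2 f <= M%:E)%E ->
  (forall s t, 0 <= s -> s <= t -> t <= T -> `|X t - X s| <= C * om s t `^ p^-1) ->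
  (forall s t, 0 <= s -> s <= t -> t <= T -> `|Y t - Y s| <= C * om s t `^ p^-1) ->
  (forall s t, 0 <= s -> s <= t -> t <= T ->
    `|Y t - Y s - field1 f (Y s) (X t - X s)| <= C * (om s t `^ p^-1) ^+ 2) ->
  controlled p T X Y (fun t => f (Y t)) /\
  (controlled_norm p T X Y (fun t => f (Y t)) <=
    (M + (k%:R * M + M + 1) * C * D `^ p^-1 + C * D `^ (p / 2)^-1)%:E)%E.
Proof.
move=> p1 /ltW T0 M0 C0 D0 omc omD omr Cf fM HX HY HR; have p0 := lt_le_trans ltr01 p1.
have p20 : 0 < p / 2 by rewrite divr_gt0.
set L := k%:R * M + M + 1; have L0 : 0 <= L by rewrite !addr_ge0 // mulr_ge0.
have LC0 : 0 <= L * C by rewrite mulr_ge0.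
have fb z : `|f z| <= M by rewrite -lee_fin; apply: le_trans fM; exact: Cbnorm_val.
have HfY s t : 0 <= s -> s <= t -> t <= T -> `|f (Y t) - f (Y s)| <= L * C * om s t `^ p^-1.
  move=> s0 st tT; apply: le_trans (Cbnorm_lipschitz _ _ M0 Cf fM) _.
  by rewrite -mulrA ler_wpM2l // HY.
have vY := var2_le_control p0 T0 omc omD C0 (fun s t s0 st => HY s t s0 (ltW st)).
have vfY := var2_le_control p0 T0 omc omD LC0 (fun s t s0 st => HfY s t s0 (ltW st)).
have vR : (var2 (p / 2) 0 T (remainder X Y (fun t => f (Y t))) <= (C * D `^ (p / 2)^-1)%:E)%E.
  apply: (var2_le_control p20 T0 omc omD C0) => s t s0 st tT.
  by rewrite powR_half ?HR // ?(ltW st) // omc.1 // ltW.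
split; last first.
  rewrite /controlled_norm !EFinD; apply: leeD vR; apply: leeD; first by rewrite lee_fin.
  exact: vfY.
have cY := cadlag_of_control p0 omc omr (@ball_compact R k) (lexx 0) (lexx T) C0 HY.
split.
- by split=> //; apply: le_lt_trans vY _; exact: ltry.
- split; last by apply: le_lt_trans vfY _; exact: ltry.
  split=> t tT; last first.
    have /cvg_ex[l Yl] := cY.2 t tT; apply/cvg_ex; exists (f l).
    by apply: (cvg_comp _ _ Yl); have [cf _ _] := Cf; exact: cf.
  by apply: (cvg_comp _ _ (cY.1 t tT)); have [cf _ _] := Cf; exact: cf.
split; last by apply: le_lt_trans vR _; exact: ltry.
pose W := D `^ p^-1; have W0 : 0 <= W by exact: powR_ge0.
have wW s t : 0 <= s -> s <= t -> t <= T -> om s t `^ p^-1 <= W.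
  move=> s0 st tT; have os := omc.1 _ _ s0 st tT.
  apply: ge0_ler_powR; rewrite ?nnegrE ?invr_ge0 ?(ltW p0) //.
  by apply: le_trans omD; exact: (control_le omc).
pose C1 := C + d%:R * C * M; pose C2 := d%:R * (C * W) * (L * C).
have C10 : 0 <= C1 by rewrite addr_ge0 // !mulr_ge0.
have C20 : 0 <= C2 by rewrite !mulr_ge0.
have B1 s u v : 0 <= u -> u <= v -> v <= T ->
    `|Y v - Y u| + `|(X v - X u) *m f (Y s)| <= C1 * om u v `^ p^-1.
  move=> u0 uv vT; have w0 := powR_ge0 (om u v) p^-1.
  rewrite mulrDl lerD ?HY //; apply: le_trans (norm_mulmx _ _) _.
  rewrite -!mulrA [C * (M * _)]mulrCA [M * (C * _)]mulrC !mulrA ler_pM ?mulr_ge0 //.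
  by rewrite -mulrA ler_wpM2l // HX.
split=> t /andP[t0 tT].
- apply: (cadlag_of_control p0 omc omr (@ball_compact R k) (lexx 0) tT (addr_ge0 C10 C20)).
  move=> u v u0 uv vt; have vT := le_trans vt tT; have v0 := le_trans u0 uv.
  have -> : remainder X Y (fun r => f (Y r)) v t - remainder X Y (fun r => f (Y r)) u t =
      - (Y v - Y u - (X v - X u) *m f (Y u)) - (X t - X v) *m (f (Y v) - f (Y u)).
    rewrite /remainder /incr mulmxBr !mulmxBl.
    move: (X t *m f (Y v)) (X v *m f (Y v)) (X t *m f (Y u)) (X u *m f (Y u)) (X v *m f (Y u)).
    move=> a1 a2 a3 a4 a5; zmodule.
  apply: le_trans (ler_normB _ _) _; rewrite normrN mulrDl; apply: lerD.
    by apply: le_trans (ler_normB _ _) _; exact: B1.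
  apply: le_trans (norm_mulmx _ _) _; rewrite /C2 -[leRHS]mulrA; apply: ler_pM => //.
    rewrite ler_wpM2l //; apply: le_trans (HX v t v0 vt tT) _.
    by rewrite ler_wpM2l // wW.
  exact: HfY.
- apply: (cadlag_of_control p0 omc omr (@ball_compact R k) t0 (lexx T) C10).
  move=> u v tu uv vT; have u0 := le_trans t0 tu.
  have -> : remainder X Y (fun r => f (Y r)) t v - remainder X Y (fun r => f (Y r)) t u =
      Y v - Y u - (X v - X u) *m f (Y t).
    rewrite /remainder /incr !mulmxBl.
    move: (X u *m f (Y t)) (X v *m f (Y t)) (X t *m f (Y t)) => a1 a2 a3; zmodule.
  by apply: le_trans (ler_normB _ _) _; exact: B1.
Qed.

Lemma RDE_existence (p M B : R) : 2 < p < 3 -> 0 <= M -> 0 < B -> exists2 C : R, 0 <= C &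
  forall T y0 X XX f, 0 < T -> rough_path p T X XX -> Cb 3 f ->
  (Cbnorm 2 f <= M%:E)%E -> (rough_norm p T X XX <= B%:E)%E ->
  exists2 Y, RDE_solution p T f y0 X XX Y (fun t => f (Y t)) &
    (controlled_norm p T X Y (fun t => f (Y t)) <= C%:E)%E.
Proof.
move=> /andP[p2 p3] M0 B0; have p1 : 1 <= p by lra.
have p0 := lt_le_trans ltr01 p1; have p03 : 0 < p < 3 by rewrite p0.
have [S S0 /(_ p)] := sewing_constant p03; rewrite p0 lexx => /(_ isT) Sp.
have [phi phi0 Hphi] := @field_compatible R d k M M0.
have K0 : 0 <= 2 :> R by [].
have [C1 C10 HC] := existence (@tensor R d) p1 p3 (ltW B0) K0 (ltW S0) phi0 Sp (@ball_compact R k).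
(* [C1] serves [Y], [B] serves [X], and the last summand the remainder, which is the defect, with
   one power [w <= 1 + 2] absorbed, plus the second-order term. *)
pose C := C1 + B + (C1 * 3 + phi B).
have P0 := phi0 _ (ltW B0).
have C0 : 0 <= C by rewrite !addr_ge0 ?mulr_ge0 // ltW.
exists (M + (k%:R * M + M + 1) * C * 2 `^ p^-1 + C * 2 `^ (p / 2)^-1).
  by rewrite !addr_ge0 // !mulr_ge0 ?powR_ge0 // !addr_ge0 // mulr_ge0.
move=> T y0 X XX f T0 rp Cf fM XB; have T0' := ltW T0.
have [om [rd omr]] := rough_path_driver p0 T0' B0 rp XB.
have F2 := Cb3_C2_field Cf.
have FF := Hphi 0 f f (lexx 0) F2 F2 (Cb3_pair_refl fM).
have [Y [Y0 Jn HY]] := HC T om (field_of f) X XX y0 T0' rd omr FF (field_of_euler0 f)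
  (fun x A => @field_of_continuous R k d f x A Cf).
have CB : C1 <= C /\ B <= C.
  split; rewrite /C -addrA; first by rewrite lerDl !addr_ge0 ?mulr_ge0 // ltW.
  by rewrite addrCA lerDl !addr_ge0 ?mulr_ge0.
have [||| cY nY] := @controlled_of_control p T M C 2 om f X Y p1 T0 M0 C0 K0
    (rd_control rd) (rd_total rd) omr Cf fM.
  - move=> s t s0 st tT; apply: le_trans (rd_X rd s0 st tT) _.
    by rewrite ler_wpM2r ?powR_ge0 ?CB.2.
  - move=> s t s0 st tT; apply: le_trans (HY s t s0 st tT).2 _.
    by rewrite ler_wpM2r ?powR_ge0 ?CB.1.
  move=> s t s0 st tT; have w0 := powR_ge0 (om s t) p^-1.
  have w3 := rd_w_bound p1 rd s0 st tT.
  have -> : Y t - Y s - field1 f (Y s) (X t - X s) =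
      defect X XX (field_of f) Y s t + field2 f (Y s) (XX s t).
    rewrite /defect /euler /=.
    by move: (field1 _ _ _) (field2 _ _ _) => a b; zmodule.
  have [_ _ H2 _] := FF _ (ltW B0).
  have cXX : close B 0 ((om s t `^ p^-1) ^+ 2) (XX s t) (XX s t).
    by apply: close_refl; exact: (rd_XX rd s0 st tT).
  have z0 : `|Y s - Y s| <= 0 by rewrite subrr normr0.
  have [h2 _ _] := H2 (Y s) (Y s) _ _ _ (exprn_ge0 2 w0) z0 cXX.
  apply: le_trans (ler_normD _ _) _; rewrite /C mulrDl -[leLHS]add0r lerD //.
    by rewrite mulr_ge0 ?exprn_ge0 // addr_ge0 // ltW.
  rewrite mulrDl lerD //.
  apply: le_trans (HY s t s0 st tT).1 _.
  rewrite [leRHS]mulrAC exprSr mulrA ler_wpM2l ?mulr_ge0 ?exprn_ge0 //.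
exists Y => //; split=> // t tT; exists (Y t - Y 0); split; last by rewrite Y0 addrC subrK.
exact: negligible_integral tT Jn.
Qed.

End Solutions.

(** * Stability of rough differential equations *)

Section Stability.
Context {R : realType} {d k : nat}.

Lemma solution_remainder_bound p T K f y0 X XX (Y : R -> 'rV[R]_k) (DY : R -> 'M[R]_(d, k)) :
  0 < p -> 0 <= T -> 0 < K -> RDE_solution p T f y0 X XX Y DY ->
  (controlled_norm p T X Y DY <= K%:E)%E ->
  exists om, [/\ control T om, om 0 T <= 1 &
    forall s t, 0 <= s -> s <= t -> t <= T ->
      `|Y t - Y s - field1 f (Y s) (X t - X s)| <= K * (om s t `^ p^-1) ^+ 2].
Proof.
move=> p0 T0 K0 [_ DYf _] YK.
have RK : (var2 (p / 2) 0 T (remainder X Y DY) <= K%:E)%E.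
  by apply: le_trans YK; rewrite leeDr // adde_ge0 // poweR_ge0.
have [|om [omc om1 omR _]] := two_parameter_control p0 T0 K0 RK.
  by move=> s _; rewrite /remainder /incr (subrr (Y s)) (subrr (X s)) mul0mx subrr.
exists om; split=> // s t s0 st tT; have := omR s t s0 st tT.
by rewrite /remainder DYf // s0 (le_trans st).
Qed.

(** [ep] is any positive bound on the distance of the data, so that equal data are reached by
    letting [ep] tend to 0. [C] is chosen before [p] and serves all exponents in (2, q]. *)
Lemma RDE_stability (q B : R) : 0 < q < 3 -> 1 <= B -> exists2 C : R, 0 <= C &
  forall p T ep y0 y0' (f f' : 'rV[R]_k -> 'M[R]_(d, k)) X1 X2 XX1 XX2 Y1 Y2 Y1' Y2',
  2 < p -> p <= q -> 0 < T -> 0 < ep -> Cb 3 f -> Cb 3 f' ->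
  (Cbnorm 3 f <= B%:E)%E -> (Cbnorm 3 f' <= B%:E)%E ->
  rough_path p T X1 XX1 -> rough_path p T X2 XX2 ->
  (rough_norm p T X1 XX1 <= B%:E)%E -> (rough_norm p T X2 XX2 <= B%:E)%E ->
  RDE_solution p T f y0 X1 XX1 Y1 Y1' -> RDE_solution p T f' y0' X2 XX2 Y2 Y2' ->
  (controlled_norm p T X1 Y1 Y1' <= B%:E)%E -> (controlled_norm p T X2 Y2 Y2' <= B%:E)%E ->
  `|y0 - y0'| <= ep -> (Cbnorm 2 (fun x => (f x - f' x)%R) <= ep%:E)%E ->
  (rough_dist p T X1 XX1 X2 XX2 <= ep%:E)%E ->
  (forall t, 0 <= t <= T -> `|Y1 t - Y2 t| <= C * ep) /\
  (`|Y1 0 - Y2 0|%:E + controlled_dist p T X1 Y1 Y1' X2 Y2 Y2' <= (C * ep)%:E)%E.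
Proof.
move=> q03 B1; have B0 : 0 < B by exact: lt_le_trans B1.
have B0' := ltW B0; pose c := k%:R * B + B + 1.
have c0 : 0 <= c by rewrite !addr_ge0 // mulr_ge0.
have q3 : q < 3 by case/andP: q03.
have [S S0 HS] := sewing_constant q03.
have [phi phi0 Hphi] := @field_compatible R d k c c0.
have K0 : 0 <= 8 :> R by [].
have [C0 C00 HC] := pair_stability (@tensor R d) (V := 'rV[R]_k) B0' K0 (ltW S0) phi0.
have [N' N'0 HN'] := @pair_fields_close R d k c C0 c0 C00.
(* The summands serve, in this order, the values, the initial values, the initial derivatives, the
   variation of the derivatives, and the remainders; [9 = 1 + 8] bounds the roots of the total
   control 8. *)
exists (C0 + (1 + (c * (C0 + 1) + N' * (C0 + 1) * 9 + C0 * 9))).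
  by rewrite !addr_ge0 // !mulr_ge0 // addr_ge0.
move=> p T ep y0 y0' f f' X1 X2 XX1 XX2 Y1 Y2 Y1' Y2'.
move=> p2 pq T0 ep0 Cf Cf' fB fB' rp1 rp2 n1 n2 s1 s2 k1 k2 yy ff dd.
have p1 : 1 <= p by lra.
have p0 : 0 < p by lra.
have T0' := ltW T0; have ep0' := ltW ep0.
have [omA [cA tA bXA bXXA _]] := rough_control p0 T0' B0 (rough_norm_bound n1).1
  (rough_norm_bound n1).2 (fun s h => rough_path_diag rp1 h).
have [omB [cB tB bXB bXXB _]] := rough_control p0 T0' B0 (rough_norm_bound n2).1
  (rough_norm_bound n2).2 (fun s h => rough_path_diag rp2 h).
have dXX0 s : 0 <= s <= T -> XX1 s s - XX2 s s = 0.
  by move=> h; rewrite (rough_path_diag rp1 h) (rough_path_diag rp2 h) subrr.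
have [omD [cD tD bXD bXXD _]] := rough_control p0 T0' ep0 (rough_norm_bound dd).1
  (rough_norm_bound dd).2 dXX0.
have [omE [cE tE bE]] := solution_remainder_bound p0 T0' B0 s1 k1.
have [omF [cF tF bF]] := solution_remainder_bound p0 T0' B0 s2 k2.
(* The controls of the two drivers, of their difference and of the two remainders have totals 2, 2,
   2, 1 and 1 at most, hence 8. [omD] is normalised by [ep], so the difference of the drivers is at
   most [ep] times the root that bounds the drivers up to [B]. *)
pose om s t := omA s t + omB s t + (omD s t + (omE s t + omF s t)).
have omc : control T om by do ?apply: controlD.
have omT : om 0 T <= 8.
  by rewrite /om; move: tA tB tD tE tF; clear; lra.
have [lA lB lD lE lF] : [/\ forall s t, 0 <= s -> s <= t -> t <= T -> omA s t <= om s t,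
    forall s t, 0 <= s -> s <= t -> t <= T -> omB s t <= om s t,
    forall s t, 0 <= s -> s <= t -> t <= T -> omD s t <= om s t,
    forall s t, 0 <= s -> s <= t -> t <= T -> omE s t <= om s t &
    forall s t, 0 <= s -> s <= t -> t <= T -> omF s t <= om s t].
  by split=> s t s0 st tT; have := cA.1 s t s0 st tT; have := cB.1 s t s0 st tT;
    have := cD.1 s t s0 st tT; have := cE.1 s t s0 st tT; have := cF.1 s t s0 st tT;
    rewrite /om; clear; lra.
have rd1 : rough_driver tensor p B 8 T om X1 XX1.
  split=> //; last by move=> s u t s0 su ut tT; have [_ _ ch] := rp1; exact: ch.
    exact: (@control_widen R _ p T B 1 omA om (fun s t => X1 t - X1 s) p0 B0' cA lA bXA).
  exact: (control_widen p0 B0' cA lA bXXA).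
have rd2 : rough_driver tensor p B 8 T om X2 XX2.
  split=> //; last by move=> s u t s0 su ut tT; have [_ _ ch] := rp2; exact: ch.
    exact: (@control_widen R _ p T B 1 omB om (fun s t => X2 t - X2 s) p0 B0' cB lB bXB).
  exact: (control_widen p0 B0' cB lB bXXB).
have F2 := Cb3_C2_field Cf; have F2' := Cb3_C2_field Cf'.
have pb e : ep <= e -> pair_bound c e f f'.
  move=> epe; have ff' : (Cbnorm 2 (fun x => (f x - f' x)%R) <= e%:E)%E.
    by apply: le_trans ff _; rewrite lee_fin.
  exact: Cb3_pair_bound B0' Cf Cf' fB fB' ff'.
have self (g : 'rV[R]_k -> 'M[R]_(d, k)) : Cb 3 g -> (Cbnorm 3 g <= B%:E)%E -> compatible phi 0 (field_of g) (field_of g).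
  move=> Cg gB; have g2 := Cb3_C2_field Cg.
  have gg : (Cbnorm 2 (fun x => (g x - g x)%R) <= 0%:E)%E by rewrite Cbnorm_subrr.
  exact: (Hphi 0 g g (lexx 0) g2 g2 (Cb3_pair_bound B0' Cg Cg gB gB gg)).
have [Y10 J1] := RDE_solution_negligible T0' s1.
have [Y20 J2] := RDE_solution_negligible T0' s2.
have bX1 := rd_X rd1; have bX2 := rd_X rd2; have bXX1 := rd_XX rd1; have bXX2 := rd_XX rd2.
have sp : stable_pair B 8 S phi p ep T om (field_of f) (field_of f') X1 X2 XX1 XX2 Y1 Y2.
  split=> //.
  - by apply: le_trans pq _; exact: ltW.
  - by apply: HS; rewrite p0.
  - move=> s t s0 st tT; split; [exact: bX1|exact: bX2|].
    have := @control_widen R _ p T ep 1 omD om _ p0 ep0' cD lD bXD s t s0 st tT.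
    have -> : X1 t - X2 t - (X1 s - X2 s) = X1 t - X1 s - (X2 t - X2 s) by zmodule.
    by move/le_trans; apply; rewrite ler_wpM2r ?powR_ge0 // ler_peMl.
  - move=> s t s0 st tT; split; [exact: bXX1|exact: bXX2|].
    apply: le_trans (control_widen p0 ep0' cD lD bXXD s0 st tT) _.
    by rewrite ler_wpM2r ?exprn_ge0 ?powR_ge0 // ler_peMl.
  - exact: self.
  - exact: self.
  - by move=> e epe; exact: (Hphi e f f' (le_trans ep0' epe) F2 F2' (pb _ epe)).
  - exact: field_of_euler0.
  - exact: field_of_euler0.
  - exact: (control_widen p0 B0' cE lE bE).
  - exact: (control_widen p0 B0' cF lF bF).
have Y00 : `|Y1 0 - Y2 0| <= ep by rewrite Y10 Y20.
have H := HC p ep T om _ _ _ _ _ _ _ _ sp Y00.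
have [_ D1 _] := s1; have [_ D2 _] := s2.
pose e := (C0 + 1) * ep.
have e0 : 0 <= e by rewrite mulr_ge0 // addr_ge0.
have epe : ep <= e by rewrite ler_peMl // lerDr.
have Ce : C0 * ep <= e by rewrite ler_wpM2r // lerDl.
have HY t : 0 <= t <= T -> `|Y1 t - Y2 t| <= e.
  by move=> /andP[t0 tT]; have [h _ _] := H 0 t (lexx 0) t0 tT; exact: le_trans Ce.
have root9 r : 1 <= r -> 8 `^ r^-1 <= 9 :> R.
  by move=> r1; apply: le_trans (root_le r1 _ (lexx 8)) _ => //; rewrite -(natrD _ 1 8).
have A0 : 0 <= N' * e by rewrite mulr_ge0.
have Cep0 : 0 <= C0 * ep by rewrite mulr_ge0.
have vD : (pvar p T (fun t => (Y1' t - Y2' t)%R) <= (N' * e * 8 `^ p^-1)%:E)%E.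
  apply: (var2_le_control p0 T0' omc omT A0) => s t s0 /ltW st tT.
  have t0 := le_trans s0 st; have sT := le_trans st tT.
  have st' : 0 <= s <= T by rewrite s0.
  have tt' : 0 <= t <= T by rewrite t0.
  rewrite /incr !D1 ?D2 //.
  have [_ h _] := H s t s0 st tT.
  have w0 := powR_ge0 (om s t) p^-1.
  have h' : close C0 e (om s t `^ p^-1) (Y1 t - Y1 s) (Y2 t - Y2 s).
    exact: closeW C00 Cep0 w0 (lexx _) Ce h.
  have [_ _ _ [_ _ hf] _ _] := HN' e (om s t `^ p^-1) f f' _ _ _ _ e0 w0 F2 F2' (pb e epe)
    (HY s st') (HY t tt') h'.
  by have -> : f (Y1 t) - f' (Y2 t) - (f (Y1 s) - f' (Y2 s)) =
      f (Y1 t) - f (Y1 s) - (f' (Y2 t) - f' (Y2 s)) by zmodule.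
have vR : (var2 (p / 2) 0 T
    (fun s t => (remainder X1 Y1 Y1' s t - remainder X2 Y2 Y2' s t)%R) <=
    (C0 * ep * 8 `^ (p / 2)^-1)%:E)%E.
  have p20 : 0 < p / 2 by rewrite divr_gt0.
  apply: (var2_le_control p20 T0' omc omT Cep0) => s t s0 /ltW st tT.
  have [_ _ h] := H s t s0 st tT.
  have st' : 0 <= s <= T by rewrite s0 (le_trans st).
  by rewrite powR_half ?omc.1 // /remainder D1 ?D2.
split=> [t tT|].
  have /andP[t0 t1] := tT; have [h _ _] := H 0 t (lexx 0) t0 t1.
  by apply: le_trans h _; rewrite ler_wpM2r // lerDl !addr_ge0 // !mulr_ge0 // addr_ge0.
have T00 : 0 <= (0 : R) <= T by rewrite lexx.
have DY0 : `|Y1' 0 - Y2' 0| <= c * e.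
  rewrite D1 ?D2 //; have [[_ _ h] _ _] := pb e epe _ _ (HY 0 T00).
  by rewrite mulr1 in h.
apply: (@le_trans _ _ (ep + (c * e + N' * e * 9 + C0 * ep * 9))%:E); last first.
  rewrite lee_fin /e; apply: (@le_trans _ _ ((1 + (c * (C0 + 1) + N' * (C0 + 1) * 9 + C0 * 9)) * ep)).
    by rewrite [leRHS](_ : _ = ep + (c * ((C0 + 1) * ep) + N' * ((C0 + 1) * ep) * 9 + C0 * ep * 9)) //; ring.
  by rewrite ler_wpM2r // lerDr.
rewrite EFinD; apply: leeD; first by rewrite lee_fin.
rewrite /controlled_dist !EFinD; apply: leeD; first apply: leeD.
- by rewrite lee_fin.
- by apply: le_trans vD _; rewrite lee_fin ler_wpM2l // root9.
- apply: le_trans vR _; rewrite lee_fin ler_wpM2l // root9 //.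
  by move: p2; clear; lra.
Qed.

End Stability.

(** * Dependence of the constants on the parameters *)

Section Constants.
Context {R : realType}.

Definition majorant (c : nat -> R) (x : R) : R := \sum_(i < (Num.truncn x).+1) c i.

Variable c : nat -> R.
Hypothesis c0 : forall n, 0 <= c n.

Lemma majorant_ge0 x : 0 <= majorant c x.
Proof. exact: sumr_ge0. Qed.

Lemma majorant_ge x : c (Num.truncn x) <= majorant c x.
Proof. by rewrite /majorant big_ord_recr /= lerDr sumr_ge0. Qed.

Lemma majorant_mono x y : x <= y -> majorant c x <= majorant c y.
Proof.
move=> /Num.Theory.le_truncn xy; rewrite /majorant.
rewrite (big_ord_widen _ c (leq_ltn_trans xy (ltnSn _))) big_mkcond.
by apply: ler_sum => i _; case: ifP.
Qed.

(** [majorant] jumps at integers, but near [z] monotonicity bounds it by its value at [h z + 1]. *)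
Lemma majorant_locally_bounded (U : topologicalType) (A : set U) (h : U -> R) :
  (forall z, A z -> {for z, continuous h}) ->
  [locally [bounded (majorant c (h z) + 1) | z in A]].
Proof.
move=> hc z Az; exists (majorant c (h z + 1) + 1); split; first exact: num_real.
move=> M BM; rewrite /= /within /=.
have hz1 : h z < h z + 1 by rewrite ltrDl.
have := @cvgr_lt _ _ _ _ _ _ (hc z Az) _ hz1.
move=> /(_ _); apply: filterS => z' hz' _; rewrite ger0_norm ?addr_ge0 ?majorant_ge0 //.
by apply: le_trans (ltW BM); rewrite lerD2r majorant_mono // ltW.
Qed.

End Constants.

(** The sewing constant blows up as p tends to 3, hence the reciprocal; the stability constant is
    uniform down to p = 2. *)
Definition parameter_size {R : realType} (z : R * R * R * R * R) : R :=
  (3 - z.1.1.1.1)^-1 + `|z.1.1.1.2| + `|z.1.1.2| + `|z.1.2| + `|z.2|.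

Lemma parameter_size_continuous {R : realType} (z : R * R * R * R * R) : z.1.1.1.1 < 3 ->
  {for z, continuous parameter_size}.
Proof.
move=> p3.
have c1 : z'.1 @[z' --> z] --> z.1 by exact: cvg_fst.
have c2 : z'.1.1 @[z' --> z] --> z.1.1 by apply: (cvg_comp _ _ c1); exact: cvg_fst.
have c3 : z'.1.1.1 @[z' --> z] --> z.1.1.1 by apply: (cvg_comp _ _ c2); exact: cvg_fst.
have c4 : z'.1.1.1.1 @[z' --> z] --> z.1.1.1.1 by apply: (cvg_comp _ _ c3); exact: cvg_fst.
have n1 : `|z'.2| @[z' --> z] --> `|z.2| by apply: cvg_norm; exact: cvg_snd.
have n2 : `|z'.1.2| @[z' --> z] --> `|z.1.2| by apply: cvg_norm; apply: (cvg_comp _ _ c1); exact: cvg_snd.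
have n3 : `|z'.1.1.2| @[z' --> z] --> `|z.1.1.2| by apply: cvg_norm; apply: (cvg_comp _ _ c2); exact: cvg_snd.
have n4 : `|z'.1.1.1.2| @[z' --> z] --> `|z.1.1.1.2|.
  by apply: cvg_norm; apply: (cvg_comp _ _ c3); exact: cvg_snd.
apply: cvgD n1; apply: cvgD n2; apply: cvgD n3; apply: cvgD n4.
apply: cvgV; first by rewrite subr_eq0 gt_eqF.
by apply: cvgB => //; exact: cvg_cst.
Qed.

Lemma var2_0 {R : realType} (V : normedModType R) (q T : R) (Xi : R -> R -> V) :
  0 < q -> 0 <= T -> (forall s t, 0 <= s -> s < t -> t <= T -> Xi s t = 0) ->
  (var2 q 0 T Xi <= 0)%E.
Proof.
move=> q0 T0 Xi0; have om0 : control T (fun _ _ : R => 0 : R) by split=> *; rewrite ?addr0.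
have := @var2_le_control R V q T Xi q0 T0 0 0 _ om0 (lexx 0) (lexx 0).
by rewrite mul0r; apply=> s t s0 st tT; rewrite Xi0 // normr0.
Qed.

Lemma common_bound {R : realType} (a b c e : R) :
  exists B, [/\ 1 <= B, a <= B, b <= B, c <= B & e <= B].
Proof.
exists (Num.max 1 (Num.max a (Num.max b (Num.max c e)))).
by split; rewrite !le_max lexx ?orbT.
Qed.

Section Uniqueness.
Context {R : realType} {d k : nat}.

Lemma controlled_norm_fin p T X (Y : R -> 'rV[R]_k) (DY : R -> 'M[R]_(d, k)) :
  controlled p T X Y DY -> controlled_norm p T X Y DY \is a fin_num.
Proof.
move=> [_ [_ v1] [_ v2]]; rewrite ge0_fin_numE; last by rewrite !adde_ge0 // ?lee_fin // poweR_ge0.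
by rewrite /controlled_norm !lte_add_pinfty // ltry.
Qed.

Lemma Cbnorm2_fin (f : 'rV[R]_k -> 'M[R]_(d, k)) : Cb 3 f -> Cbnorm 2 f \is a fin_num.
Proof.
move=> Cf; rewrite ge0_fin_numE ?Cbnorm_ge0 //.
by apply: le_lt_trans (Cbnorm_leS 2 f) _; rewrite -ge0_fin_numE ?Cbnorm_ge0 // Cbnorm_fin.
Qed.

(** Each solution has a finite norm, so a common [B] exists, and stability with equal data applies
    for every positive distance. *)
Lemma RDE_unique p T f y0 X XX Y1 Y2 (Y1' Y2' : R -> 'M[R]_(d, k)) :
  2 < p < 3 -> 0 < T -> Cb 3 f -> rough_path p T X XX ->
  RDE_solution p T f y0 X XX Y1 Y1' -> RDE_solution p T f y0 X XX Y2 Y2' ->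
  forall t, 0 <= t <= T -> Y1 t = Y2 t /\ Y1' t = Y2' t.
Proof.
move=> /andP[p2 p3] T0 Cf rp s1 s2 t tT.
have [[cY1 D1 _] [cY2 D2 _]] := (s1, s2).
suff Y12 : Y1 t = Y2 t by rewrite D1 ?D2 // Y12.
have [B [B1 Bf BX B1' B2']] := common_bound (fine (Cbnorm 3 f)) (fine (rough_norm p T X XX))
  (fine (controlled_norm p T X Y1 Y1')) (fine (controlled_norm p T X Y2 Y2')).
have q03 : 0 < p < 3 by rewrite p3 andbT (lt_trans _ p2).
have [C C0 HC] := @RDE_stability R d k p B q03 B1.
have le x : x \is a fin_num -> fine x <= B -> (x <= B%:E)%E.
  by move=> xf; rewrite -lee_fin fineK.
have fB : (Cbnorm 3 f <= B%:E)%E by apply: le Bf; exact: Cbnorm_fin.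
have XB : (rough_norm p T X XX <= B%:E)%E. by apply: le BX; exact: rough_path_norm rp.
have Y1B : (controlled_norm p T X Y1 Y1' <= B%:E)%E. by apply: le B1'; exact: controlled_norm_fin.
have Y2B : (controlled_norm p T X Y2 Y2' <= B%:E)%E. by apply: le B2'; exact: controlled_norm_fin.
have dd : (rough_dist p T X XX X XX <= 0)%E.
  have p0 : 0 < p by case/andP: q03.
  have -> : 0%E = (0 + 0)%E :> \bar R by rewrite adde0.
  apply: leeD; apply: var2_0; rewrite ?divr_gt0 ?(ltW T0) //.
    by move=> s u _ _ _; rewrite /incr !subrr.
  by move=> s u _ _ _; rewrite subrr.
apply/eqP; rewrite -subr_eq0 -normr_le0; apply/ler_addgt0Pr => e e0; rewrite add0r.
have ep0 : 0 < e / (C + 1) by rewrite divr_gt0 // ltr_wpDl.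
have yy : `|y0 - y0| <= e / (C + 1) by rewrite subrr normr0 ltW.
have ff : (Cbnorm 2 (fun x => (f x - f x)%R) <= (e / (C + 1))%:E)%E.
  by rewrite Cbnorm_subrr lee_fin ltW.
have dd' : (rough_dist p T X XX X XX <= (e / (C + 1))%:E)%E.
  by apply: le_trans dd _; rewrite lee_fin ltW.
have [H _] := HC p T _ _ _ _ _ _ _ _ _ _ _ _ _ p2 (lexx p) T0 ep0 Cf Cf fB fB rp rp XB XB
  s1 s2 Y1B Y2B yy ff dd'.
apply: le_trans (H t tT) _.
by rewrite mulrA ler_pdivrMr ?ltr_wpDl // mulrDr mulr1 mulrC lerDl ltW.
Qed.

End Uniqueness.

Lemma parameter_size_bound {R : realType} (p a b c e m : R) :
  p < 3 -> parameter_size (p, a, b, c, e) <= m ->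
  [/\ (3 - p)^-1 <= m, a <= m, b <= m, c <= m & e <= m].
Proof.
move=> p3; have p0 : 0 <= (3 - p)^-1 by rewrite invr_ge0 subr_ge0 ltW.
rewrite /parameter_size /=.
have := ler_norm a; have := ler_norm b; have := ler_norm c; have := ler_norm e.
move: (normr_ge0 a) (normr_ge0 b) (normr_ge0 c) (normr_ge0 e).
by move: p0; clear; move: (_^-1) => ?; split; lra.
Qed.

Theorem corollary3p1 (R : realType) (d k : nat) :
  (forall p : R, 2 < p < 3 ->
     exists Kp : R -> R -> R,
       [/\ forall a b, 0 <= a -> 0 <= b -> 0 <= Kp a b,
           forall a b a' b', 0 <= a <= a' -> 0 <= b <= b' ->
             Kp a b <= Kp a' b' &
           forall (T : R) (y0 : 'rV[R]_k)
             (X : R -> 'rV[R]_d) (XX : R -> R -> 'M[R]_d)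
             (f : 'rV[R]_k -> 'M[R]_(d, k)),
             0 < T -> rough_path p T X XX -> Cb 3 f ->
             exists (Y : R -> 'rV[R]_k) (Y' : R -> 'M[R]_(d, k)),
               [/\ RDE_solution p T f y0 X XX Y Y',
                   forall (Z : R -> 'rV[R]_k) (Z' : R -> 'M[R]_(d, k)),
                     RDE_solution p T f y0 X XX Z Z' ->
                     forall t, 0 <= t <= T -> Z t = Y t /\ Z' t = Y' t &
                   (controlled_norm p T X Y Y' <=
                      (Kp (fine (Cbnorm 2 f)) (fine (rough_norm p T X XX)))%:E)%E]])
  /\
  (exists C : R * R * R * R * R -> R,
     [locally [bounded C z | z in `]2, 3[%classic `*` `[0, +oo[%classic
        `*` `]0, +oo[%classic `*` `[0, +oo[%classic `*` `[0, +oo[%classic]] /\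
     forall (p : R) (T : R) (K : R)
       (y0 y0' : 'rV[R]_k) (f f' : 'rV[R]_k -> 'M[R]_(d, k))
       (X1 X2 : R -> 'rV[R]_d) (XX1 XX2 : R -> R -> 'M[R]_d)
       (Y1 Y2 : R -> 'rV[R]_k) (Y1' Y2' : R -> 'M[R]_(d, k)),
       2 < p < 3 -> 0 < T -> 0 < K ->
       Cb 3 f -> Cb 3 f' ->
       rough_path p T X1 XX1 -> rough_path p T X2 XX2 ->
       RDE_solution p T f y0 X1 XX1 Y1 Y1' ->
       RDE_solution p T f' y0' X2 XX2 Y2 Y2' ->
       (controlled_norm p T X1 Y1 Y1' <= K%:E)%E ->
       (controlled_norm p T X2 Y2 Y2' <= K%:E)%E ->
       (`|Y1 0 - Y2 0|%:E + controlled_dist p T X1 Y1 Y1' X2 Y2 Y2' <=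
          (C (p, Num.max (fine (Cbnorm 3 f)) (fine (Cbnorm 3 f')), K,
              fine (rough_norm p T X1 XX1), fine (rough_norm p T X2 XX2)))%:E *
          (`|y0 - y0'|%:E + Cbnorm 2 (fun x => (f x - f' x)%R)
           + rough_dist p T X1 XX1 X2 XX2))%E).
Proof.
split.
  move=> p p23; have p2 : 2 < p by case/andP: p23.
  have /choice[c Hc] : forall n : nat, exists C : R, 0 <= C /\
      forall T (y0 : 'rV[R]_k) (X : R -> 'rV[R]_d) XX f, 0 < T -> rough_path p T X XX -> Cb 3 f ->
      (Cbnorm 2 f <= n.+1%:R%:E)%E -> (rough_norm p T X XX <= n.+1%:R%:E)%E ->
      exists2 Y, RDE_solution p T f y0 X XX Y (fun t => f (Y t)) &
        (controlled_norm p T X Y (fun t => f (Y t)) <= C%:E)%E.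
    move=> n; have [C C0 HC] := @RDE_existence R d k p n.+1%:R n.+1%:R p23 (ler0n R _) (ltr0Sn R n).
    by exists C.
  have c0 n : 0 <= c n by have [] := Hc n.
  exists (fun a b => majorant c (a + b)); split.
  - by move=> a b _ _; exact: majorant_ge0.
  - by move=> a b a' b' /andP[_ aa] /andP[_ bb]; apply: majorant_mono => //; exact: lerD.
  move=> T y0 X XX f T0 rp Cf.
  set a := fine _; set b := fine _; pose n := Num.truncn (a + b).
  have a0 : 0 <= a by rewrite fine_ge0 // Cbnorm_ge0.
  have b0 : 0 <= b by rewrite fine_ge0 // rough_norm_ge0.
  (* [truncn] rounds down, so the constant [c n] is the one for parameters up to [n.+1]. *)
  have abn : a + b <= n.+1%:R by apply: ltW; exact: truncnS_gt.
  have [|| Y sY nY] := (Hc n).2 T y0 X XX f T0 rp Cf.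
  - rewrite -(fineK (Cbnorm2_fin Cf)) lee_fin; apply: le_trans abn; rewrite lerDl //.
  - rewrite -(fineK (rough_path_norm rp)) lee_fin; apply: le_trans abn; rewrite lerDr //.
  exists Y, (fun t => f (Y t)); split=> //.
    by move=> Z Z' sZ t tT; exact: (RDE_unique p23 T0 Cf rp sZ sY tT).
  by apply: le_trans nY _; rewrite lee_fin; exact: majorant_ge.
(* These exponents exhaust the range below 3, and [p <= q n] means that the reciprocal of [3 - p] is
   at most [n.+1]. *)
pose q n : R := 3 - n.+1%:R^-1.
have q03 n : 0 < q n < 3.
  have n1 : n.+1%:R^-1 <= 1 :> R by rewrite invf_le1 // ler1n.
  have n0 : 0 < n.+1%:R^-1 :> R by rewrite invr_gt0.
  by rewrite /q; move: (n.+1%:R^-1) n1 n0 => x; lra.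
have /choice[c Hc] : forall n : nat, exists C : R, 0 <= C /\
  forall p T ep y0 y0' (f f' : 'rV[R]_k -> 'M[R]_(d, k)) X1 X2 XX1 XX2 Y1 Y2 Y1' Y2',
  2 < p -> p <= q n -> 0 < T -> 0 < ep -> Cb 3 f -> Cb 3 f' ->
  (Cbnorm 3 f <= n.+1%:R%:E)%E -> (Cbnorm 3 f' <= n.+1%:R%:E)%E ->
  rough_path p T X1 XX1 -> rough_path p T X2 XX2 ->
  (rough_norm p T X1 XX1 <= n.+1%:R%:E)%E -> (rough_norm p T X2 XX2 <= n.+1%:R%:E)%E ->
  RDE_solution p T f y0 X1 XX1 Y1 Y1' -> RDE_solution p T f' y0' X2 XX2 Y2 Y2' ->
  (controlled_norm p T X1 Y1 Y1' <= n.+1%:R%:E)%E ->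
  (controlled_norm p T X2 Y2 Y2' <= n.+1%:R%:E)%E ->
  `|y0 - y0'| <= ep -> (Cbnorm 2 (fun x => (f x - f' x)%R) <= ep%:E)%E ->
  (rough_dist p T X1 XX1 X2 XX2 <= ep%:E)%E ->
  (`|Y1 0 - Y2 0|%:E + controlled_dist p T X1 Y1 Y1' X2 Y2 Y2' <= (C * ep)%:E)%E.
  move=> n; have n1 : 1 <= n.+1%:R :> R by rewrite ler1n.
  have [C C0 HC] := @RDE_stability R d k (q n) n.+1%:R (q03 n) n1.
  exists C; split=> // p T ep y0 y0' f f' X1 X2 XX1 XX2 Y1 Y2 Y1' Y2'.
  move=> h1 h2 h3 h4 h5 h6 h7 h8 h9 h10 h11 h12 h13 h14 h15 h16 h17 h18 h19.
  by have [] := HC _ _ _ _ _ _ _ _ _ _ _ _ _ _ _ h1 h2 h3 h4 h5 h6 h7 h8 h9 h10 h11 h12 h13 h14 h15 h16 h17 h18 h19.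
have c0 n : 0 <= c n by have [] := Hc n.
(* The summand [1] keeps the factor positive, both for an infinite distance of the data and for the
   division below. *)
exists (fun z => majorant c (parameter_size z) + 1); split.
  apply: majorant_locally_bounded => // z [[[[p23 _] _] _] _].
  apply: parameter_size_continuous; move: p23; rewrite /= in_itv /=.
  by case/andP.
move=> p T K y0 y0' f f' X1 X2 XX1 XX2 Y1 Y2 Y1' Y2' /andP[p2 p3] T0 K0 Cf Cf' rp1 rp2 s1 s2 k1 k2.
set z := (p, _, _, _, _); pose n := Num.truncn (parameter_size z).
have zn : parameter_size z <= n.+1%:R by apply: ltW; exact: truncnS_gt.
set C := _ + 1.
have C1 : 1 <= C by rewrite lerDr majorant_ge0.
have cC : c n <= C by apply: le_trans (majorant_ge c0 _) _; rewrite lerDl.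
set r := (_ + rough_dist _ _ _ _ _ _)%E.
have r1 : (`|y0 - y0'|%:E <= r)%E.
  by rewrite /r -addeA leeDl // adde_ge0 ?Cbnorm_ge0 ?rough_norm_ge0.
have r2 : (Cbnorm 2 (fun x => (f x - f' x)%R) <= r)%E.
  by rewrite /r addeAC leeDr // adde_ge0 ?lee_fin ?rough_norm_ge0.
have r3 : (rough_dist p T X1 XX1 X2 XX2 <= r)%E.
  by rewrite /r leeDr // adde_ge0 ?lee_fin ?Cbnorm_ge0.
have r0 : (0 <= r)%E by apply: le_trans r1; rewrite lee_fin.
have [rfin|] := boolP (r \is a fin_num); last first.
  rewrite ge0_fin_numE // -leNgt leye_eq => /eqP ->.
  by rewrite gt0_muley ?leey // lte_fin (lt_le_trans ltr01).
have np : 0 < 3 - p by rewrite subr_gt0.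
have np' : 0 <= (3 - p)^-1 by rewrite invr_ge0 ltW.
have [z1 z2 z3 z4 z5] : [/\ (3 - p)^-1 <= n.+1%:R,
    Num.max (fine (Cbnorm 3 f)) (fine (Cbnorm 3 f')) <= n.+1%:R, K <= n.+1%:R,
    fine (rough_norm p T X1 XX1) <= n.+1%:R & fine (rough_norm p T X2 XX2) <= n.+1%:R].
  exact: parameter_size_bound p3 zn.
have pq : p <= q n.
  rewrite /q lerBrDr addrC -lerBrDr -(invrK (3 - p)) lef_pV2 // posrE ?invr_gt0 //.
have [f1 f2] : fine (Cbnorm 3 f) <= n.+1%:R /\ fine (Cbnorm 3 f') <= n.+1%:R.
  by apply/andP; rewrite -ge_max; exact: z2.
have le x : x \is a fin_num -> fine x <= n.+1%:R -> (x <= n.+1%:R%:E)%E.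
  by move=> xf; rewrite -lee_fin fineK.
apply/lee_addgt0Pr => e e0.
have Cpos : 0 < C by exact: lt_le_trans C1.
have rr0 : 0 <= fine r by rewrite fine_ge0.
(* The distance of the data may be 0 while stability takes a positive [ep]; the enlargement by
   [e / C] costs at most [e] in the end. *)
pose ep := fine r + e / C.
have eC0 : 0 < e / C by rewrite divr_gt0.
have ep0 : 0 < ep by rewrite ltr_wpDl.
have rep : (r <= ep%:E)%E by rewrite -(fineK rfin) lee_fin lerDl ltW.
apply: (@le_trans _ _ (c n * ep)%:E); last first.
  rewrite -(fineK rfin) -EFinM -EFinD lee_fin.
  apply: (@le_trans _ _ (C * ep)); first by rewrite ler_wpM2r // ltW.
  by rewrite /ep mulrDr lerD2l mulrC divfK // gt_eqF.
apply: ((Hc n).2 p T ep y0 y0' f f' X1 X2 XX1 XX2 Y1 Y2 Y1' Y2') => //.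
- exact: le (Cbnorm_fin Cf) f1.
- exact: le (Cbnorm_fin Cf') f2.
- exact: le (rough_path_norm rp1) z4.
- exact: le (rough_path_norm rp2) z5.
- by apply: le_trans k1 _; rewrite lee_fin.
- by apply: le_trans k2 _; rewrite lee_fin.
- by rewrite -lee_fin; exact: le_trans rep.
- exact: le_trans rep.
- exact: le_trans rep.
Qed.
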